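(* Let $\mathfrak M$ be a weight sequence system satisfying $[\mathrm L]$ and $[\mathfrak M.2]'$ and let $\mathscr W$ be a weight function system satisfying $[\mathrm{wM}]$ and $[\mathrm N]$. Then $\mathcal S^{[\mathfrak M]}_{[\mathscr W]}$ is nuclear.
   Context: Notation: $\mathbb N=\{0,1,2,\dots\}$, $\mathbb R_+=(0,\infty)$, $d\ge1$ fixed, $e_j$ the $j$-th standard unit vector. The bracket $[\,\cdot\,]$ stands for either the Beurling case $(\,\cdot\,)$ or the Roumieu case $\{\,\cdot\,\}$, read consistently throughout; the statement is asserted in both cases. Weight sequence system (on $\mathbb N^d$): a family $\mathfrak M=\{M^\lambda\mid\lambda\in\mathbb R_+\}$ of sequences $M^\lambda=(M^\lambda_\alpha)_{\alpha\in\mathbb N^d}$ of positive numbers such that for each $\lambda$: $\lim_{|\alpha|\to\infty}(M^\lambda_\alpha)^{1/|\alpha|}=\infty$ and $(M^\lambda_{\alpha+e_j})^2\le M^\lambda_\alpha M^\lambda_{\alpha+2e_j}$ for all $\alpha\in\mathbb N^d$, $1\le j\le d$; and $M^\lambda_\alpha\le M^\mu_\alpha$ for all $\alpha$ whenever $\lambda\le\mu$. Conditions: - $(\mathrm L)$: $\forall R>0\,\forall\lambda\,\exists\mu\,\exists C>0\,\forall\alpha:\ R^{|\alpha|}M^\mu_\alpha\le CM^\lambda_\alpha$; $\{\mathrm L\}$: $\forall R>0\,\forall\mu\,\exists\lambda\,\exists C>0\,\forall\alpha:\ R^{|\alpha|}M^\mu_\alpha\le CM^\lambda_\alpha$. -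 $(\mathfrak M.2)'$: $\forall\lambda\,\exists\mu\,\exists C,H>0\,\forall\alpha\,\forall j:\ M^\mu_{\alpha+e_j}\le CH^{|\alpha|}M^\lambda_\alpha$; $\{\mathfrak M.2\}'$: $\forall\mu\,\exists\lambda\,\exists C,H>0\,\forall\alpha\,\forall j:\ M^\mu_{\alpha+e_j}\le CH^{|\alpha|}M^\lambda_\alpha$. Weight function system (on $\mathbb R^d$): a family $\mathscr W=\{w^\lambda\mid\lambda\in\mathbb R_+\}$ of continuous functions $w^\lambda:\mathbb R^d\to[1,\infty)$ with $w^\lambda\le w^\mu$ whenever $\mu\le\lambda$. Conditions: - $(\mathrm{wM})$: $\forall\lambda\,\exists\mu\,\exists C>0\,\forall x:\ \sup_{|y|\le1}w^\lambda(x+y)\le Cw^\mu(x)$; $\{\mathrm{wM}\}$: the same with $\forall\mu\,\exists\lambda$ in place of $\forall\lambda\,\exists\mu$. - $(\mathrm N)$: $\forall\lambda\,\exists\mu:\ w^\lambda/w^\mu\in L^1(\mathbb R^d)$; $\{\mathrm N\}$: $\forall\mu\,\exists\lambda:\ w^\lambda/w^\mu\in L^1(\mathbb R^d)$. Spaces: for $q\in[1,\infty]$, $\mathcal S^{M^\lambda}_{w^\lambda,q}$ is the Banach space of $\varphi\in C^\infty(\mathbb R^d)$ with norm $\sup_{\alpha\in\mathbb N^d}\|\varphi^{(\alpha)}w^\lambda\|_{L^q}/M^\lambda_\alpha<\infty$. Then $\mathcal S^{(\mathfrak M)}_{(\mathscr W),q}=\varprojlim_{\lambda\to0^+}\mathcal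 S^{M^\lambda}_{w^\lambda,q}$ and $\mathcal S^{\{\mathfrak M\}}_{\{\mathscr W\},q}=\varinjlim_{\lambda\to\infty}\mathcal S^{M^\lambda}_{w^\lambda,q}$ (locally convex limits). Under the hypotheses $[\mathrm L]$, $[\mathfrak M.2]'$, $[\mathrm{wM}]$, $[\mathrm N]$ these spaces coincide as locally convex spaces for all $q\in[1,\infty]$, and $\mathcal S^{[\mathfrak M]}_{[\mathscr W]}$ denotes this common space (one may take $q=\infty$). *)

(* Defs.v *)
From HB Require Import structures.
From mathcomp Require Import all_boot all_order all_algebra.
From mathcomp Require Import complex.
From mathcomp Require Import all_classical all_reals all_analysis.
Set Implicit Arguments. Unset Strict Implicit. Unset Printing Implicit Defensive.
Import Order.TTheory GRing.Theory Num.Theory numFieldNormedType.Exports.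
Local Open Scope classical_set_scope.
Local Open Scope ring_scope.

Definition seminorm (K : numDomainType) (E : lmodType K) (p : E -> K) : Prop :=
  [/\ forall x, 0 <= p x, forall x y, p (x + y) <= p x + p y
    & forall a x, p (a *: x) = `|a| * p x].

Record seminorms (K : numDomainType) (E : lmodType K) := Seminorms {
  in_seminorms : set (E -> K);
  seminormsP : forall p, in_seminorms p -> seminorm p }.

(* [E] with the locally convex topology generated by the family [Gamma]: the
   balls of the finite sums of members of [Gamma] form a basis of the topology,
   and the family need not be directed. *)
Definition seminormed (K : numFieldType) (E : lmodType K)
  (Gamma : seminorms E) : Type := E.

Section seminormed.
Variables (K : numFieldType) (E : lmodType K) (Gamma : seminorms E).

Local Notation T := (seminormed Gamma).

HB.instance Definition _ := GRing.Lmodule.copy T E.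

Definition finite_sum (s : seq {p | in_seminorms Gamma p}) (x : E) : K :=
  \sum_(p <- s) sval p x.

Definition seminormed_ball (s : seq {p | in_seminorms Gamma p}) (x : T) (e : K) :
  set T := [set y | finite_sum s (y - x) < e].

Definition seminormed_nbhs (x : T) : set_system T :=
  [set A | exists s, exists2 e, 0 < e & seminormed_ball s x e `<=` A].

Lemma finite_sum_seminorm s : seminorm (finite_sum s).
Proof.
split=> [x|x y|a x]; rewrite /finite_sum.
- by apply: sumr_ge0 => -[p /= /seminormsP[]].
- by rewrite -big_split/=; apply: ler_sum => -[p /= /seminormsP[]].
- by rewrite mulr_sumr; apply: eq_bigr => -[p /= /seminormsP[]].
Qed.

Lemma finite_sum0 s : finite_sum s 0 = 0.
Proof. by have [_ _ h] := finite_sum_seminorm s; rewrite -(scale0r 0) h normr0 mul0r. Qed.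

Let ball_center s (x : T) e : 0 < e -> seminormed_ball s x e x.
Proof. by move=> e0; rewrite /seminormed_ball/= subrr finite_sum0. Qed.

Let ball_sub s (x y : T) e : seminormed_ball s x e y ->
  seminormed_ball s y (e - finite_sum s (y - x)) `<=` seminormed_ball s x e.
Proof.
move=> xy z; rewrite /seminormed_ball/= ltrBrDr; apply: le_lt_trans.
have [_ tri _] := finite_sum_seminorm s.
by rewrite -[leLHS]/(finite_sum s (z - x)) -(subrKA y) tri.
Qed.

HB.instance Definition _ := hasNbhs.Build T seminormed_nbhs.

Let seminormed_filter (x : T) : ProperFilter (nbhs x).
Proof.
split.
  by case=> s [e e0 /(_ x)]; apply; exact: ball_center.
split; first by exists [::], 1.
- move=> A B [s [e e0 sA]] [t [f f0 tB]].
  have ef : e >=< f by rewrite real_comparable// gtr0_real.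
  exists (s ++ t), (Num.min e f); first by rewrite comparable_lt_min// e0 f0.
  have [s0 _ _] := finite_sum_seminorm s; have [t0 _ _] := finite_sum_seminorm t.
  move=> y; rewrite /seminormed_ball/= /finite_sum big_cat/= comparable_lt_min//.
  move=> /andP[ye yf]; split; [apply: sA|apply: tB].
    by apply: le_lt_trans ye; rewrite lerDl; exact: t0.
  by apply: le_lt_trans yf; rewrite lerDr; exact: s0.
- by move=> A B AB [s [e e0 sA]]; exists s, e => //; exact: subset_trans sA AB.
Qed.

Let seminormed_singleton (x : T) A : nbhs x A -> A x.
Proof. by case=> s [e e0]; apply; exact: ball_center. Qed.

Let ball_nbhs s (x : T) e (y : T) :
  seminormed_ball s x e y -> nbhs y (seminormed_ball s x e).
Proof.
by move=> xy; exists s, (e - finite_sum s (y - x));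
  [rewrite subr_gt0|exact: ball_sub].
Qed.

Let seminormed_nbhs_nbhs (x : T) A : nbhs x A -> nbhs x (nbhs^~ A).
Proof.
case=> s [e e0 sA]; exists s, e => // y /ball_nbhs [t [f f0 tB]].
by exists t, f => //; exact: subset_trans tB sA.
Qed.

HB.instance Definition _ := Nbhs_isNbhsTopological.Build T
  seminormed_filter seminormed_singleton seminormed_nbhs_nbhs.

Let seminormed_add : continuous (fun z : T * T => z.1 + z.2).
Proof.
move=> [x y] A [s [e e0 sA]].
have e20 : 0 < e / 2 by rewrite divr_gt0.
exists (seminormed_ball s x (e / 2), seminormed_ball s y (e / 2)).
  by split; exists s, (e / 2).
move=> [u v] [/= xu yv]; apply: sA; rewrite /seminormed_ball/= opprD addrACA.
have [_ tri _] := finite_sum_seminorm s.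
by apply: (le_lt_trans (tri _ _)); rewrite (splitr e) ltrD.
Qed.

Let seminormed_scale : continuous (fun z : K^o * T => z.1 *: z.2).
Proof.
move=> [k x] A [s [e e0 sA]].
have [s0 tri hom] := finite_sum_seminorm s.
have k0 : 0 < `|k| + 1 by rewrite ltr_wpDl.
have x0 : 0 < finite_sum s x + 1 by rewrite ltr_wpDl// s0.
have e20 : 0 < e / 2 by rewrite divr_gt0.
pose r := Num.min 1 (e / 2 / (finite_sum s x + 1)).
have cmp : 1 >=< e / 2 / (finite_sum s x + 1).
  by rewrite real_comparable ?gtr0_real// divr_gt0.
have r0 : 0 < r by rewrite comparable_lt_min// ltr01 divr_gt0.
exists (ball (k : K^o) r, seminormed_ball s x (e / 2 / (`|k| + 1))).
  split; first exact: nbhsx_ballx.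
  by exists s, (e / 2 / (`|k| + 1)); rewrite // divr_gt0.
move=> [l z] [/= kl xz]; apply: sA; rewrite /seminormed_ball/=.
move: kl; rewrite -ball_normE/= comparable_lt_min// => /andP[kl1 kl2].
have -> : l *: z - k *: x = l *: (z - x) + (l - k) *: x :> E.
  by rewrite scalerBr scalerBl addrA subrK.
apply: (le_lt_trans (tri _ _)); rewrite !hom (splitr e); apply: ltr_leD.
  apply: (@le_lt_trans _ _ ((`|k| + 1) * finite_sum s (z - x))).
    apply: ler_wpM2r; first exact: s0.
    rewrite -[l](subrK k) addrC (le_trans (ler_normD _ _))// lerD2l.
    by rewrite distrC ltW.
  by rewrite mulrC -ltr_pdivlMr.
rewrite distrC; apply: (@le_trans _ _ (`|k - l| * (finite_sum s x + 1))).
  by rewrite ler_wpM2l// lerDl.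
by rewrite -ler_pdivlMr// ltW.
Qed.

Local Open Scope convex_scope.

Let seminormed_locally_convex : exists2 B : set_system T,
  (forall b, b \in B -> convex_set b) & basis B.
Proof.
exists [set B | exists s x e, B = seminormed_ball s x e].
  move=> B /[!inE]/= -[s [x [e ->]]].
  apply/convex_setW => y z; rewrite !inE /seminormed_ball/= => xy xz l l0 l1.
  rewrite inE /seminormed_ball/=; have [_ tri hom] := finite_sum_seminorm s.
  have -> : y <| l |> z - x = l%:num *: (y - x) + (1 - l%:num) *: (z - x) :> E.
    rewrite [y <| l |> z]/(l%:num *: (y : E) + (1 - l%:num) *: (z : E)).
    by rewrite !scalerBr addrACA -opprD -scalerDl (addrC l%:num) subrK scale1r.
  have l1p : 0 < (1 - l%:num) by rewrite subr_gt0.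
  apply: (le_lt_trans (tri _ _)); rewrite !hom !gtr0_norm//.
  have -> : e = l%:num * e + (1 - l%:num) * e.
    by rewrite -mulrDl (addrC l%:num) subrK mul1r.
  by rewrite ltrD// ltr_pM2l.
split=> [B [s [x [e ->]]]|x A [s [e e0 sA]]].
  by rewrite openE => y /ball_nbhs.
by exists (seminormed_ball s x e) => //; split; [exists s, x, e|exact: ball_center].
Qed.

HB.instance Definition _ := PreTopologicalLmod_isTvs.Build K T
  seminormed_add seminormed_scale seminormed_locally_convex.
HB.instance Definition _ :=
  PreTopologicalNmodule_isTopologicalNmodule.Build T seminormed_add.
HB.instance Definition _ :=
  TopologicalNmodule_isTopologicalLmodule.Build K T seminormed_scale.
HB.instance Definition _ :=
  Uniform_isTvs.Build K T seminormed_locally_convex.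

End seminormed.

(* [X], with the map [i], is the completion of [E] with respect to the seminorm
   [p], i.e. the local Banach space of [p]; it is the completion of
   [E / p^-1(0)], and is unique up to isometric isomorphism. *)
Definition is_completion (K : numFieldType) (E : lmodType K) (p : E -> K)
    (X : completeNormedModType K) (i : {linear E -> X}) : Prop :=
  (forall x, `|i x| = p x) /\ dense (range i).

Definition nuclear_operator (K : numFieldType) (X Y : normedModType K)
    (T : X -> Y) : Prop :=
  exists (c : nat -> K) (f : nat -> {linear X -> K^o}) (y : nat -> Y),
    [/\ cvgn (series (fun n => `|c n| : K^o)),
        forall n x, `|f n x| <= `|x|,
        forall n, `|y n| <= 1
      & forall x, series (fun n => (c n * f n x) *: y n) @ \oo --> T x].

(* Grothendieck's definition: every continuous seminorm [p] is dominated by a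
   continuous seminorm [q] for which the canonical map between the local Banach
   spaces of [q] and [p] is nuclear. As local Banach spaces are determined up to
   isometric isomorphism, it is immaterial which completions are considered. *)
Definition nuclear_space (K : numFieldType) (E : tvsType K) : Prop :=
  forall p : E -> K, seminorm p -> continuous (p : E -> K^o) ->
  exists q : E -> K, [/\ seminorm q, continuous (q : E -> K^o),
    forall x, p x <= q x &
    forall (X Y : completeNormedModType K) (i : {linear E -> X})
        (j : {linear E -> Y}),
      is_completion q i -> is_completion p j ->
      exists T : {linear X -> Y},
        (forall x, T (i x) = j x) /\ nuclear_operator T].

Section lebesgue_step.
Variables (R : realType) (n : nat).
Variable m : {sigma_finite_measure set (n.-tuple (measurableTypeR R)) -> \bar R}.

Definition tuple_cons (z : measurableTypeR R * n.-tuple (measurableTypeR R)) :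
  n.+1.-tuple (measurableTypeR R) := [tuple of z.1 :: z.2].

Lemma measurable_tuple_cons : measurable_fun [set: _] tuple_cons.
Proof. exact: measurable_cons. Qed.

Definition lebesgue_step :=
  pushforward ((@lebesgue_measure R) \x m)%E tuple_cons.

Let step0 : lebesgue_step set0 = 0%E.
Proof. by rewrite /lebesgue_step /pushforward preimage_set0 measure0. Qed.

Let step_ge0 A : (0 <= lebesgue_step A)%E.
Proof. by rewrite /lebesgue_step /pushforward measure_ge0. Qed.

Let step_additive : semi_sigma_additive lebesgue_step.
Proof. by apply: measure_semi_sigma_additive; exact: measurable_tuple_cons. Qed.

HB.instance Definition _ := isMeasure.Build _ _ _ lebesgue_step
  step0 step_ge0 step_additive.

Let step_sigma_finite : sigma_finite setT lebesgue_step.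
Proof.
have /sigma_finiteP[F [TF ndF Foo]] := sigma_finiteT (@lebesgue_measure R).
have /sigma_finiteP[G [TG ndG Goo]] := sigma_finiteT m.
pose uncons (t : n.+1.-tuple (measurableTypeR R)) :=
  (thead t, [tuple of behead t]).
have uncons_cons z : uncons (tuple_cons z) = z.
  by case: z => x t; congr (_, _); exact/val_inj.
have muncons : measurable_fun [set: _] uncons.
  by apply/measurable_fun_pair; [exact: measurable_tnth|exact: measurable_behead].
exists (fun k => uncons @^-1` (F k `*` G k)).
  apply/seteqP; split=> // t _.
  have [i _ Fi] : (\bigcup_i F i) (thead t) by rewrite -TF.
  have [j _ Gj] : (\bigcup_i G i) [tuple of behead t] by rewrite -TG.
  exists (maxn i j) => //; split=> /=.
    by move: (_ t) Fi; exact/subsetPset/ndF/leq_maxl.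
  by move: [tuple of behead t] Gj; exact/subsetPset/ndG/leq_maxr.
move=> k; have [mF Fk] := Foo k; have [mG Gk] := Goo k; split.
  by rewrite -[X in measurable X]setTI; apply: muncons => //; exact: measurableX.
rewrite /lebesgue_step /pushforward -comp_preimage.
rewrite (_ : uncons \o tuple_cons = id) ?preimage_id; last exact/funext.
by rewrite product_measure1E// lte_mul_pinfty// ge0_fin_numE.
Qed.

HB.instance Definition _ := Measure_isSigmaFinite.Build _ _ _ lebesgue_step
  step_sigma_finite.
End lebesgue_step.

(* Lebesgue measure on [R^n]: the image of the product of the Lebesgue measures
   on [R] and [R^(n-1)] under [tuple_cons]. *)
Fixpoint lebesgue_tuple (R : realType) (n : nat) :
    {sigma_finite_measure set (n.-tuple (measurableTypeR R)) -> \bar R} :=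
  match n with
  | 0 => \d_ [tuple]
  | n'.+1 => lebesgue_step (lebesgue_tuple R n')
  end.

Section spaces.
Variables (R : realType) (d : nat).

Definition multi_index := {ffun 'I_d -> nat}.
Implicit Types (a : multi_index) (x : 'rV[R]_d) (lam mu : {posnum R}).

Definition mi_deg a : nat := (\sum_i a i)%N.
Definition mi_unit (j : 'I_d) : multi_index := [ffun i => (i == j) : nat].

Record weight_sequence_system := WeightSequenceSystem {
  wseq :> {posnum R} -> multi_index -> R;
  wseq_gt0 : forall lam a, 0 < wseq lam a;
  wseq_root_pinfty : forall lam (A : R), exists N : nat, forall a,
    (N <= mi_deg a)%N -> A <= wseq lam a `^ (mi_deg a)%:R^-1;
  wseq_log_convex : forall lam a j,
    wseq lam (a + mi_unit j) ^+ 2 <=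
    wseq lam a * wseq lam (a + mi_unit j *+ 2);
  wseq_mono : forall lam mu, lam%:num <= mu%:num ->
    forall a, wseq lam a <= wseq mu a }.

Record weight_function_system := WeightFunctionSystem {
  wfun :> {posnum R} -> 'rV[R]_d -> R;
  wfun_continuous : forall lam, continuous (wfun lam);
  wfun_ge1 : forall lam x, 1 <= wfun lam x;
  wfun_anti : forall lam mu, mu%:num <= lam%:num ->
    forall x, wfun lam x <= wfun mu x }.

(* The indices of both systems range over the positive reals. The Beurling and
   the Roumieu version of a condition differ in which of the two indices is
   universally quantified. *)
Variant bracket := Beurling | Roumieu.

Definition bracketed (c : bracket) (P : {posnum R} -> {posnum R} -> Prop) :=
  match c with
  | Beurling => forall lam, exists mu, P lam mu
  | Roumieu => forall mu, exists lam, P lam mu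
  end.

Definition cond_L (c : bracket) (M : weight_sequence_system) :=
  forall r : R, 0 < r -> bracketed c (fun lam mu =>
    exists2 C : R, 0 < C &
      forall a, r ^+ mi_deg a * M mu a <= C * M lam a).

Definition cond_M2' (c : bracket) (M : weight_sequence_system) :=
  bracketed c (fun lam mu => exists C H : R, [/\ 0 < C, 0 < H &
    forall a j, M mu (a + mi_unit j) <= C * H ^+ mi_deg a * M lam a]).

(* The unit ball is the Euclidean one; the library norm on ['rV[R]_d] is the
   maximum norm. *)
Definition cond_wM (c : bracket) (W : weight_function_system) :=
  bracketed c (fun lam mu => exists2 C : R, 0 < C &
    forall x y : 'rV[R]_d, Num.sqrt (\sum_i y 0 i ^+ 2) <= 1 ->
      W lam (x + y) <= C * W mu x).

Definition cond_N (c : bracket) (W : weight_function_system) :=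
  bracketed c (fun lam mu => (lebesgue_tuple R d).-integrable setT
    (fun t => let x := \row_i tnth t i in (W lam x / W mu x)%:E)).

Definition partial (s : seq 'I_d) (f : 'rV[R]_d -> R) : 'rV[R]_d -> R :=
  foldr (fun j g => 'D_(delta_mx 0 j) g) f s.

Definition smooth (f : 'rV[R]_d -> R) := forall s,
  continuous (partial s f) /\
  forall j x, derivable (partial s f) x (delta_mx 0 j).

(* Derivatives of complex-valued functions are taken componentwise, since [R[i]]
   carries no [normedModType R] structure. *)
Definition re (phi : 'rV[R]_d -> R[i]) x : R := complex.Re (phi x).
Definition im (phi : 'rV[R]_d -> R[i]) x : R := complex.Im (phi x).

Definition smoothC (phi : 'rV[R]_d -> R[i]) :=
  smooth (re phi) /\ smooth (im phi).

Definition mi_seq a : seq 'I_d := flatten [seq nseq (a j) j | j <- enum 'I_d].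

Definition mi_partial a (phi : 'rV[R]_d -> R[i]) x : R[i] :=
  Complex (partial (mi_seq a) (re phi) x) (partial (mi_seq a) (im phi) x).

Variables (M : weight_sequence_system) (W : weight_function_system).

(* The norm for [q = oo]; the essential supremum of a continuous function with
   respect to Lebesgue measure is its supremum. *)
Definition gs_norm lam (phi : 'rV[R]_d -> R[i]) : \bar R :=
  ereal_sup (range (fun ax : multi_index * 'rV[R]_d =>
    (Normc.normc (mi_partial ax.1 phi ax.2) * W lam ax.2 /
      M lam ax.1)%:E)).

Definition gs_step lam : set ('rV[R]_d -> R[i]) :=
  [set phi | smoothC phi /\ (gs_norm lam phi < +oo)%E].

Definition gs_set (c : bracket) : set ('rV[R]_d -> R[i]) :=
  match c with
  | Beurling => \bigcap_lam gs_step lam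
  | Roumieu => \bigcup_lam gs_step lam
  end.

Lemma partialZ (u : R) f s : smooth f -> partial s (u *: f) = u *: partial s f.
Proof.
move=> sf; elim: s => // j s IH /=; rewrite IH; apply/funext => x.
by have [_ /(_ j x) df] := sf s; rewrite deriveZ.
Qed.

Lemma partialD f g s : smooth f -> smooth g ->
  partial s (f + g) = partial s f + partial s g.
Proof.
move=> sf sg; elim: s => // j s IH /=; rewrite IH; apply/funext => x.
have [_ /(_ j x) df] := sf s; have [_ /(_ j x) dg] := sg s.
by rewrite deriveD.
Qed.

Lemma smoothZ (u : R) f : smooth f -> smooth (u *: f).
Proof.
move=> sf s; rewrite partialZ//; have [cf df] := sf s; split=> [x|j x].
  exact: (cvgZl_tmp (cf x)).
by apply: derivableZ; exact: df.
Qed.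

Lemma smoothD f g : smooth f -> smooth g -> smooth (f + g).
Proof.
move=> sf sg s; rewrite partialD//.
have [cf df] := sf s; have [cg dg] := sg s; split=> [x|j x].
  exact: (cvgD (cf x) (cg x)).
by apply: derivableD; [exact: df|exact: dg].
Qed.

Lemma partial0 s : partial s 0 = 0.
Proof. by elim: s => //= j s ->; apply/funext => x; rewrite derive_cst. Qed.

Lemma smooth0 : smooth 0.
Proof.
move=> s; rewrite partial0; split=> [|j x]; last exact: derivable_cst.
exact: cst_continuous.
Qed.

Lemma reZ (z : R[i]) phi :
  re (z *: phi) = complex.Re z *: re phi + (- complex.Im z) *: im phi.
Proof.
apply/funext => x; rewrite /re /im !fctE.
by case: z (phi x) => [u v] [p q]; rewrite /GRing.scale/= mulNr.
Qed.

Lemma imZ (z : R[i]) phi :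
  im (z *: phi) = complex.Re z *: im phi + complex.Im z *: re phi.
Proof.
apply/funext => x; rewrite /re /im !fctE.
by case: z (phi x) => [u v] [p q].
Qed.

Lemma reD phi psi : re (phi + psi) = re phi + re psi.
Proof. by apply/funext => x; rewrite /re !fctE; case: (phi x) (psi x) => [? ?] []. Qed.

Lemma imD phi psi : im (phi + psi) = im phi + im psi.
Proof. by apply/funext => x; rewrite /im !fctE; case: (phi x) (psi x) => [? ?] []. Qed.

Lemma smoothC0 : smoothC 0.
Proof. by split; exact: smooth0. Qed.

Lemma smoothCD phi psi : smoothC phi -> smoothC psi -> smoothC (phi + psi).
Proof. by move=> [? ?] [? ?]; split; rewrite ?reD ?imD; exact: smoothD. Qed.

Lemma smoothCZ z phi : smoothC phi -> smoothC (z *: phi).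
Proof.
by move=> [? ?]; split; rewrite ?reZ ?imZ; apply: smoothD; exact: smoothZ.
Qed.

Lemma mi_partial0 a x : mi_partial a 0 x = 0.
Proof. by rewrite /mi_partial [re 0](_ : _ = 0)// [im 0](_ : _ = 0)// partial0. Qed.

Lemma mi_partialD a phi psi x : smoothC phi -> smoothC psi ->
  mi_partial a (phi + psi) x = mi_partial a phi x + mi_partial a psi x.
Proof. by move=> [? ?] [? ?]; rewrite /mi_partial reD imD !partialD. Qed.

Lemma mi_partialZ a z phi x : smoothC phi ->
  mi_partial a (z *: phi) x = z * mi_partial a phi x.
Proof.
move=> [? ?]; rewrite /mi_partial reZ imZ !partialD ?partialZ//; try exact: smoothZ.
by case: z => u v; rewrite !fctE /GRing.scale/= mulNr.
Qed.

Local Notation normc := Normc.normc.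

Lemma normc_ge0 (z : R[i]) : 0 <= normc z.
Proof. by case: z => u v; exact: sqrtr_ge0. Qed.

Let weight_ge0 lam a x : 0 <= W lam x / M lam a.
Proof. by rewrite divr_ge0// ltW ?wseq_gt0// (lt_le_trans ltr01)// wfun_ge1. Qed.

Lemma gs_norm_ub lam phi a x :
  ((normc (mi_partial a phi x) * W lam x / M lam a)%:E <= gs_norm lam phi)%E.
Proof. by apply: ereal_sup_ubound; exists (a, x). Qed.

Lemma gs_norm_ge0 lam phi : (0 <= gs_norm lam phi)%E.
Proof.
apply: le_trans (gs_norm_ub lam phi 0 0).
by rewrite lee_fin -mulrA mulr_ge0// normc_ge0.
Qed.

Lemma gs_norm0 lam : gs_norm lam 0 = 0%E.
Proof.
apply/eqP; rewrite eq_le gs_norm_ge0 andbT; apply: ub_ereal_sup => _ [[a x] _ <-].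
by rewrite mi_partial0 Normc.normc0 !mul0r.
Qed.

Lemma gs_normD lam phi psi : smoothC phi -> smoothC psi ->
  (gs_norm lam (phi + psi)%R <= gs_norm lam phi + gs_norm lam psi)%E.
Proof.
move=> sphi spsi; apply: ub_ereal_sup => _ [[a x] _ <-].
rewrite mi_partialD//.
apply: le_trans (leeD (gs_norm_ub lam phi a x) (gs_norm_ub lam psi a x)).
rewrite -EFinD lee_fin -!mulrA -mulrDl ler_wpM2r//.
exact: le_normcD.
Qed.

Lemma gs_normZ_le lam z phi : smoothC phi ->
  (gs_norm lam (z *: phi)%R <= (normc z)%:E * gs_norm lam phi)%E.
Proof.
move=> sphi; apply: ub_ereal_sup => _ [[a x] _ <-].
rewrite mi_partialZ//.
apply: le_trans (lee_wpmul2l _ (gs_norm_ub lam phi a x)).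
  by rewrite -EFinM lee_fin Normc.normcM !mulrA.
by rewrite lee_fin normc_ge0.
Qed.

Lemma gs_normZ lam z phi : smoothC phi ->
  gs_norm lam (z *: phi) = ((normc z)%:E * gs_norm lam phi)%E.
Proof.
move=> sphi; apply/eqP; rewrite eq_le gs_normZ_le//=.
have [->|z0] := eqVneq z 0.
  by rewrite scale0r gs_norm0 Normc.normc0 mul0e.
have nz0 : 0 < normc z.
  rewrite lt_neqAle normc_ge0 andbT eq_sym; apply: contra z0 => /eqP.
  by move/Normc.eq0_normc => ->.
have := gs_normZ_le lam z^-1 (smoothCZ z sphi).
rewrite scalerA mulVf// scale1r => h.
apply: le_trans (lee_wpmul2l _ h) _; first by rewrite lee_fin ltW.
by rewrite muleA -EFinM Normc.normcV mulfV ?gt_eqF// mul1e.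
Qed.

End spaces.

Section gelfand_shilov.
Variables (R : realType) (d : nat) (M : weight_sequence_system R d)
  (W : weight_function_system R d).
Local Notation normc := Normc.normc.
Implicit Types lam mu : {posnum R}.

Lemma gs_step_submod lam : [/\ gs_step M W lam 0,
  forall phi psi, gs_step M W lam phi -> gs_step M W lam psi ->
    gs_step M W lam (phi + psi)
  & forall z phi, gs_step M W lam phi -> gs_step M W lam (z *: phi)].
Proof.
split=> [|phi psi [sphi nphi] [spsi npsi]|z phi [sphi nphi]].
- by split; [exact: smoothC0|rewrite gs_norm0 ltry].
- split; first exact: smoothCD.
  by apply: le_lt_trans (gs_normD _ _ _ sphi spsi) _; rewrite lte_add_pinfty.
- split; first exact: smoothCZ.
  by rewrite gs_normZ// lte_mul_pinfty// lee_fin normc_ge0.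
Qed.

Lemma gs_norm_anti lam mu phi : lam%:num <= mu%:num ->
  (gs_norm M W mu phi <= gs_norm M W lam phi)%E.
Proof.
move=> lm; apply: ub_ereal_sup => _ [[a x] _ <-] /=.
apply: le_trans (gs_norm_ub _ _ _ _ a x).
rewrite lee_fin; apply: ler_pM.
- by rewrite mulr_ge0 ?normc_ge0// (le_trans ler01)// wfun_ge1.
- by rewrite invr_ge0 ltW// wseq_gt0.
- by rewrite ler_wpM2l ?normc_ge0// wfun_anti.
- by rewrite lef_pV2 ?posrE ?wseq_gt0// wseq_mono.
Qed.

Lemma gs_step_mono lam mu : lam%:num <= mu%:num ->
  gs_step M W lam `<=` gs_step M W mu.
Proof.
by move=> lm phi [sphi nphi]; split=> //; apply: le_lt_trans (gs_norm_anti _ lm) _.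
Qed.

Variable c : bracket.

Definition gs_pred : {pred 'rV[R]_d -> R[i]} :=
  [pred phi | phi \in gs_set M W c].

Lemma gs_submod_closed : submod_closed gs_pred.
Proof.
rewrite /gs_pred; case: c => /=; split.
- by rewrite inE => lam _; have [] := gs_step_submod lam.
- move=> z phi psi; rewrite !inE => gphi gpsi lam _.
  have [_ gD gZ] := gs_step_submod lam.
  by apply: gD; [apply: gZ; exact: gphi|exact: gpsi].
- by rewrite inE; exists 1%:pos => //; have [] := gs_step_submod 1%:pos.
- move=> z phi psi; rewrite !inE => -[lam _ gphi] [mu _ gpsi].
  have [_ gD gZ] := gs_step_submod (Num.max lam%:num mu%:num)%:pos.
  exists (Num.max lam%:num mu%:num)%:pos => //; apply: gD.
    by apply: gZ; apply: gs_step_mono gphi; rewrite /= le_max lexx.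
  by apply: gs_step_mono gpsi; rewrite /= le_max lexx orbT.
Qed.

HB.instance Definition _ :=
  GRing.isSubmodClosed.Build _ _ gs_pred gs_submod_closed.

Record gs := Gs { gs_val :> 'rV[R]_d -> R[i]; _ : gs_val \in gs_pred }.
HB.instance Definition _ := [isSub for gs_val].
HB.instance Definition _ := [Choice of gs by <:].
HB.instance Definition _ := [SubChoice_isSubLmodule of gs by <:].

Definition gs_normC lam (phi : 'rV[R]_d -> R[i]) : R[i] :=
  (fine (gs_norm M W lam phi))%:C%C.

End gelfand_shilov.

Section gelfand_shilov_topology.
Variables (R : realType) (d : nat) (M : weight_sequence_system R d)
  (W : weight_function_system R d).

(* Beurling: the projective limit topology, generated by the norms of all steps.
   Roumieu: the inductive limit topology, i.e. the finest locally convex topology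
   making the inclusion of every step continuous; it is generated by all the
   seminorms whose restriction to each step is continuous. *)
Definition gs_seminorm_set (c : bracket) : set (gs M W c -> R[i]) :=
  match c with
  | Beurling => [set p | exists lam, p = gs_normC M W lam \o (@gs_val _ _ _ _ _)]
  | Roumieu => [set p | seminorm p /\ forall lam, exists2 C : R[i], 0 < C &
      forall phi : gs M W Roumieu, gs_step M W lam phi ->
        p phi <= C * gs_normC M W lam phi]
  end.

Lemma gs_seminormP c p : @gs_seminorm_set c p -> seminorm p.
Proof.
case: c p => p /= [] // lam ->.
have fin (phi : gs M W Beurling) : gs_norm M W lam phi \is a fin_num.
  case: phi => phi /=; rewrite inE => /(_ lam I)[_ h].
  by rewrite ge0_fin_numE// gs_norm_ge0.
have sm (phi : gs M W Beurling) : smoothC phi.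
  by case: phi => phi /=; rewrite inE => /(_ lam I)[].
pose n (phi : gs M W Beurling) := fine (gs_norm M W lam phi).
have nE phi : (n phi)%:E = gs_norm M W lam phi by exact: fineK.
have n_ge0 phi : 0 <= n phi by rewrite -lee_fin nE gs_norm_ge0.
have nD phi psi : n (phi + psi) <= n phi + n psi.
  rewrite -lee_fin EFinD !nE; exact: (gs_normD _ _ _ (sm phi) (sm psi)).
have nZ z phi : n (z *: phi) = Normc.normc z * n phi.
  by apply: EFin_inj; rewrite EFinM !nE; exact: (gs_normZ _ _ _ _ (sm phi)).
rewrite (_ : _ \o _ = fun phi => (n phi)%:C%C)//.
split=> [phi|phi psi|z phi]; first by rewrite lecR.
  by rewrite -rmorphD lecR nD.
by rewrite nZ rmorphM.
Qed.

Definition gs_seminorms c : seminorms (gs M W c) := Seminorms (@gs_seminormP c).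

Definition gelfand_shilov c : tvsType R[i] := seminormed (gs_seminorms c).
End gelfand_shilov_topology.

(* Main.v *)
From HB Require Import structures.
Require Import Defs.
From mathcomp Require Import all_boot all_order all_algebra.
From mathcomp Require Import complex.
From mathcomp Require Import all_reals.
From mathcomp Require Import all_classical all_analysis.
From mathcomp Require Import ring lra zify.
Set Implicit Arguments. Unset Strict Implicit. Unset Printing Implicit Defensive.
Import Order.TTheory GRing.Theory Num.Theory numFieldNormedType.Exports.

(* If every continuous seminorm [p] is dominated by the supremum of functionals [g_n] with
   [|g_n| <= b_n Q], [sum b_n < oo] and [Q] a Hilbertian seminorm, the space is nuclear:
   project orthogonally in the pre-Hilbert space [E + K[X]] with the squared norm
   [sum |g_n(x) + a_n|^2] onto [E]; the monomials [X^n] then have images [y_n] of norm at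
   most [1] in the local Banach space of [p], and [x = sum g_n(x) X^n] modulo vectors of
   norm [0], so that the canonical map is [sum g_n (x) y_n]. An orthogonal projection onto
   the kernel of a surjection [G -> E] transfers this to quotients, hence from the steps
   to the inductive limit in the Roumieu case.

   Between two steps, such functionals are weighted Faber-Schauder coefficients,
   tensorized over the [d] variables, of the derivatives of [phi] on the cubes of a grid of
   mesh [1/d]. The coefficients of a [C^2] function on a cube are summable; the conditions
   [L] and [(M.2)'] give the summability over the multi-indices, and [wM] and [N] that over
   the cubes. *)

Local Open Scope classical_set_scope.
Local Open Scope ring_scope.

(** * Norms over the complex numbers *)

(** A map into a Banach space that is bounded on a subspace need not extend boundedly, and [p] is
    only known to lie below the supremum of the [g n], so the vectors [y n] cannot be read off
    directly. Hilbertian norms provide the extension: composing with an orthogonal projection keeps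
    the bound. The quotient side has the same obstacle: the [g n] need not vanish on the kernel of
    [G -> E] and are corrected by their values on the projection to it. The pre-Hilbert spaces need
    not be complete, so projections are available only up to arbitrarily small errors, and both
    constructions are limits of approximations. Two nuclear steps are used in a row: one gives the
    [g n] with summable bounds relative to an intermediate norm, the next gives square-summable
    functionals whose Hilbertian seminorm dominates that norm. In the Roumieu case a continuous
    seminorm has a separate constant on each step; the functionals therefore live on a direct sum of
    countably many steps, where weights depending on the step absorb these constants. *)

Section complex_norms.
Variable R : realType.
Local Notation K := R[i].
Local Notation normc := Normc.normc.

Definition nrm (V : normedZmodType K) (x : V) : R := complex.Re `|x|.

Lemma nrmE (V : normedZmodType K) (x : V) : `|x| = (nrm x)%:C%C.
Proof. by rewrite /nrm RRe_real ?ger0_real. Qed.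

Lemma ge0_realC (x : K) : 0 <= x -> x = (complex.Re x)%:C%C.
Proof. by move=> x0; rewrite RRe_real ?ger0_real. Qed.

Lemma nrm_ge0 (V : normedZmodType K) (x : V) : 0 <= nrm x.
Proof. by rewrite -lecR -nrmE; exact: normr_ge0. Qed.

Lemma nrmD (V : normedZmodType K) (x y : V) : nrm (x + y) <= nrm x + nrm y.
Proof. by rewrite -lecR rmorphD/= -!nrmE ler_normD. Qed.

Lemma nrmN (V : normedZmodType K) (x : V) : nrm (- x) = nrm x.
Proof. by rewrite /nrm normrN. Qed.

Lemma nrmC (V : normedZmodType K) (x y : V) : nrm (x - y) = nrm (y - x).
Proof. by rewrite /nrm distrC. Qed.

Lemma nrm0 (V : normedZmodType K) : nrm (0 : V) = 0.
Proof. by rewrite /nrm normr0. Qed.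

Lemma nrm_eq0 (V : normedZmodType K) (x : V) : nrm x = 0 -> x = 0.
Proof. by move=> x0; apply/eqP; rewrite -normr_eq0 nrmE x0. Qed.

Lemma nrm_normc (z : K) : nrm (z : K^o) = normc z.
Proof. by case: z. Qed.

Lemma nrmZ (V : normedModType K) a (x : V) : nrm (a *: x) = normc a * nrm x.
Proof.
by apply: (@complexI R); rewrite -nrmE normrZ rmorphM/= -[in RHS]nrmE -nrm_normc -nrmE.
Qed.

Lemma nrm_tri (V : normedZmodType K) (x y z : V) : nrm (x - z) <= nrm (x - y) + nrm (y - z).
Proof. by rewrite -(subrKA y) nrmD. Qed.

Lemma normcR (x : R) : normc (x%:C)%C = `|x|.
Proof. by rewrite /= expr0n addr0 sqrtr_sqr. Qed.

Lemma Re_normc (z : K) : `|complex.Re z| <= normc z.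
Proof.
case: z => x y /=; rewrite -(@ler_pXn2r _ 2)// ?nnegrE ?sqrtr_ge0//.
by rewrite sqr_sqrtr ?addr_ge0 ?sqr_ge0// real_normK ?num_real// lerDl sqr_ge0.
Qed.

Lemma Im_normc (z : K) : `|complex.Im z| <= normc z.
Proof.
case: z => x y /=; rewrite -(@ler_pXn2r _ 2)// ?nnegrE ?sqrtr_ge0//.
by rewrite sqr_sqrtr ?addr_ge0 ?sqr_ge0// real_normK ?num_real// lerDr sqr_ge0.
Qed.

Lemma normc_ReIm (z : K) : normc z <= `|complex.Re z| + `|complex.Im z|.
Proof.
case: z => x y /=; rewrite -(@ler_pXn2r _ 2)// ?nnegrE ?sqrtr_ge0 ?addr_ge0//.
rewrite sqr_sqrtr ?addr_ge0 ?sqr_ge0// sqrrD !real_normK ?num_real//.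
by rewrite lerD2r lerDl mulrn_wge0// mulr_ge0.
Qed.

Lemma le_all_eps (x y c : R) : 0 <= c ->
  (forall e, 0 < e -> x <= y + c * e) -> x <= y.
Proof.
move=> c0 h; apply/ler_addgt0Pr => e e0.
have c1 : 0 < c + 1 by rewrite ltr_wpDl.
apply: le_trans (h (e / (c + 1)) _) _; first by rewrite divr_gt0.
rewrite lerD2l mulrCA ger_pMr// ler_pdivrMr// mul1r lerDl//.
Qed.

(** [P e y] is to be read as: [y] lies within [e] of the value sought. The relational form serves
    scalars and Banach spaces alike and needs no choice of sequences. *)
Definition approx_complete (Y : normedModType K) := forall P : R -> Y -> Prop,
  (forall e, 0 < e -> exists y, P e y) ->
  (forall e e' y y', P e y -> P e' y' -> nrm (y - y') <= e + e') ->
  exists z, forall e y, P e y -> nrm (z - y) <= e.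

(** The intervals of radius [e] around [y] meet pairwise, so the supremum of their left endpoints
    lies in all of them. *)
Lemma approx_real (P : R -> R -> Prop) :
  (exists e y, P e y) ->
  (forall e e' y y', P e y -> P e' y' -> `|y - y'| <= e + e') ->
  exists z, forall e y, P e y -> `|z - y| <= e.
Proof.
move=> [e0 [y0 P0]] h; pose A := [set x | exists e y, P e y /\ x = y - e].
have ub e y : P e y -> ubound A (y + e).
  move=> Py _ [e' [y' [Py' ->]]].
  by have := h _ _ _ _ Py Py'; rewrite ler_norml => /andP[]; lra.
have supA : has_sup A.
  by split; [exists (y0 - e0), e0, y0|exists (y0 + e0); exact: ub].
exists (sup A) => e y Py; rewrite ler_distl; apply/andP; split.
  by apply: ub_le_sup; [exact: supA.2|exists e, y].
by apply: ge_sup; [exact: supA.1|exact: ub].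
Qed.

Lemma approx_complete_scalar : approx_complete (K^o : normedModType K).
Proof.
move=> P ex h.
have [] := @approx_real (fun e x => exists2 y, P e y & x = complex.Re y).
- by have [y Py] := ex 1 ltr01; exists 1, (complex.Re y), y.
- move=> e e' _ _ [y Py ->] [y' Py' ->]; apply: le_trans (h _ _ _ _ Py Py').
  by rewrite nrm_normc -raddfB Re_normc.
move=> u hu.
have [] := @approx_real (fun e x => exists2 y, P e y & x = complex.Im y).
- by have [y Py] := ex 1 ltr01; exists 1, (complex.Im y), y.
- move=> e e' _ _ [y Py ->] [y' Py' ->]; apply: le_trans (h _ _ _ _ Py Py').
  by rewrite nrm_normc -raddfB Im_normc.
move=> v hv; exists (Complex u v) => e y Py.
(* Two [t] for locating real and imaginary part at precision [t], one more for comparing [y'] with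
   [y]. *)
apply: (@le_all_eps _ _ 3) => // t t0.
have [y' Py'] := ex t t0.
apply: le_trans (nrm_tri _ y' _) _.
have := h _ _ _ _ Py' Py; rewrite !nrm_normc => h1.
suff : normc (Complex u v - y') <= t + t by lra.
apply: le_trans (normc_ReIm _) _.
by rewrite !raddfB/= lerD//; [apply: hu; exists y'|apply: hv; exists y'].
Qed.

Lemma approx_complete_banach (Y : completeNormedModType K) : approx_complete Y.
Proof.
move=> P ex h.
have ex' n : exists y, P n.+1%:R^-1 y by apply: ex; rewrite invr_gt0.
have [u Pu] := choice ex'.
have small (e : R) : 0 < e -> \forall n \near \oo, n.+1%:R^-1 <= e.
  move=> e0; have := @near_infty_natSinv_lt R (PosNum e0).
  by apply: filterS => n /= /ltW.
have cu : cvg (u @ \oo).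
  apply/cauchy_cvgP/cauchy_exP => _/posnumP[e].
  pose r := complex.Re e%:num.
  have eE : e%:num = (r%:C)%C by rewrite /r -ge0_realC.
  have r0 : 0 < r by rewrite -ltcR -eE; exact: gt0.
  have [N _ /(_ N (leqnn N)) hN] := small (r / 3) (divr_gt0 r0 (ltr0Sn _ 2)).
  exists (u N); apply: filterS (small (r / 3) _) => [n hn|]; last by rewrite divr_gt0.
  rewrite -ball_normE/= nrmE eE ltcR.
  by apply: le_lt_trans (h _ _ _ _ (Pu N) (Pu n)) _; apply: le_lt_trans (lerD hN hn) _; lra.
exists (lim (u @ \oo)) => e y Py.
apply: (@le_all_eps _ _ 2) => // t t0.
have tC : 0 < (t%:C)%C by rewrite ltcR.
have /cvgrPdist_lt /(_ _ tC) := cu.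
move=> H; near \oo => n.
apply: le_trans (nrm_tri _ (u n) _) _.
have h1 : nrm (lim (u @ \oo) - u n) < t by rewrite -ltcR -nrmE; near: n.
have h2 : n.+1%:R^-1 <= t by near: n; exact: small.
have := h _ _ _ _ (Pu n) Py; move: h1 h2; move: (nrm _) (nrm _) (_^-1) => a b c; lra.
Unshelve. all: end_near. Qed.

End complex_norms.

(** * Extension of bounded linear maps and orthogonal projection *)

Section linear_extension.
Variable R : realType.
Local Notation K := R[i].
Local Notation normc := Normc.normc.

(* [OA e v u] says that [u] stands for [v] up to an error [e]; this covers both
   the extension of a bounded map from a dense subspace and the orthogonal
   projection of a pre-Hilbert space, whose values need not exist in [U]. *)
Lemma linear_extension (V U : lmodType K) (Y : normedModType K)
    (OA : R -> V -> U -> Prop) (A : {linear U -> Y}) (c : R) :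
  approx_complete Y -> 0 <= c ->
  (forall v e, 0 < e -> exists u, OA e v u) ->
  (forall e e' v v' u u' a, OA e v u -> OA e' v' u' ->
    OA (normc a * e + e') (a *: v + v') (a *: u + u')) ->
  (forall e u, OA e 0 u -> nrm (A u) <= c * e) ->
  exists T : {linear V -> Y}, forall e v u, OA e v u -> nrm (T v - A u) <= c * e.
Proof.
move=> cY c0 ex comb bd.
have c1 : 0 < c + 1 by rewrite ltr_wpDl.
have pt v : exists z, forall e u, OA e v u -> nrm (z - A u) <= c * e.
  have [] := cY (fun r y => exists e u, [/\ OA e v u, y = A u & c * e <= r]).
  - move=> e e0; have [u hu] := ex v (e / (c + 1)) (divr_gt0 e0 c1).
    exists (A u), (e / (c + 1)), u; split=> //.
    by rewrite mulrCA ger_pMr// ler_pdivrMr// mul1r lerDl.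
  - move=> r r' _ _ [e [u [h -> er]]] [e' [u' [h' -> er']]].
    (* By [comb], [u - u'] stands for 0 up to [e + e'], and there [bd] applies. *)
    rewrite -raddfB (_ : u - u' = -1 *: u' + u); last by rewrite scaleN1r addrC.
    have := comb _ _ _ _ _ _ (-1) h' h.
    have -> : -1 *: v + v = 0 by rewrite scaleN1r addNr.
    move=> /bd /le_trans; apply.
    by rewrite normcN Normc.normc1 mul1r mulrDr addrC lerD.
  move=> z hz; exists z => e u h; apply: hz; exists e, u; split=> //.
have [T hT] := choice pt.
have linT : linear T.
  move=> a v v'; apply/eqP; rewrite -subr_eq0; apply/eqP; apply: nrm_eq0.
  apply/eqP; rewrite eq_le nrm_ge0 andbT.
  apply: (@le_all_eps _ _ _ (2 * c * (normc a + 1))).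
    by rewrite !mulr_ge0// addr_ge0// normc_ge0.
  move=> e e0; rewrite add0r.
  have [u hu] := ex v e e0; have [u' hu'] := ex v' e e0.
  have h1 := hT _ _ _ (comb _ _ _ _ _ _ a hu hu').
  have h2 := hT _ _ _ hu; have h3 := hT _ _ _ hu'.
  apply: le_trans (nrm_tri _ (A (a *: u + u')) _) _.
  have -> : A (a *: u + u') - (a *: T v + T v') =
      - (a *: (T v - A u) + (T v' - A u')).
    by rewrite linearP scalerBr addrACA -opprD opprB.
  rewrite nrmN; apply: le_trans (lerD h1 (nrmD _ _)) _; rewrite nrmZ.
  have := ler_wpM2l (normc_ge0 a) h2.
  move: h3; move: (nrm _) (nrm _) => x y h3 h4.
  rewrite -[leRHS]/(2 * c * (normc a + 1) * e).
  have -> : 2 * c * (normc a + 1) * e = c * (normc a * e + e) + (normc a * (c * e) + c * e) by ring.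
  by rewrite lerD2l lerD.
pose T' : {linear V -> Y} := HB.pack T (GRing.isLinear.Build _ _ _ _ T linT).
by exists T' => e v u; exact: hT.
Qed.

End linear_extension.

(** The quadratic is evaluated at its minimiser [b / q]. For q = 0 it is affine in [t], and a
    nonzero [b] would make it -1 at [(a + 1) / (2 * b)]. *)
Lemma discriminant_le (R : realFieldType) (a b q : R) : 0 <= q ->
  (forall t, 0 <= a - 2 * t * b + t ^+ 2 * q) -> b ^+ 2 <= a * q.
Proof.
rewrite le_eqVlt => /predU1P[<-|q0] h.
  rewrite mulr0; have [->|b0] := eqVneq b 0; first by rewrite expr0n.
  have := h ((a + 1) / (2 * b)); rewrite mulr0 addr0.
  suff -> : 2 * ((a + 1) / (2 * b)) * b = a + 1 by lra.
  by field.
have := h (b / q).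
have -> : a - 2 * (b / q) * b + (b / q) ^+ 2 * q = (a * q - b ^+ 2) / q by field; lra.
by rewrite pmulr_lge0 ?invr_gt0// subr_ge0.
Qed.

Section projection.
Variables (R : realType) (V : lmodType R[i]) (B : V -> V -> R).
Local Notation normc := Normc.normc.
Hypothesis BD : forall x y z, B (x + y) z = B x z + B y z.
Hypothesis BC : forall x y, B x y = B y x.
Hypothesis BZ : forall a x y, B (a *: x) y = B x (a^*%C *: y).
Hypothesis BR : forall (r : R) x y, B (r%:C%C *: x) y = r * B x y.
Hypothesis B_ge0 : forall x, 0 <= B x x.

(** [B] is the real part of a semi-definite Hermitian form, and [BZ] is the trace of sesquilinearity
    that survives taking real parts. Nonzero vectors may have norm 0. *)
Definition Bnorm x := Num.sqrt (B x x).

Lemma Bnorm_ge0 x : 0 <= Bnorm x. Proof. exact: sqrtr_ge0. Qed.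

Lemma Bnorm_sqr x : Bnorm x ^+ 2 = B x x. Proof. exact: (sqr_sqrtr (B_ge0 x)). Qed.

Lemma BN x y : B (- x) y = - B x y.
Proof. by rewrite -[- B x y]mulN1r -BR rmorphN1 scaleN1r. Qed.

Lemma BB x y z : B (x - y) z = B x z - B y z.
Proof. by rewrite BD BN. Qed.

Lemma B_line x f (t : R) : B (x - t%:C%C *: f) (x - t%:C%C *: f) =
  B x x - 2 * t * B x f + t ^+ 2 * B f f.
Proof.
rewrite BB BR !(BC _ (x - _)) !BB !BR (BC f x); ring.
Qed.

Lemma sqr_le_Bnorm (a b : R) f : 0 <= a -> b ^+ 2 <= a ^+ 2 * B f f -> `|b| <= a * Bnorm f.
Proof.
move=> a0 h; rewrite -(@ler_pXn2r _ 2)// ?nnegrE ?mulr_ge0 ?Bnorm_ge0//.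
by rewrite exprMn Bnorm_sqr real_normK ?num_real.
Qed.

Lemma B_CauchySchwarz x y : `|B x y| <= Bnorm x * Bnorm y.
Proof.
apply: sqr_le_Bnorm; first exact: Bnorm_ge0.
rewrite Bnorm_sqr; apply: discriminant_le => // t.
by rewrite -B_line.
Qed.

Lemma BnormZ a x : Bnorm (a *: x) = normc a * Bnorm x.
Proof.
rewrite /Bnorm BZ scalerA.
have -> : (a^*%C * a = (normc a ^+ 2)%:C)%C.
  case: (a) => u v; apply/eqP; rewrite eq_complex /= sqr_sqrtr ?addr_ge0 ?sqr_ge0//.
  by apply/andP; split; apply/eqP; ring.
by rewrite BC BR sqrtrM ?sqr_ge0// sqrtr_sqr ger0_norm// normc_ge0.
Qed.

Variable F : V -> Prop.
Hypothesis F0 : F 0.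
Hypothesis FP : forall a x y, F x -> F y -> F (a *: x + y).

(** Testing against [F] says that [u] is within [e] of the projection of [v] in the completion of
    [F], without naming that projection. The condition is stable under linear combinations, as
    [linear_extension] requires. *)
Definition near_proj (e : R) (v u : V) :=
  [/\ 0 <= e, F u & forall f, F f -> `|B (v - u) f| <= e * Bnorm f].

Lemma near_projP a e e' v v' u u' : near_proj e v u -> near_proj e' v' u' ->
  near_proj (normc a * e + e') (a *: v + v') (a *: u + u').
Proof.
move=> [e0 Fu h] [e0' Fu' h']; split.
- by rewrite addr_ge0// mulr_ge0// normc_ge0.
- exact: FP.
- move=> f Ff; rewrite opprD addrACA -scalerBr BD BZ.
  apply: le_trans (ler_normD _ _) _; rewrite mulrDl lerD//; last exact: h'.
  have Ff' : F (a^*%C *: f) by rewrite -[_ *: f]addr0; exact: FP.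
  apply: le_trans (h _ Ff') _; rewrite BnormZ mulrA (mulrC e).
  suff -> : normc a^*%C = normc a by [].
  by case: (a) => x y /=; rewrite sqrrN.
Qed.

(** Take [u] with squared distance to [v] less than [e ^+ 2] above the infimum. Moving [u] by
    multiples of [f] cannot go below the infimum, and the discriminant of the resulting quadratic
    bounds [B (v - u) f]. *)
Lemma near_proj_exists v e : 0 < e -> exists u, near_proj e v u.
Proof.
move=> e0; pose S := [set B (v - u) (v - u) | u in F].
have infS : has_inf S.
  by split; [exists (B (v - 0) (v - 0)), 0|exists 0 => _ [u _ <-]].
have [_ [u Fu <-] hu] := inf_adherent (exprn_gt0 2 e0) infS.
exists u; split=> [||f Ff]; [exact: ltW|exact: Fu|].
apply: sqr_le_Bnorm; first exact: ltW.
apply: discriminant_le => // t.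
have := B_line (v - u) f t.
have : inf S <= B (v - u - t%:C%C *: f) (v - u - t%:C%C *: f).
  apply: ge_inf; first exact: infS.2.
  exists (t%:C%C *: f + u); first exact: FP.
  by rewrite opprD addrA addrAC.
move: hu; lra.
Qed.

(** Testing with [u] itself gives |u|^2 = B(x, u) - B(x - u, u) <= (|x| + e) |u|. *)
Lemma near_proj_norm e x u : near_proj e x u -> Bnorm u <= Bnorm x + e.
Proof.
move=> [e0 Fu h]; have := h u Fu; have := B_CauchySchwarz x u.
rewrite BB !ler_norml -Bnorm_sqr => /andP[_ h1] /andP[h2 _].
have := Bnorm_ge0 u; rewrite le_eqVlt => /predU1P[<-|u0].
  by rewrite addr_ge0// Bnorm_ge0.
by rewrite -(ler_pM2r u0); lra.
Qed.

(** Pythagoras with a cross term of at most 2 e |u|, which |u|^2 absorbs up to e^2. *)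
Lemma near_proj_orth e x u : near_proj e x u -> Bnorm (x - u) <= Bnorm x + e.
Proof.
move=> [e0 Fu h]; have := h u Fu.
have : Bnorm x ^+ 2 = Bnorm (x - u) ^+ 2 + 2 * B (x - u) u + Bnorm u ^+ 2.
  rewrite !Bnorm_sqr !BB !(BC _ (x - u)) !BB (BC u x); ring.
rewrite ler_norml => h1 /andP[h2 _].
rewrite -(@ler_pXn2r _ 2)// ?nnegrE ?addr_ge0 ?Bnorm_ge0//.
have := sqr_ge0 (Bnorm u - e); have := mulr_ge0 (Bnorm_ge0 x) e0.
move: h1 h2; move: (Bnorm _) (Bnorm _) (Bnorm _) (B _ _) => a b c d; nra.
Qed.

End projection.

(** * The Hilbertian seminorm of a square-summable family of functionals *)

Section l2_family.
Variables (R : realType) (V : lmodType R[i]) (e : nat -> {linear V -> R[i]^o}).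
Local Notation K := R[i].
Local Notation normc := Normc.normc.

(** The real part of z times the conjugate of w. *)
Definition dotc (z w : K) : R :=
  complex.Re z * complex.Re w + complex.Im z * complex.Im w.

Lemma dotcc z : dotc z z = normc z ^+ 2.
Proof. by case: z => x y; rewrite /dotc/= sqr_sqrtr ?addr_ge0 ?sqr_ge0. Qed.

Lemma dotc_le z w : `|dotc z w| <= normc z ^+ 2 + normc w ^+ 2.
Proof.
rewrite -!dotcc /dotc; case: z w => x y [u v] /=; rewrite ler_norml.
have := sqr_ge0 (x - u); have := sqr_ge0 (x + u).
have := sqr_ge0 (y - v); have := sqr_ge0 (y + v); rewrite !expr2 => *.
by apply/andP; split; nra.
Qed.

Definition square_summable := forall x, exists C, forall n,
  \sum_(0 <= m < n) normc (e m x) ^+ 2 <= C.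
Hypothesis sq : square_summable.

Definition l2form (x y : V) : R := limn (series (fun m => dotc (e m x) (e m y))).

Lemma bounded_series_cvg (u : nat -> R) C : (forall n, 0 <= u n) ->
  (forall n, \sum_(0 <= m < n) u m <= C) -> cvgn (series u).
Proof.
move=> u0 uC; apply: nondecreasing_is_cvgn.
  by apply: nondecreasing_series => n _ _.
by exists C => _ [n _ <-]; exact: uC.
Qed.

Lemma l2form_cvg x y : cvgn (series (fun m => dotc (e m x) (e m y))).
Proof.
have [C hC] := sq x; have [D hD] := sq y.
apply: normed_cvg; apply: (@bounded_series_cvg _ (C + D)) => [n|n]; first exact: normr_ge0.
apply: le_trans (lerD (hC n) (hD n)); rewrite -big_split /=.
by apply: ler_sum => m _; exact: dotc_le.
Qed.

Lemma l2formD x y z : l2form (x + y) z = l2form x z + l2form y z.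
Proof.
rewrite /l2form -limD; [|exact: l2form_cvg|exact: l2form_cvg].
congr (limn _); apply/funext => n; rewrite !fctE /series /= -big_split /=.
by apply: eq_bigr => m _; rewrite raddfD /dotc !raddfD /=; ring.
Qed.

Lemma l2formC x y : l2form x y = l2form y x.
Proof.
congr (limn _); apply/funext => n; rewrite /series /=.
by apply: eq_bigr => m _; rewrite /dotc !(mulrC (_ (e m x))).
Qed.

Lemma l2formZ a x y : l2form (a *: x) y = l2form x (a^*%C *: y).
Proof.
congr (limn _); apply/funext => n; rewrite /series /=.
apply: eq_bigr => m _; rewrite !linearZ /dotc /GRing.scale /=.
by case: a (e m x) (e m y) => a b [u v] [p q] /=; ring.
Qed.

Lemma l2formR (r : R) x y : l2form (r%:C%C *: x) y = r * l2form x y.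
Proof.
rewrite /l2form -[RHS]/(r *: _) -limZl_tmp; last exact: l2form_cvg.
congr (limn _); apply/funext => n; rewrite /series /= -[RHS]/(r * _) mulr_sumr.
apply: eq_bigr => m _; rewrite !linearZ /dotc /GRing.scale /=.
by case: (e m x) (e m y) => [u v] [p q] /=; ring.
Qed.

Lemma l2form_partial_sum_le x n : \sum_(0 <= m < n) normc (e m x) ^+ 2 <= l2form x x.
Proof.
under eq_bigr do rewrite -dotcc.
apply: (nondecreasing_cvgn_le (u_ := series (fun m => dotc (e m x) (e m x)))); last exact: l2form_cvg.
by apply: nondecreasing_series => m _ _; rewrite dotcc sqr_ge0.
Qed.

Lemma l2form_le x C :
  (forall n, \sum_(0 <= m < n) normc (e m x) ^+ 2 <= C) -> l2form x x <= C.
Proof.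
move=> h; apply: limr_le; first exact: l2form_cvg.
by apply: nearW => n; rewrite /series/=; under eq_bigr do rewrite dotcc.
Qed.

Lemma l2form_ge0 x : 0 <= l2form x x.
Proof. by have := l2form_partial_sum_le x 0; rewrite big_geq. Qed.

Local Notation Q := (Bnorm l2form).

Lemma term_le_l2norm m x : normc (e m x) <= Q x.
Proof.
rewrite -(@ler_pXn2r _ 2)// ?nnegrE ?Bnorm_ge0 ?normc_ge0//.
rewrite (Bnorm_sqr l2form_ge0); apply: le_trans (l2form_partial_sum_le x m.+1).
by rewrite big_nat_recr//= lerDr sumr_ge0// => i _; rewrite sqr_ge0.
Qed.

Lemma l2norm_le x C : 0 <= C ->
  (forall n, \sum_(0 <= m < n) normc (e m x) ^+ 2 <= C ^+ 2) -> Q x <= C.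
Proof.
move=> C0 h; rewrite -(@ler_pXn2r _ 2)// ?nnegrE ?Bnorm_ge0//.
by rewrite (Bnorm_sqr l2form_ge0); exact: l2form_le.
Qed.

End l2_family.

(** * Expansion of a map by projection in an augmented pre-Hilbert space *)

Section l2_factorization.
Variables (R : realType) (G : lmodType R[i]) (Y : normedModType R[i]).
Variables (A : {linear G -> Y}) (g : nat -> {linear G -> R[i]^o}).
Local Notation K := R[i].
Local Notation normc := Normc.normc.
Hypothesis cY : approx_complete Y.
Hypothesis sq : square_summable g.
Hypothesis A_le : forall x C, 0 <= C -> (forall n, normc (g n x) <= C) -> nrm (A x) <= C.

Local Notation V := (G * {poly K})%type.

Lemma augmented_linear m : linear (fun v : V => (g m v.1 + v.2`_m : K^o)).
Proof.
move=> a v w /=; rewrite linearP coefD coefZ scalerDr /GRing.scale/=.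
by rewrite addrACA.
Qed.

Definition augmented m : {linear V -> K^o} := HB.pack (fun v : V => (g m v.1 + v.2`_m : K^o))
  (GRing.isLinear.Build _ _ _ _ _ (augmented_linear m)).

Lemma augmented_square_summable : square_summable augmented.
Proof.
move=> [x a]; have [C hC] := sq x.
pose f m := normc a`_m ^+ 2.
have f0 m : 0 <= f m by exact: sqr_ge0.
have hD n : \sum_(0 <= m < n) f m <= \sum_(0 <= m < size a) f m.
  apply: (@le_trans _ _ (\sum_(0 <= m < maxn n (size a)) f m)).
    rewrite [leRHS](@big_cat_nat _ _ _ n)//= ?leq_maxl// lerDl.
    by apply: sumr_ge0 => i _.
  rewrite (@big_cat_nat _ _ _ (size a))//= ?leq_maxr// gerDl.
  rewrite big_nat big1// => i /andP[hi _].
  by rewrite /f nth_default// Normc.normc0 expr0n.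
exists (2 * (C + \sum_(0 <= m < size a) f m)) => n.
have := lerD (hC n) (hD n); rewrite -big_split/= => h.
apply: le_trans (_ : _ <= 2 * _) (_ : 2 * _ <= _); last by rewrite ler_pM2l; [exact: h|].
rewrite mulr_sumr; apply: ler_sum => m _; rewrite /f -!dotcc /dotc.
case: (g m x) (a`_m) => [u v] [p q] /=.
by have := sqr_ge0 (u - p); have := sqr_ge0 (v - q); nra.
Qed.

Local Notation B := (l2form augmented).
Local Notation Q := (Bnorm B).
Let sqA := augmented_square_summable.
Let B0 := l2form_ge0 sqA.
Let base (v : V) := v.2 = 0.

Lemma l2_factor_expansion : exists y : nat -> Y, (forall n, nrm (y n) <= 1) /\
  forall x N r, 0 <= r ->
    (forall n, \sum_(N <= m < n) normc (g m x) ^+ 2 <= r ^+ 2) ->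
    nrm (A x - \sum_(0 <= n < N) (g n x : K) *: y n) <= r.
Proof.
have linA1 : linear (fun v : V => A v.1) by move=> a v w; rewrite linearP.
pose A1 : {linear V -> Y} := HB.pack (fun v : V => A v.1)
  (GRing.isLinear.Build _ _ _ _ _ linA1).
have F0 : base 0 by [].
have FP a v w : base v -> base w -> base (a *: v + w).
  by rewrite /base /= => -> ->; rewrite scaler0 addr0.
have A1_le v : base v -> nrm (A v.1) <= Q v.
  move=> Fv; apply: A_le => [|n]; first exact: Bnorm_ge0.
  by have := term_le_l2norm sqA n v; rewrite /= Fv coef0 addr0.
have Q0 : Q 0 = 0.
  apply/eqP; rewrite eq_le Bnorm_ge0 andbT; apply: l2norm_le => // n.
  rewrite big1 ?expr0n// => m _; rewrite linear0 Normc.normc0 expr0n//.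
have BD := l2formD sqA; have BC := l2formC augmented.
have BZ := l2formZ augmented; have BR := l2formR sqA.
(* [T] is [A1] after the orthogonal projection onto [base]. On [base] the coordinates are the [g n],
   so [A_le] bounds [A1] by [Q], and projecting preserves this bound. *)
have [T hT] : exists T : {linear V -> Y}, forall e v u,
    near_proj B base e v u -> nrm (T v - A1 u) <= 1 * e.
  apply: linear_extension => //.
  - by move=> v e e0; exact: near_proj_exists.
  - by move=> *; exact: near_projP.
  - move=> e u h; have := near_proj_norm BD BC BR B0 h; rewrite Q0 add0r mul1r.
    by apply: le_trans; apply: A1_le; case: h.
have TA x : T (x, 0) = A x.
  apply/eqP; rewrite -subr_eq0; apply/eqP/nrm_eq0/eqP; rewrite eq_le nrm_ge0 andbT.
  have := hT 0 (x, 0) (x, 0); rewrite mulr0; apply; split=> // f Ff.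
  by rewrite (BB BD BR) subrr normr0 mul0r.
have T_le v : nrm (T v) <= Q v.
  apply: (@le_all_eps _ _ _ 2) => // e e0.
  have [u hu] := near_proj_exists BD BC BR B0 F0 FP v e0.
  have := near_proj_norm BD BC BR B0 hu.
  have := hT _ _ _ hu; have [_ Fu _] := hu; have := A1_le _ Fu.
  have := nrmD (T v - A1 u) (A1 u); rewrite subrK /=; lra.
exists (fun n => T (0, 'X^n)); split=> [n|x N r r0 h].
  apply: le_trans (T_le _) _; apply: l2norm_le => // k; rewrite expr1n.
  under eq_bigr => m _ do rewrite /= linear0 add0r coefXn.
  have -> : \sum_(0 <= m < k) normc (m == n)%:R ^+ 2 = \sum_(0 <= m < k) ((m == n)%:R : R).
    by apply: eq_bigr => m _; case: eqP; rewrite ?Normc.normc1 ?Normc.normc0 ?expr1n ?expr0n.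
  have [nk|nk] := ltnP n k.
    rewrite (bigD1_seq n)/= ?mem_index_iota ?iota_uniq// eqxx big1 ?addr0// => m.
    by move=> /negPf ->.
  rewrite big_nat big1// => m /andP[_ mk]; case: eqP => // mn.
  by move: mk; rewrite mn ltnNge nk.
(* Subtracting [a] erases the coordinates below [N] and leaves the others, so [Q (x, - a)] is
   exactly the tail bounded by [h]. *)
pose a : {poly K} := \sum_(0 <= n < N) g n x *: 'X^n.
have -> : A x - \sum_(0 <= n < N) (g n x : K) *: T (0, 'X^n) = T (x, - a).
  have -> : (x, - a) = (x, 0) - (0, a) :> V by congr (_, _); rewrite ?subr0 ?sub0r.
  rewrite linearB TA; congr (_ - _).
  have -> : (0, a) = \sum_(0 <= n < N) g n x *: (0, 'X^n) :> V.
    rewrite /a; elim/big_rec2: _ => // n p q _ <-.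
    by congr (_, _); rewrite /= scaler0 addr0.
  by rewrite raddf_sum; apply: eq_bigr => n _; rewrite /= linearZ_LR.
apply: le_trans (T_le _) _; apply: l2norm_le => // n.
apply: le_trans (h n) => /=.
have ca m : a`_m = if (m < N)%N then g m x else 0.
  have -> : a = \poly_(i < N) g i x by rewrite poly_def /a big_mkord.
  by rewrite coef_poly.
have [nN|Nn] := leqP n N.
  rewrite big_nat big1 ?sumr_ge0// => [m|m /andP[_ mn]]; first by rewrite sqr_ge0.
  by rewrite coefN ca (leq_trans mn nN) subrr Normc.normc0 expr0n.
rewrite (@big_cat_nat _ _ _ N)//= ?(ltnW Nn)// big_nat big1 ?add0r.
  rewrite [leLHS]big_nat [leRHS]big_nat; apply: ler_sum => m /andP[Nm _].
  by rewrite coefN ca ltnNge Nm subr0.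
by move=> m /andP[_ mN]; rewrite coefN ca mN subrr Normc.normc0 expr0n.
Qed.

End l2_factorization.

Section dense_extension.
Variable R : realType.
Local Notation K := R[i].
Local Notation normc := Normc.normc.

Lemma cvg_nrm (V : normedModType K) (u : nat -> V) (l : V) :
  (forall r : R, 0 < r -> \forall n \near \oo, nrm (l - u n) < r) -> u @ \oo --> l.
Proof.
move=> h; apply/cvgrPdist_lt => e e0.
have eE := ge0_realC (ltW e0).
have r0 : 0 < complex.Re e by rewrite -ltcR -eE; exact: e0.
by apply: filterS (h _ r0) => n; rewrite nrmE {2}eE ltcR.
Qed.

Lemma dense_approx (E : lmodType K) (X : normedModType K) (i : {linear E -> X}) :
  dense (range i) -> forall xi (r : R), 0 < r -> exists x, nrm (xi - i x) <= r.
Proof.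
move=> di xi r r0; have rC : 0 < (r%:C)%C by rewrite ltcR.
have [||z [bz [x _ xz]]] := di (ball xi (r%:C)%C).
- by exists xi; exact: ballxx.
- exact: ball_open.
exists x; move: bz; rewrite -xz -ball_normE /= nrmE ltcR; exact: ltW.
Qed.

Lemma dense_extension (E : lmodType K) (X Y : normedModType K)
    (i : {linear E -> X}) (A : {linear E -> Y}) (c : R) :
  approx_complete Y -> 0 <= c -> dense (range i) ->
  (forall x, nrm (A x) <= c * nrm (i x)) ->
  exists T : {linear X -> Y}, forall xi x, nrm (T xi - A x) <= c * nrm (xi - i x).
Proof.
move=> cY c0 di Ai.
have [T hT] : exists T : {linear X -> Y}, forall e xi x,
    nrm (xi - i x) <= e -> nrm (T xi - A x) <= c * e.
  apply: linear_extension => //.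
  - by move=> xi e e0; exact: dense_approx.
  - move=> e e' xi xi' x x' a h h'.
    rewrite linearP opprD addrACA -scalerBr.
    apply: le_trans (nrmD _ _) _; rewrite nrmZ lerD//.
    by rewrite ler_wpM2l// normc_ge0.
  - move=> e x; rewrite sub0r nrmN => h.
    by apply: le_trans (Ai x) _; rewrite ler_wpM2l.
by exists T => xi x; exact: hT.
Qed.

End dense_extension.

Lemma sum_sqr_le (R : realDomainType) (I : Type) (s : seq I) (a : I -> R) :
  (forall i, 0 <= a i) -> \sum_(i <- s) a i ^+ 2 <= (\sum_(i <- s) a i) ^+ 2.
Proof.
move=> a0; elim: s => [|i s IH]; first by rewrite !big_nil expr0n.
rewrite !big_cons sqrrD -addrA lerD2l.
apply: le_trans IH _; rewrite lerDr mulrn_wge0// mulr_ge0// sumr_ge0//.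
Qed.

(** * Descent of functionals and expansions along a surjection *)

Section nuclear_factorization.
Variables (R : realType) (E G : lmodType R[i]) (S : {linear G -> E}).
Variables (g e : nat -> {linear G -> R[i]^o}) (b : nat -> R) (bound : R).
Local Notation K := R[i].
Local Notation normc := Normc.normc.
Local Notation B := (l2form e).
Local Notation Q := (Bnorm B).
Hypothesis S_surj : forall phi, exists x, S x = phi.
Hypothesis sq : square_summable e.
Hypothesis b_gt0 : forall n, 0 < b n.
Hypothesis b_le : forall n, \sum_(0 <= m < n) b m <= bound.
Hypothesis g_le : forall n x, normc (g n x) <= b n * Q x.

Let ker (x : G) := S x = 0.
Let ker0 : ker 0. Proof. by rewrite /ker linear0. Qed.
Let kerP a x y : ker x -> ker y -> ker (a *: x + y).
Proof. by rewrite /ker linearP => -> ->; rewrite scaler0 addr0. Qed.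
Let BD := l2formD sq.
Let BC := l2formC e.
Let BZ := l2formZ e.
Let BR := l2formR sq.
Let B0 := l2form_ge0 sq.

Let bound_ge0 : 0 <= bound.
Proof. by have := b_le 0; rewrite big_geq. Qed.

(** [T n] is [g n] after the projection onto the kernel. The difference [g n - T n] vanishes on the
    kernel, hence factors through [S]: it is [g n] after the projection onto the orthogonal
    complement, which does not increase [Q]. The second part says how well an approximate projection
    [u] computes it. *)
Lemma quotient_functionals : exists h : nat -> {linear E -> K^o},
  (forall n x, normc (h n (S x)) <= b n * Q x) /\
  forall n r x u, near_proj B ker r x u -> normc (g n (x - u) - h n (S x)) <= b n * r.
Proof.
have pt n : exists T : {linear G -> K^o}, forall r x u,
    near_proj B ker r x u -> nrm (T x - g n u) <= b n * r.
  apply: linear_extension.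
  - exact: approx_complete_scalar.
  - exact: ltW.
  - by move=> v r r0; exact: near_proj_exists.
  - by move=> *; exact: near_projP.
  - move=> r u [r0 Fu h]; rewrite nrm_normc.
    apply: le_trans (g_le n u) _; apply: ler_wpM2l; first exact: ltW.
    have Q0 : Q 0 = 0 by rewrite /Bnorm -(scale0r 0) BR mul0r sqrtr0.
    by have := near_proj_norm BD BC BR B0 (And3 r0 Fu h); rewrite Q0 add0r.
have [T hT] := choice pt.
have [sec secP] := choice S_surj.
have Tker n x : S x = 0 -> g n x = T n x :> K.
  move=> Sx; apply/eqP; rewrite eq_sym -subr_eq0; apply/eqP.
  apply: (@nrm_eq0 R (K^o)); apply/eqP; rewrite eq_le nrm_ge0 andbT.
  have := hT n 0 x x; rewrite mulr0; apply; split=> // f Ff.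
  by rewrite subrr -(scale0r 0) BR mul0r normr0 mul0r.
have TS n x y : S x = S y -> g n x - T n x = g n y - T n y :> K.
  move=> Sxy; have /(Tker n) : S (x - y) = 0 by rewrite linearB Sxy subrr.
  rewrite !linearB /= => eqxy.
  have -> : g n x = T n x - T n y + g n y :> K by rewrite -eqxy subrK.
  by move: (T n x : K) (T n y : K) (g n y : K) => t t' z; ring.
have linh n : linear (fun phi => g n (sec phi) - T n (sec phi) : K^o).
  move=> a phi psi; rewrite (TS _ _ (a *: sec phi + sec psi)); last first.
    by rewrite linearP !secP.
  by rewrite !linearP /GRing.scale/=; ring.
pose h n : {linear E -> K^o} := HB.pack (fun phi => g n (sec phi) - T n (sec phi) : K^o)
  (GRing.isLinear.Build _ _ _ _ _ (linh n)).
have hS n x : h n (S x) = g n x - T n x by apply: TS; rewrite secP.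
have hS2 n r x u : near_proj B ker r x u -> normc (g n (x - u) - h n (S x)) <= b n * r.
  move=> pu; rewrite hS; apply: le_trans (hT n _ _ _ pu).
  rewrite nrm_normc linearB /=; move: (T n x : K) (g n x : K) (g n u : K) => t v w.
  suff -> : v - w - (v - t) = t - w by [].
  by ring.
exists h; split=> // n x.
have bn := ltW (b_gt0 n).
apply: (@le_all_eps _ _ _ (2 * b n)) => [|r r0]; first by rewrite mulr_ge0.
have [u pu] := near_proj_exists BD BC BR B0 ker0 kerP x r0.
have h1 := near_proj_orth BD BC BR B0 pu.
have h2 := hS2 n _ _ _ pu.
have h3 := g_le n (x - u); have h4 := ler_wpM2l bn h1.
have h5 : normc (h n (S x)) <= normc (g n (x - u)) + normc (g n (x - u) - h n (S x)).
  have := le_normcD (g n (x - u)) (- (g n (x - u) - h n (S x))).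
  by rewrite normcN opprB [_ + (_ - _)]addrC subrK.
have -> : b n * Q x + 2 * b n * r = b n * (Q x + r) + b n * r by ring.
by apply: le_trans h5 _; rewrite lerD// (le_trans h3).
Qed.

(** The expansion on [G] has coefficients [g n x], which depend on the representative [x]. Applied
    to [x - u] with [u] close to the projection of [x] on the kernel, it has the same value under
    [S], and its coefficients are close to [h n (S x)]. *)
Lemma quotient_expansion (Y : normedModType K) (j : {linear E -> Y}) (h : nat -> {linear E -> K^o}) :
  approx_complete Y ->
  (forall n r x u, near_proj B ker r x u -> normc (g n (x - u) - h n (S x)) <= b n * r) ->
  (forall x C, 0 <= C -> (forall n, normc (g n x) <= C) -> nrm (j (S x)) <= C) ->
  exists y : nat -> Y, (forall n, nrm (y n) <= 1) /\
    forall x N r, 0 <= r -> (forall n, \sum_(N <= m < n) b m <= r) ->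
      nrm (j (S x) - \sum_(0 <= n < N) (h n (S x) : K) *: y n) <= r * Q x.
Proof.
move=> cY hg jS.
have linA : linear (fun x => j (S x)) by move=> a x y; rewrite !linearP.
pose A : {linear G -> Y} := HB.pack (fun x => j (S x))
  (GRing.isLinear.Build _ _ _ _ _ linA).
have sum_sq m n x r : 0 <= r -> \sum_(m <= k < n) b k <= r ->
    \sum_(m <= k < n) normc (g k x) ^+ 2 <= (r * Q x) ^+ 2.
  move=> r0 hr.
  have Qx := Bnorm_ge0 B x.
  have g0 k : 0 <= normc (g k x) by exact: normc_ge0.
  apply: le_trans (sum_sqr_le _ g0) _.
  rewrite ler_pXn2r// ?nnegrE ?mulr_ge0// ?sumr_ge0//.
  apply: le_trans (_ : _ <= (\sum_(m <= k < n) b k) * Q x) _.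
    by rewrite mulr_suml ler_sum.
  by rewrite ler_wpM2r.
have sqg : square_summable g.
  move=> x; exists ((bound * Q x) ^+ 2) => n.
  exact: sum_sq (b_le n).
have [y [y1 hy]] := l2_factor_expansion cY sqg (A := A) jS.
exists y; split=> // x N r r0 hr.
have Qx := Bnorm_ge0 B x.
apply: (@le_all_eps _ _ _ (r + bound)) => [|t t0]; first by rewrite addr_ge0.
have [u pu] := near_proj_exists BD BC BR B0 ker0 kerP x t0.
have orth := near_proj_orth BD BC BR B0 pu.
have Sxu : S (x - u) = S x.
  by rewrite linearB /=; have [_ -> _] := pu; rewrite subr0.
have h1 : nrm (j (S x) - \sum_(0 <= n < N) (g n (x - u) : K) *: y n) <= r * Q (x - u).
  rewrite -Sxu; apply: (hy (x - u)) => [|n]; first by rewrite mulr_ge0// Bnorm_ge0.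
  exact: sum_sq (hr n).
apply: le_trans (nrm_tri _ (\sum_(0 <= n < N) (g n (x - u) : K) *: y n) _) _.
have -> : r * Q x + (r + bound) * t = r * (Q x + t) + bound * t by ring.
apply: lerD; first by apply: le_trans h1 _; rewrite ler_wpM2l.
rewrite -sumrB; apply: (@le_trans _ _ (\sum_(0 <= n < N) b n * t)); last first.
  by rewrite -mulr_suml ler_wpM2r// ltW.
elim/big_rec2: _ => [|n u' v' _ IH]; first by rewrite nrm0.
apply: le_trans (nrmD _ _) _; rewrite lerD// -scalerBl nrmZ.
rewrite -[leRHS]mulr1 ler_pM ?normc_ge0 ?nrm_ge0//.
exact: hg.
Qed.

End nuclear_factorization.

(** * Nuclearity from summable functionals *)

Section nuclear_domination.
Variables (R : realType) (E G : lmodType R[i]) (S : {linear G -> E}).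
Variables (g e : nat -> {linear G -> R[i]^o}) (b : nat -> R) (bound : R).
Variable p : E -> R[i].
Local Notation K := R[i].
Local Notation normc := Normc.normc.
Local Notation B := (l2form e).
Local Notation Q := (Bnorm B).
Hypothesis S_surj : forall phi, exists x, S x = phi.
Hypothesis sq : square_summable e.
Hypothesis b_gt0 : forall n, 0 < b n.
Hypothesis b_le : forall n, \sum_(0 <= m < n) b m <= bound.
Hypothesis g_le : forall n x, normc (g n x) <= b n * Q x.
Hypothesis sp : seminorm p.
Hypothesis p_le : forall x C, 0 <= C -> (forall n, normc (g n x) <= C) ->
  p (S x) <= (C%:C)%C.

(** [s] is the seminorm that makes all the [h n / b n] contractive. In the nuclear representation
    these become the functionals, and the [b n] the summable coefficients. *)
Lemma seminorm_sup (h : nat -> {linear E -> K^o}) :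
  (forall phi, exists C, forall n, normc (h n phi) / b n <= C) ->
  exists s : E -> K, [/\ seminorm s,
    forall n phi, (normc (h n phi) / b n)%:C%C <= s phi
    & forall phi C, (forall n, normc (h n phi) / b n <= C) -> s phi <= C%:C%C].
Proof.
move=> hb; pose A phi := range (fun n => normc (h n phi) / b n).
have supA phi : has_sup (A phi).
  split; first by exists (normc (h 0 phi) / b 0), 0.
  by have [C hC] := hb phi; exists C => _ [n _ <-].
have le_sup n phi : normc (h n phi) / b n <= sup (A phi).
  by apply: ub_le_sup; [exact: (supA phi).2|exists n].
have sup_le phi C : (forall n, normc (h n phi) / b n <= C) -> sup (A phi) <= C.
  by move=> hC; apply: ge_sup; [exact: (supA phi).1|move=> _ [n _ <-]].
have sup_ge0 phi : 0 <= sup (A phi).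
  by apply: le_trans (le_sup 0 phi); rewrite divr_ge0 ?normc_ge0// ltW.
have supZ a phi : sup (A (a *: phi)) <= normc a * sup (A phi).
  apply: sup_le => n; rewrite linearZ /= Normc.normcM -mulrA.
  by rewrite ler_wpM2l ?normc_ge0.
exists (fun phi => (sup (A phi))%:C%C); split=> [|n phi|phi C hC]; rewrite ?lecR//; last exact: sup_le.
split=> [phi|phi psi|a phi]; first by rewrite ler0c.
  rewrite -rmorphD lecR; apply: sup_le => n; rewrite linearD.
  apply: le_trans (lerD (le_sup n phi) (le_sup n psi)).
  have bn : 0 <= (b n)^-1 by rewrite invr_ge0 ltW.
  by rewrite -mulrDl ler_wpM2r//; exact: le_normcD.
rewrite nrmE -rmorphM nrm_normc; congr (_%:C)%C.
apply/eqP; rewrite eq_le supZ /=.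
have [->|a0] := eqVneq a 0; first by rewrite Normc.normc0 mul0r.
have na : 0 < normc a.
  rewrite lt_neqAle normc_ge0 andbT eq_sym; apply: contra a0 => /eqP.
  by move/Normc.eq0_normc => ->.
have := supZ a^-1 (a *: phi); rewrite scalerA mulVf// scale1r Normc.normcV.
by rewrite mulrC ler_pdivlMr// mulrC.
Qed.

Lemma nuclear_canonical_map (h : nat -> {linear E -> K^o}) (q : E -> K)
    (X Y : completeNormedModType K) (i : {linear E -> X}) (j : {linear E -> Y}) :
  (forall n r x u, near_proj B (fun x => S x = 0) r x u ->
    normc (g n (x - u) - h n (S x)) <= b n * r) ->
  (forall phi, p phi <= q phi) ->
  (forall n phi, (normc (h n phi) / b n)%:C%C <= q phi) ->
  is_completion q i -> is_completion p j ->
  exists T : {linear X -> Y}, (forall x, T (i x) = j x) /\ nuclear_operator T.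
Proof.
move=> hg pq hq [iE di] [jE dj].
have cY := @approx_complete_banach R Y.
have nj_le phi : nrm (j phi) <= 1 * nrm (i phi).
  by rewrite mul1r -lecR -!nrmE iE jE.
have [T hT] := dense_extension cY ler01 di nj_le.
have Ti x : T (i x) = j x.
  apply/eqP; rewrite -subr_eq0; apply/eqP/nrm_eq0/eqP; rewrite eq_le nrm_ge0 andbT.
  by have := hT (i x) x; rewrite subrr nrm0 mulr0.
exists T; split=> //.
have linh n : linear (fun phi => ((b n)^-1%:C)%C * h n phi : K^o).
  by move=> a phi psi; rewrite linearP /GRing.scale/=; ring.
pose h1 n : {linear E -> K^o} := HB.pack (fun phi => ((b n)^-1%:C)%C * h n phi : K^o)
  (GRing.isLinear.Build _ _ _ _ _ (linh n)).
have pt n : exists f : {linear X -> K^o}, forall xi x, nrm (f xi - h1 n x) <= 1 * nrm (xi - i x).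
  apply: dense_extension => //; first exact: approx_complete_scalar.
  move=> phi; rewrite mul1r -lecR -[leRHS]nrmE iE; apply: le_trans (hq n phi).
  have bn : 0 <= (b n)^-1 by rewrite invr_ge0 ltW.
  by rewrite lecR nrm_normc /= Normc.normcM normcR ger0_norm// mulrC.
have [f hf] := choice pt.
have jS x C : 0 <= C -> (forall n, normc (g n x) <= C) -> nrm (j (S x)) <= C.
  by move=> C0 hC; rewrite -lecR -nrmE jE; exact: p_le.
have [y [y1 hy]] := quotient_expansion sq b_le g_le cY hg jS.
have b_ge0 n : 0 <= b n by exact: ltW.
have cvb := bounded_series_cvg b_ge0 b_le.
have tail N n : \sum_(N <= m < n) b m <= limn (series b) - series b N.
  have ndb : nondecreasing_seq (series b) by apply: nondecreasing_series => m _ _.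
  have [Nn|nN] := leqP N n.
    rewrite lerBrDl; apply: le_trans (nondecreasing_cvgn_le ndb cvb n).
    by rewrite /series/= -big_cat_nat.
  by rewrite big_geq ?(ltnW nN)// subr_ge0; exact: nondecreasing_cvgn_le.
have tail0 N : 0 <= limn (series b) - series b N.
  by have := tail N N; rewrite big_geq.
have bound0 : 0 <= bound by have := b_le 0; rewrite big_geq.
exists (fun n => (b n)%:C%C), f, y; split.
- apply/cvg_ex; exists (limn (series b))%:C%C; apply: cvg_nrm => r r0.
  have /cvgrPdist_lt /(_ r r0) := cvb; apply: filterS => n.
  suff -> : series (fun n0 => `|(b n0)%:C%C| : K^o) n = (series b n)%:C%C.
    by rewrite -rmorphB nrm_normc normcR.
  rewrite /series/= rmorph_sum; apply: eq_bigr => m _.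
  by rewrite nrmE nrm_normc normcR ger0_norm.
- move=> n x; rewrite !nrmE lecR.
  have := hf n x 0; rewrite (linear0 i) (linear0 (h1 n)). by rewrite !subr0 mul1r.
- by move=> n; rewrite nrmE lecR.
move=> xi; apply: cvg_nrm => r r0.
(* One third of [r] pays for replacing [xi] by [i phi]. The truncation index [N] is fixed only
   afterwards, because it depends on [Q x] for a preimage [x] of [phi]; the truncation costs another
   third. *)
have d0 : 0 < r / (3 * (1 + bound)) by rewrite divr_gt0// mulr_gt0// ltr_wpDr.
have [phi hphi] := dense_approx di xi d0.
have [x Sx] := S_surj phi.
have Qx : 0 < Q x + 1 by rewrite ltr_wpDl// Bnorm_ge0.
have /cvgrPdist_lt /(_ _ (divr_gt0 r0 (mulr_gt0 (ltr0Sn R 2) Qx))) := cvb.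
apply: filterS => N; rewrite ger0_norm// => hN.
have E1 : nrm (T xi - j phi) <= nrm (xi - i phi) by have := hT xi phi; rewrite mul1r.
have E2 := hy x N _ (tail0 N) (tail N).
have E3 : nrm (\sum_(0 <= n < N) (h n (S x) : K) *: y n -
    series (fun n => ((b n)%:C%C * f n xi) *: y n) N) <= bound * nrm (xi - i phi).
  apply: le_trans (_ : _ <= \sum_(0 <= n < N) b n * nrm (xi - i phi)) _; last first.
    by rewrite -mulr_suml ler_wpM2r ?nrm_ge0.
  rewrite /series/= -sumrB.
  elim/big_rec2: _ => [|n u' v' _ IH]; first by rewrite nrm0.
  apply: le_trans (nrmD _ _) _; rewrite lerD// -scalerBl nrmZ.
  rewrite -[leRHS]mulr1 ler_pM ?normc_ge0 ?nrm_ge0//.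
  have -> : h n (S x) = (b n)%:C%C * h1 n phi :> K.
    by rewrite /= Sx mulrA -rmorphM divff ?gt_eqF// mul1r.
  rewrite -mulrBr Normc.normcM normcR ger0_norm// ler_wpM2l//.
  by have := hf n xi phi; rewrite mul1r nrmC nrm_normc.
have E4 : (limn (series b) - series b N) * Q x <= r / 3.
  apply: le_trans (_ : _ <= (limn (series b) - series b N) * (Q x + 1)) _.
    by rewrite ler_wpM2l// lerDl.
  by rewrite -ler_pdivlMr// -mulrA -invfM ltW.
have E5 : (1 + bound) * nrm (xi - i phi) <= r / 3.
  have b1 : 0 < 1 + bound by rewrite ltr_wpDr.
  by rewrite mulrC -ler_pdivlMr// -mulrA -invfM.
rewrite -Sx in E1 E3 E5.
have := nrm_tri (T xi) (j (S x)) (series (fun n => ((b n)%:C%C * f n xi) *: y n) N).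
have := nrm_tri (j (S x)) (\sum_(0 <= n < N) (h n (S x) : K) *: y n)
  (series (fun n => ((b n)%:C%C * f n xi) *: y n) N).
lra.
Qed.

(** [q] is [p] plus the supremum of the [h n / b n]. Its upper bound is stated on [G], where [Q]
    lives; the continuity of [q] is later derived from it. *)
Lemma nuclear_dominating_seminorm : exists q : E -> K,
  [/\ seminorm q, forall phi, p phi <= q phi,
    forall x, q (S x) <= p (S x) + (Q x)%:C%C
  & forall (X Y : completeNormedModType K) (i : {linear E -> X}) (j : {linear E -> Y}),
      is_completion q i -> is_completion p j ->
      exists T : {linear X -> Y}, (forall x, T (i x) = j x) /\ nuclear_operator T].
Proof.
have [h [h_le hg]] := quotient_functionals S_surj sq b_gt0 g_le.
have h_div n x : normc (h n (S x)) / b n <= Q x.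
  by rewrite ler_pdivrMr// mulrC.
have [|s [[s0 sD sZ] hs s_le]] := seminorm_sup (h := h).
  by move=> phi; have [x <-] := S_surj phi; exists (Q x).
have [p0 pD pZ] := sp.
exists (fun phi => p phi + s phi); split.
- split=> [x|x y|a x]; first by rewrite addr_ge0.
    by rewrite addrACA lerD.
  by rewrite pZ sZ mulrDr.
- by move=> phi; rewrite lerDl.
- by move=> x; rewrite lerD2l s_le.
move=> X Y i j; apply: (nuclear_canonical_map hg).
- by move=> phi; rewrite lerDl.
- by move=> n phi; apply: le_trans (hs n phi) _; rewrite lerDr.
Qed.

End nuclear_domination.

(** * Partial derivatives *)

Section line_derivatives.
Variables (R : realType) (d : nat).
Local Notation rV := 'rV[R]_d.
Local Notation dl j := (delta_mx 0 j : rV).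
Implicit Types (f : rV -> R) (x : rV).

Lemma is_derive_line f j x (t : R) : derivable f (x + t *: dl j) (dl j) ->
  is_derive t 1 (fun u => f (x + u *: dl j)) ('D_(dl j) f (x + t *: dl j)).
Proof.
move=> df.
have eq_quot : (fun h : R => h^-1 *: (((fun u => f (x + u *: dl j)) \o shift t) (h *: 1)
     - f (x + t *: dl j))) = 
   (fun h : R => h^-1 *: ((f \o shift (x + t *: dl j)) (h *: dl j) - f (x + t *: dl j))).
  apply/funext => h /=; congr (_ *: (f _ - _)).
  by rewrite scalerDl addrCA [h *: 1]mulr1.
apply: DeriveDef; first by rewrite /derivable eq_quot.
by rewrite /derive eq_quot.
Qed.

Lemma MVT_line f j x (h : R) : 0 < h -> (forall y, derivable f y (dl j)) ->
  exists2 c, 0 < c < h &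
    f (x + h *: dl j) - f x = h * 'D_(dl j) f (x + c *: dl j).
Proof.
move=> h0 df.
pose g u := f (x + u *: dl j).
have dg (t : R) : is_derive t 1 g ('D_(dl j) f (x + t *: dl j)) by apply: is_derive_line.
have cg : {within `[0, h], continuous g}.
  apply: continuous_subspaceT => t; apply: differentiable_continuous.
  by apply/derivable1_diffP; have [] := dg t.
have [] := @MVT R g (fun t => 'D_(dl j) f (x + t *: dl j)) 0 h h0 (fun t _ => dg t) cg.
move=> c; rewrite in_itv /= => hc; rewrite /g scale0r addr0 subr0 mulrC => eqc.
by exists c.
Qed.

Lemma derivable_shift f j x v : derivable f (x + v) (dl j) ->
  derivable (fun y => f (y + v)) x (dl j).
Proof.
rewrite /derivable.
suff -> : (fun h : R => h^-1 *: ((f \o shift (x + v)) (h *: dl j) - f (x + v))) =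
  (fun h : R => h^-1 *: (((fun y => f (y + v)) \o shift x) (h *: dl j) - f (x + v))) by [].
by apply/funext => h /=; rewrite addrA.
Qed.

Lemma derive_shift f j x v :
  'D_(dl j) (fun y => f (y + v)) x = 'D_(dl j) f (x + v).
Proof.
rewrite /derive.
suff -> : (fun h : R => h^-1 *: ((f \o shift (x + v)) (h *: dl j) - f (x + v))) =
  (fun h : R => h^-1 *: (((fun y => f (y + v)) \o shift x) (h *: dl j) - f (x + v))) by [].
by apply/funext => h /=; rewrite addrA.
Qed.

(** The mean value theorem twice: along the [i] direction for the increment of [f] in direction [j],
    then along [j] for the derivative in direction [i]. With [i] and [j] distinct it yields the
    symmetry of mixed derivatives, with [i = j] the size of the Faber-Schauder coefficients. *)
Lemma second_difference f i j x (h k : R) : 0 < h -> 0 < k ->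
  (forall y, derivable f y (dl i)) ->
  (forall y, derivable ('D_(dl i) f) y (dl j)) ->
  exists c c', [/\ 0 < c < h, 0 < c' < k &
    f (x + k *: dl j + h *: dl i) - f (x + k *: dl j) - (f (x + h *: dl i) - f x) =
    h * k * 'D_(dl j) ('D_(dl i) f) (x + c *: dl i + c' *: dl j)].
Proof.
move=> h0 k0 df ddf.
pose g y := f (y + k *: dl j) - f y.
have dg1 y : derivable (fun y => f (y + k *: dl j)) y (dl i) by exact: derivable_shift.
have dg y : derivable g y (dl i) by exact: derivableB.
have [c hc Ec] := MVT_line x h0 dg.
have [c' hc' Ec'] := MVT_line (x + c *: dl i) k0 ddf.
exists c, c'; split=> //.
rewrite -mulrA -Ec' -[LHS]/(f (x + k *: dl j + h *: dl i) - f (x + k *: dl j) -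
  (f (x + h *: dl i) - f x)).
have Dg : 'D_(dl i) g (x + c *: dl i) = 
   'D_(dl i) f (x + c *: dl i + k *: dl j) - 'D_(dl i) f (x + c *: dl i).
  by rewrite deriveB// derive_shift.
by rewrite -Dg -Ec /g (addrAC x (k *: _)); ring.
Qed.

Lemma norm_small2 (t c c' : R) i j : 0 < c < t -> 0 < c' < t ->
  `|c *: dl i + c' *: dl j| <= t * (`|dl i| + `|dl j|).
Proof.
move=> /andP[c0 ct] /andP[c0' ct'].
apply: le_trans (ler_normD _ _) _; rewrite !normrZ mulrDr !gtr0_norm//.
by rewrite lerD// ler_wpM2r// ltW.
Qed.

(** Both mixed derivatives, at points near [x], equal the same second difference over a square of
    side [t] divided by t^2; continuity at [x] does the rest. *)
Lemma derive_comm f i j x :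
  (forall y, derivable f y (dl i)) -> (forall y, derivable f y (dl j)) ->
  (forall y, derivable ('D_(dl i) f) y (dl j)) ->
  (forall y, derivable ('D_(dl j) f) y (dl i)) ->
  continuous ('D_(dl j) ('D_(dl i) f)) -> continuous ('D_(dl i) ('D_(dl j) f)) ->
  'D_(dl j) ('D_(dl i) f) x = 'D_(dl i) ('D_(dl j) f) x.
Proof.
move=> di dj dij dji cij cji; apply/eqP; rewrite -subr_eq0 -normr_eq0.
apply/eqP/le_anti; rewrite normr_ge0 andbT; apply/ler_addgt0Pl => e e0; rewrite addr0.
have e2 : 0 < e / 2 by rewrite divr_gt0.
have /cvgrPdist_le /(_ _ e2) := cij x; rewrite nearE => /nbhs_ballP[r /= r0 hr].
have /cvgrPdist_le /(_ _ e2) := cji x; rewrite nearE => /nbhs_ballP[r' /= r0' hr'].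
pose m := `|dl i| + `|dl j| + 1.
have m0 : 0 < m by rewrite ltr_wpDl// addr_ge0.
pose t := Num.min r r' / m.
have t0 : 0 < t by rewrite divr_gt0// lt_min r0.
have small c c' : 0 < c < t -> 0 < c' < t -> `|c *: dl i + c' *: dl j| < Num.min r r'.
  move=> hc hc'; apply: le_lt_trans (norm_small2 i j hc hc') _.
  by rewrite mulrAC ltr_pdivrMr// ltr_pM2l ?lt_min ?r0// ltrDl.
have [c [c' [hc hc' E]]] := second_difference x t0 t0 di dij.
have [b [b' [hb hb' E']]] := second_difference x t0 t0 dj dji.
have EE : 'D_(dl j) ('D_(dl i) f) (x + c *: dl i + c' *: dl j) =
    'D_(dl i) ('D_(dl j) f) (x + b *: dl j + b' *: dl i).
  have tt : t * t != 0 by rewrite mulf_neq0// gt_eqF.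
  have LL : f (x + t *: dl j + t *: dl i) - f (x + t *: dl j) - (f (x + t *: dl i) - f x) =
      f (x + t *: dl i + t *: dl j) - f (x + t *: dl i) - (f (x + t *: dl j) - f x).
    by rewrite (addrAC x (t *: dl j)); ring.
  exact (mulfI tt (etrans (esym E) (etrans LL E'))).
have := hr (x + c *: dl i + c' *: dl j); have := hr' (x + b *: dl j + b' *: dl i).
rewrite -!ball_normE /= -EE => /(_ _) h1 /(_ _) h2.
rewrite (splitr e); apply: le_trans (ler_distD ('D_(dl j) ('D_(dl i) f) (x + c *: dl i + c' *: dl j)) _ _) _.
apply: lerD; [apply: h2|rewrite distrC; apply: h1].
  rewrite -addrA opprD addrA subrr sub0r normrN.
  by apply: lt_le_trans (small _ _ hc hc') _; rewrite ge_min lexx.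
rewrite -addrA opprD addrA subrr sub0r normrN addrC.
by apply: lt_le_trans (small _ _ hb' hb) _; rewrite ge_min lexx orbT.
Qed.

Lemma partial_cat s s' f : partial (s ++ s') f = partial s (partial s' f).
Proof. exact: foldr_cat. Qed.

Lemma smooth_partial f s : smooth f -> smooth (partial s f).
Proof. by move=> sf s'; rewrite -partial_cat; exact: sf. Qed.

Lemma partial_swap i j s f : smooth f -> partial (i :: j :: s) f = partial (j :: i :: s) f.
Proof.
move=> sf; apply/funext => x /=; apply: derive_comm.
- exact: (sf s).2.
- exact: (sf s).2.
- exact: (sf (j :: s)).2.
- exact: (sf (i :: s)).2.
- exact: (sf [:: i, j & s]).1.
- exact: (sf [:: j, i & s]).1.
Qed.

Lemma partial_move s j s' f : smooth f -> partial (s ++ j :: s') f = partial (j :: s ++ s') f.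
Proof.
move=> sf; elim: s => // i s IH.
by rewrite [RHS](partial_swap _ _ _ sf) /=; move: IH => /= ->.
Qed.

(** Needed because [mi_partial] differentiates in the fixed order of [mi_seq], whereas the tensor
    operators add derivatives in front. *)
Lemma partial_perm s s' f : smooth f -> perm_eq s s' -> partial s f = partial s' f.
Proof.
move=> sf; elim: s s' => [|j s IH] s'; first by rewrite perm_sym => /perm_nilP ->.
move=> ps; have js' : j \in s' by rewrite -(perm_mem ps) mem_head.
case/splitPr: js' ps => s1 s2; rewrite perm_sym -(cat1s j s2) perm_catCA perm_sym /= perm_cons => ps.
by rewrite partial_move//= (IH _ ps).
Qed.

End line_derivatives.

(** * Faber-Schauder functionals *)

Section dyadic_functionals.
Variables (R : realType) (d : nat).
Local Notation rV := 'rV[R]_d.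
Local Notation dl j := (delta_mx 0 j : rV).
Implicit Types (f : rV -> R) (x : rV).

Definition upd x (j : 'I_d) (u : R) : rV := x + (u - x 0 j) *: dl j.

Lemma updE x j u i : upd x j u 0 i = if i == j then u else x 0 i.
Proof.
rewrite !mxE eqxx /= eq_sym; case: eqP => [->|_]; first by rewrite mulr1 subrKC.
by rewrite mulr0 addr0.
Qed.

Lemma upd_shift x j u h : upd x j (u + h) = upd x j u + h *: dl j.
Proof. by rewrite /upd (addrAC u) scalerDl addrA. Qed.

Lemma upd_id x j : upd x j (x 0 j) = x.
Proof. by rewrite /upd subrr scale0r addr0. Qed.

Lemma upd_upd x j u v : upd (upd x j u) j v = upd x j v.
Proof. by apply/rowP => i; rewrite !updE; case: eqP. Qed.

Lemma upd_add x i j u h : i != j -> upd (h *: dl i + x) j u = h *: dl i + upd x j u.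
Proof.
move=> ij; rewrite /upd -addrA; congr (_ + (_ + (_ - _) *: _)).
by rewrite !mxE eqxx /= (eq_sym j) (negPf ij) mulr0 add0r.
Qed.

(** A slice remains a function of all [d] variables, constant in the [j]-th, so that operators in
    different variables compose and commute with the derivatives in the other variables. *)
Definition slice (j : 'I_d) (u : R) f : rV -> R := fun x => f (upd x j u).

Lemma upd_continuous j u : continuous (fun x => upd x j u).
Proof.
have c1 : continuous (idfun : rV -> rV) by move=> x; exact: cvg_id.
have c0 : continuous (fun x : rV => x 0 j : R) by exact: coord_continuous.
have c2 : continuous (fun x : rV => u - x 0 j : R).
  move=> x; apply: (@continuousB R R _ (cst u) (fun x : rV => x 0 j)).
    exact: cst_continuous.
  exact: c0.
have c3 : continuous (fun x : rV => (u - x 0 j) *: dl j : rV).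
  by move=> x; exact: (cvgZr_tmp (c2 x)).
by move=> x; exact: (continuousD (c1 x) (c3 x)).
Qed.

Lemma slice_continuous j u f : continuous f -> continuous (slice j u f).
Proof. by move=> cf x; apply: (continuous_comp (@upd_continuous j u x)); exact: cf. Qed.

Lemma derivable_slice i j u f x : i != j -> derivable f (upd x j u) (dl i) ->
  derivable (slice j u f) x (dl i).
Proof.
move=> ij; rewrite /derivable.
suff -> : (fun h : R => h^-1 *: ((f \o shift (upd x j u)) (h *: dl i) - f (upd x j u))) =
  (fun h : R => h^-1 *: ((slice j u f \o shift x) (h *: dl i) - slice j u f x)) by [].
by apply/funext => h /=; rewrite /slice upd_add.
Qed.

Lemma derive_slice i j u f : i != j ->
  'D_(dl i) (slice j u f) = slice j u ('D_(dl i) f).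
Proof.
move=> ij; apply/funext => x; rewrite /slice /derive.
suff -> : (fun h : R => h^-1 *: ((f \o shift (upd x j u)) (h *: dl i) - f (upd x j u))) =
  (fun h : R => h^-1 *: (((fun x => f (upd x j u)) \o shift x) (h *: dl i) - f (upd x j u))) by [].
by apply/funext => h /=; rewrite upd_add.
Qed.

Lemma slice_line j u f x h : slice j u f (h *: dl j + x) = slice j u f x.
Proof.
rewrite /slice; congr f; apply/rowP => i; rewrite !updE; case: eqP => // ij.
by rewrite !mxE eqxx /=; case: eqP => // _; rewrite mulr0 add0r.
Qed.

Lemma derivable_slice_same j u f x : derivable (slice j u f) x (dl j).
Proof.
rewrite /derivable.
suff -> : (fun h : R => h^-1 *: ((slice j u f \o shift x) (h *: dl j) - slice j u f x)) =
  cst 0 by exact: is_cvg_cst.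
by apply/funext => h; rewrite /= slice_line subrr scaler0.
Qed.

Lemma derive_slice_same j u f : 'D_(dl j) (slice j u f) = 0.
Proof.
apply/funext => x; rewrite /derive.
suff -> : (fun h : R => h^-1 *: ((slice j u f \o shift x) (h *: dl j) - slice j u f x)) =
  cst 0 by exact: lim_cst.
by apply/funext => h; rewrite /= slice_line subrr scaler0.
Qed.

Lemma partial_slice j u f s :
  partial s (slice j u f) = if j \in s then 0 else slice j u (partial s f).
Proof.
elim: s => //= i s ->; rewrite inE.
have [->|ij] /= := eqVneq j i.
  case: ifP => _; last exact: derive_slice_same.
  by apply/funext => x; exact: derive_cst.
case: ifP => _; first by apply/funext => x; exact: derive_cst.
by rewrite derive_slice// eq_sym.
Qed.

Lemma smooth_slice j u f : smooth f -> smooth (slice j u f).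
Proof.
move=> sf s; have [cf df] := sf s; rewrite partial_slice; case: ifP => js.
  split=> [|i x]; last exact: derivable_cst.
  exact: cst_continuous.
split=> [|i x]; first exact: slice_continuous.
have [->|ij] := eqVneq i j; first exact: derivable_slice_same.
exact: derivable_slice.
Qed.

(** [inl] stands for the two endpoints, [inr (l, k)] for the [k]-th dyadic interval of level [l].
    Pairs with k >= 2^l are padding, with zero operator and zero weight. *)
Definition dyadic_index := (bool + nat * nat)%type.

(* Faber-Schauder coefficients: the second difference at the midpoint of the
   [k]-th dyadic interval of level [l] is of size [4^-l] on functions with bounded
   second derivative; the weights [(3/2)^l] still make the [2^l] functionals of
   level [l] summable, whereas their inverses sum up to [1/2]. *)
Definition dyadic_point (o r : R) (l k : nat) : R := o + r * (k%:R / 2 ^+ l).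

Variables (o : 'I_d -> R) (r : R).
Hypothesis r_gt0 : 0 < r.
Hypothesis r_le1 : r <= 1.

Definition dyadic_op (j : 'I_d) (t : dyadic_index) f : rV -> R :=
  match t with
  | inl false => 2 *: slice j (o j) f
  | inl true => 2 *: slice j (o j + r) f
  | inr (l, k) => if (k < 2 ^ l)%N then
      (6 * (3 / 2) ^+ l) *: (slice j (dyadic_point (o j) r l.+1 k.*2.+1) f +
        (- 2^-1) *: (slice j (dyadic_point (o j) r l k) f +
                     slice j (dyadic_point (o j) r l k.+1) f))
      else 0
  end.

(** At level [l] the coefficient is half a second difference of step at most 2^-(l+1), scaled by 6
    (3/2)^l; this gives 6 (3/2)^l * 1/2 * 4^-(l+1) = 3/4 (3/8)^l. *)
Definition dyadic_weight (t : dyadic_index) : R :=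
  match t with
  | inl _ => 2
  | inr (l, k) => if (k < 2 ^ l)%N then 3 / 4 * (3 / 8) ^+ l else 0
  end.

Lemma dyadic_weight_ge0 t : 0 <= dyadic_weight t.
Proof.
by case: t => [[]|[l k]] //=; case: ifP => // _; rewrite mulr_ge0 ?exprn_ge0// divr_ge0.
Qed.

Lemma smooth_dyadic_op j t f : smooth f -> smooth (dyadic_op j t f).
Proof.
move=> sf; have ss u := smooth_slice j u sf.
case: t => [[]|[l k]] /=; [exact (smoothZ _ (ss _))|exact (smoothZ _ (ss _))|].
case: ifP => _; last exact (@smooth0 R d).
exact (smoothZ _ (smoothD (ss _) (smoothZ _ (smoothD (ss _) (ss _))))).
Qed.

Lemma dyadic_opP j t a f g :
  dyadic_op j t (a *: f + g) = a *: dyadic_op j t f + dyadic_op j t g.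
Proof.
apply/funext => x; case: t => [[]|[l k]] /=; last case: ifP => _;
  rewrite /slice !fctE /GRing.scale/=; try ring.
by rewrite -[0 x]/(0 : R) mulr0 addr0.
Qed.

Lemma partial_dyadic_op j t f s : smooth f -> j \notin s ->
  partial s (dyadic_op j t f) = dyadic_op j t (partial s f).
Proof.
move=> sf js; have ss u := smooth_slice j u sf.
have ps u : partial s (slice j u f) = slice j u (partial s f).
  by rewrite partial_slice (negPf js).
case: t => [[]|[l k]] /=.
- by rewrite (partialZ _ _ (ss _)) ps.
- by rewrite (partialZ _ _ (ss _)) ps.
case: ifP => _; last exact: partial0.
set u := dyadic_point _ _ l.+1 _; set v := dyadic_point _ _ _ _; set w := dyadic_point _ _ _ _.
have s2 := smoothD (ss v) (ss w); have s1 := smoothZ (- 2^-1) s2.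
rewrite (partialZ _ _ (smoothD (ss u) s1)) (partialD _ (ss u) s1) (partialZ _ _ s2).
by rewrite (partialD _ (ss v) (ss w)) !ps.
Qed.

Definition in_cube x := forall j, o j <= x 0 j <= o j + r.

Lemma dyadic_pointS (a : R) l k : dyadic_point a r l.+1 k.*2 = dyadic_point a r l k.
Proof. by rewrite /dyadic_point -mul2n natrM exprS; congr (_ + _ * _); field. Qed.

(** The factor 2 at the endpoints gives A/2 at level 0. Passing to level l+1, even points are old,
    and an odd point differs from the average of its neighbours by at most A/6 (2/3)^l; the partial
    sums of these increments give the bound. *)
Lemma dyadic_point_le f j x A : (forall t, `|dyadic_op j t f x| <= A) ->
  forall l k, (k <= 2 ^ l)%N ->
  `|slice j (dyadic_point (o j) r l k) f x| <= A * (1 - 2^-1 * (2 / 3) ^+ l).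
Proof.
move=> hA; have A0 : 0 <= A by exact: le_trans (hA (inl true)).
elim=> [|l IH] k.
  have h t : `|2 * slice j t f x| <= A -> `|slice j t f x| <= A * (1 - 2^-1).
    by rewrite normrM (@ger0_norm _ 2)//; lra.
  have h1 := h _ (hA (inl true)); have h0 := h _ (hA (inl false)).
  case: k => [|[|]]// _; rewrite /dyadic_point expr0 divr1 ?mulr0 ?mulr1 ?addr0//.
move=> hk; rewrite -(odd_double_half k) in hk *; set m := k./2 in hk *.
have p0 : 0 <= (2 / 3) ^+ l :> R by rewrite exprn_ge0// divr_ge0.
have step : A * (1 - 2^-1 * (2 / 3) ^+ l) <= A * (1 - 2^-1 * (2 / 3) ^+ l.+1).
  by rewrite ler_wpM2l// exprS; lra.
case: (odd k) hk => /=; rewrite ?add1n ?add0n => hk; last first.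
  rewrite dyadic_pointS; apply: le_trans step; apply: IH.
  by move: hk; rewrite expnS mul2n leq_double.
have mk : (m < 2 ^ l)%N by move: hk; rewrite expnS mul2n ltn_double.
have := hA (inr (l, m)); rewrite /= mk.
have := IH _ mk; have := IH _ (ltnW mk).
set y := slice _ _ f x; set z := slice _ _ f x; set w := slice _ _ f x => hy hz.
rewrite -[X in `|X| <= _ -> _]/(6 * (3 / 2) ^+ l * (w + - 2^-1 * (y + z))).
have c0 : 0 < 6 * (3 / 2) ^+ l :> R by rewrite mulr_gt0// exprn_gt0// divr_gt0.
rewrite normrM (ger0_norm (ltW c0)) mulrC -ler_pdivlMr// => hw.
have : A / (6 * (3 / 2) ^+ l) = A * (6^-1 * (2 / 3) ^+ l).
  by rewrite invfM -exprVn invf_div.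
move=> EA; rewrite EA in hw.
have -> : A * (1 - 2^-1 * (2 / 3) ^+ l.+1) =
    A * (1 - 2^-1 * (2 / 3) ^+ l) + A * (6^-1 * (2 / 3) ^+ l).
  by rewrite exprS; field.
move: hy hz hw; rewrite !ler_norml; move: (A * (6^-1 * _)) (A * (_ - _)) => u v.
move=> /andP[? ?] /andP[? ?] /andP[? ?]; apply/andP; split; lra.
Qed.

Lemma dyadic_approx (v e : R) : 0 <= v <= 1 -> 0 < e ->
  exists l k, (k <= 2 ^ l)%N /\ `|v - k%:R / 2 ^+ l| < e.
Proof.
move=> /andP[v0 v1] e0.
have [l _ /(_ l (leqnn l)) /= hl] := near_infty_natSinv_expn_lt (PosNum e0).
exists l, (Num.trunc (v * 2 ^+ l)).
have p0 : 0 < 2 ^+ l :> R by rewrite exprn_gt0.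
have vp0 : 0 <= v * 2 ^+ l by rewrite mulr_ge0// ltW.
have /andP[h1 h2] := truncn_itv vp0.
split.
  rewrite -(ler_nat R) natrX; apply: le_trans h1 _.
  by rewrite ler_piMl// ltW.
apply: le_lt_trans hl; rewrite div1r ler_distl; apply/andP; split.
  by rewrite -(ler_pM2r p0) mulrDl mulNr divfK ?gt_eqF// mulVf ?gt_eqF//; lra.
rewrite -(ler_pM2r p0) mulrDl divfK ?gt_eqF// mulVf ?gt_eqF//.
by rewrite -natr1 in h2; lra.
Qed.

(** The bound at dyadic points extends to the interval by density and continuity. *)
Lemma dyadic_op_lower f j x A : continuous f ->
  (forall t, `|dyadic_op j t f x| <= A) ->
  forall u, o j <= u <= o j + r -> `|slice j u f x| <= A.
Proof.
move=> cf hA u /andP[u0 u1]; have A0 : 0 <= A by exact: le_trans (hA (inl true)).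
apply/ler_addgt0Pr => e e0.
have cg : continuous (fun u => f (upd x j u)).
  move=> t; apply: (@continuous_comp _ _ _ (fun u => upd x j u) f); last exact: cf.
  have c2 : continuous (fun u : R => u - x 0 j : R).
    move=> v; apply: (@continuousB R R _ idfun (cst (x 0 j))).
      exact: cvg_id.
    exact: cst_continuous.
  have c3 : continuous (fun u : R => (u - x 0 j) *: dl j : rV).
    by move=> v; exact: (cvgZr_tmp (c2 v)).
  have c1 : continuous (fun _ : R => x : rV) by exact: cst_continuous.
  exact: (continuousD (c1 t) (c3 t)).
have /cvgrPdist_le /(_ _ e0) := cg u; rewrite nearE => /nbhs_ballP[q /= q0 hq].
have hv : 0 <= (u - o j) / r <= 1.
  apply/andP; split; first by rewrite divr_ge0 ?subr_ge0// ltW.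
  by rewrite ler_pdivrMr// mul1r; lra.
have [l [k [hk hd]]] := dyadic_approx hv (divr_gt0 q0 r_gt0).
have := hq (dyadic_point (o j) r l k); rewrite -ball_normE /=.
have -> : u - dyadic_point (o j) r l k = r * ((u - o j) / r - k%:R / 2 ^+ l).
  by rewrite /dyadic_point; field; rewrite ?gt_eqF ?exprn_gt0.
rewrite normrM (gtr0_norm r_gt0) mulrC -ltr_pdivlMr// => /(_ hd) h1.
have h2 := dyadic_point_le hA hk; rewrite /slice in h2 *.
have h3 : A * (1 - 2^-1 * (2 / 3) ^+ l) <= A.
  by rewrite ler_piMr// gerBl mulr_ge0// exprn_ge0// divr_ge0.
have := ler_normD (f (upd x j u) - f (upd x j (dyadic_point (o j) r l k))) (f (upd x j (dyadic_point (o j) r l k))).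
rewrite subrK; lra.
Qed.

Lemma dyadic_op_upper f j t x N : smooth f -> in_cube x ->
  (forall y, in_cube y -> `|f y| <= N) ->
  (forall y, in_cube y -> `|partial [:: j; j] f y| <= N) ->
  `|dyadic_op j t f x| <= dyadic_weight t * N.
Proof.
move=> sf cx hf hddf; have r0 := ltW r_gt0.
have cu u : o j <= u <= o j + r -> in_cube (upd x j u).
  by move=> hu i; rewrite updE; case: eqP => [->|].
case: t => [[]|[l k]] /=.
- rewrite [leLHS]normrM ger0_norm// ler_pM2l//; apply/hf/cu.
  by rewrite lexx lerDl r0.
- rewrite [leLHS]normrM ger0_norm// ler_pM2l//; apply/hf/cu.
  by rewrite lexx lerDl r0.
case: ifP => kl; last by rewrite normr0 mul0r.
set p := dyadic_point (o j) r l k.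
pose h := r / 2 ^+ l.+1.
have h0 : 0 < h by rewrite divr_gt0// exprn_gt0.
have Em : dyadic_point (o j) r l.+1 k.*2.+1 = p + h.
  rewrite /p /h /dyadic_point -addn1 natrD -mul2n natrM exprS; field.
  by rewrite expf_neq0.
have Eq : dyadic_point (o j) r l k.+1 = p + h + h.
  rewrite /p /h /dyadic_point -natr1 exprS; field.
  by rewrite expf_neq0.
have pin : o j <= p /\ p + h + h <= o j + r.
  split; first by rewrite /p /dyadic_point lerDl mulr_ge0// divr_ge0// exprn_ge0.
  rewrite -Eq /dyadic_point lerD2l ler_piMr// ler_pdivrMr ?exprn_gt0// mul1r.
  by rewrite -natrX ler_nat.
have D1 y : derivable f y (dl j) by exact: (sf [::]).2.
have D2 y : derivable ('D_(dl j) f) y (dl j) by exact: (sf [:: j]).2.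
(* The expression at the midpoint is -1/2 times the second difference with step [h] based at [p]. *)
have [c [c' [hc hc' E]]] := second_difference (upd x j p) h0 h0 D1 D2.
rewrite /slice -!upd_shift in E.
have bE : `|partial [:: j; j] f (upd x j (p + c + c'))| <= N.
  by apply/hddf/cu; move: hc hc' pin => /andP[? ?] /andP[? ?] [? ?]; apply/andP; split; lra.
rewrite Em Eq.
set w := 6 * _; have w0 : 0 < w by rewrite mulr_gt0// exprn_gt0// divr_gt0.
rewrite [leLHS]normrM (gtr0_norm w0).
set V := (X in w * `|X|).
have -> : V = - 2^-1 * (h * h * partial [:: j; j] f (upd x j (p + c + c'))).
  by rewrite -E /V /slice !fctE /GRing.scale/=; field.
rewrite normrM normrN (@ger0_norm _ 2^-1)// normrM (@ger0_norm _ (h * h)) ?mulr_ge0 ?(ltW h0)//.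
have hh : h * h <= (4^-1) ^+ l.+1.
  have -> : 4^-1 = 2^-1 * 2^-1 :> R by field.
  rewrite exprMn; have : h <= 2^-1 ^+ l.+1.
    by rewrite exprVn /h ler_piMl// invr_ge0 exprn_ge0.
  by move=> hl; rewrite ler_pM// ltW.
have N0 : 0 <= N by apply: le_trans (hf x cx); exact: normr_ge0.
apply: le_trans (_ : _ <= w * (2^-1 * ((4^-1) ^+ l.+1 * N))) _.
  rewrite ler_pM2l// ler_pM2l// ler_pM// mulr_ge0//; exact: ltW.
rewrite le_eqVlt; apply/orP; left; apply/eqP; rewrite /w exprS.
have -> : (3 / 8) ^+ l = (3 / 2) ^+ l * 4^-1 ^+ l :> R.
  by rewrite -exprMn; congr (_ ^+ _); field.
by field.
Qed.

Fixpoint tensor_op (s : seq 'I_d) (tau : seq dyadic_index) f :=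
  match s, tau with
  | j :: s', t :: tau' => tensor_op s' tau' (dyadic_op j t f)
  | _, _ => f
  end.

Definition tensor_weight (tau : seq dyadic_index) : R := \prod_(t <- tau) dyadic_weight t.

Lemma tensor_opP s tau a f g :
  tensor_op s tau (a *: f + g) = a *: tensor_op s tau f + tensor_op s tau g.
Proof.
elim: s tau f g => [|j s IH] [|t tau] f g //=.
by rewrite dyadic_opP IH.
Qed.

(** One variable at a time: by induction every [dyadic_op j t f] is bounded by [A] at [y] with its
    [j]-th coordinate reset to that of [x], and [dyadic_op_lower] then frees this coordinate. *)
Lemma tensor_op_lower s f A x : uniq s -> smooth f ->
  (forall tau, size tau = size s -> `|tensor_op s tau f x| <= A) ->
  forall y : rV, (forall i, if i \in s then is_true (o i <= y 0 i <= o i + r) else y 0 i = x 0 i) ->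
  `|f y| <= A.
Proof.
elim: s f => [|j s IH] f /=.
  move=> _ sf /(_ [::] erefl) /= h y hy; suff -> : y = x by [].
  by apply/rowP => i; exact: hy.
move=> /andP[js us] sf h y hy.
pose z := upd y j (x 0 j).
have hop t : `|dyadic_op j t f z| <= A.
  apply: (IH _ us (smooth_dyadic_op j t sf)) => [tau st|i].
    by apply: (h (t :: tau)); rewrite /= st.
  have := hy i; rewrite inE /z updE; have [->|ij] //= := eqVneq i j.
  by rewrite (negPf js).
have := hy j; rewrite inE eqxx /= => hyj.
have := dyadic_op_lower (sf [::]).1 hop hyj.
by rewrite /slice /z upd_upd upd_id.
Qed.

(** For each subset of [s], the derivative taken twice in every variable of the subset is bounded by
    [N] on the cube. This is what one second difference per variable consumes. *)
Fixpoint doubly_bounded (s : seq 'I_d) f (N : R) : Prop :=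
  match s with
  | [::] => forall y, in_cube y -> `|f y| <= N
  | j :: s' => doubly_bounded s' f N /\ doubly_bounded s' (partial [:: j; j] f) N
  end.

Lemma doubly_bounded_op s j t f N : smooth f -> j \notin s ->
  doubly_bounded s f N -> doubly_bounded s (partial [:: j; j] f) N ->
  doubly_bounded s (dyadic_op j t f) (dyadic_weight t * N).
Proof.
elim: s f => [|i s IH] f sf.
  by move=> _ /= h h' y cy; exact: dyadic_op_upper.
rewrite inE negb_or => /andP[ji js] [h1 h2] [h3 h4].
split; first exact (IH _ sf js h1 h3).
have jii : j \notin [:: i; i] by rewrite !inE negb_or ji.
rewrite (partial_dyadic_op _ sf jii).
apply: (IH _ (smooth_partial [:: i; i] sf) js h2).
have pe : perm_eq [:: j; j; i; i] [:: i; i; j; j] by rewrite (perm_catC [:: j; j] [:: i; i]).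
by move: h4; rewrite -!partial_cat (partial_perm sf pe).
Qed.

Lemma tensor_op_upper s tau f N x : uniq s -> size tau = size s -> smooth f ->
  in_cube x -> doubly_bounded s f N -> `|tensor_op s tau f x| <= tensor_weight tau * N.
Proof.
elim: s tau f N => [|j s IH] [|t tau] f N //=.
  by move=> _ _ sf cx; rewrite /tensor_weight big_nil mul1r; exact.
move=> /andP[js us] [st] sf cx [h1 h2].
rewrite /tensor_weight big_cons mulrAC (mulrC _ (\prod_(_ <- _) _)).
apply: (IH _ _ _ us st (smooth_dyadic_op j t sf) cx).
exact (doubly_bounded_op t sf js h1 h2).
Qed.

(** Two derivatives per variable: the origin of the order [2 * d] in the condition on the weight
    sequences. *)
Lemma doubly_bounded_partial s w f N : smooth f ->
  (forall w', (size w' <= 2 * size s)%N ->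
    forall y, in_cube y -> `|partial (w' ++ w) f y| <= N) ->
  doubly_bounded s (partial w f) N.
Proof.
move=> sf; elim: s w => [|j s IH] w h; first by move=> y; exact: (h [::]).
split.
  by apply: IH => w' hw'; apply: h; rewrite (leq_trans hw')//= mulnS leq_addl.
rewrite -partial_cat; apply: IH => w' hw'.
have -> : w' ++ [:: j; j] ++ w = (w' ++ [:: j; j]) ++ w by rewrite -catA.
by apply: h; rewrite size_cat /= addn2 mulnS.
Qed.

End dyadic_functionals.

(** * Unordered sums *)

Section unordered_sums.
Variable R : realFieldType.

(** Bounding the finite sums over duplicate-free lists makes sums over different countable index
    sets comparable without enumerating them. *)
Definition sum_le (I : eqType) (b : I -> R) (C : R) :=
  forall s : seq I, uniq s -> \sum_(i <- s) b i <= C.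

Lemma sum_le_subset (I : eqType) (b : I -> R) (s1 s2 : seq I) :
  (forall i, 0 <= b i) -> uniq s1 -> {subset s1 <= s2} ->
  \sum_(i <- s1) b i <= \sum_(i <- s2) b i.
Proof.
move=> b0; elim: s1 s2 => [|x s1 IH] s2 /=; first by rewrite big_nil sumr_ge0.
move=> /andP[xs1 us1] sub; have xs2 : x \in s2 by apply: sub; rewrite mem_head.
rewrite big_cons (big_rem x xs2) /= lerD2l; apply: IH => // y ys1.
have := perm_mem (perm_to_rem xs2) y; rewrite sub ?inE ?ys1 ?orbT//.
by case: eqP => // yx _; rewrite -yx ys1 in xs1.
Qed.

(** Every finite set of pairs lies in the product of its two projections. *)
Lemma sum_le_dep (I J : eqType) (b : I * J -> R) (B : I -> R) (C : R) :
  (forall ij, 0 <= b ij) -> (forall i, sum_le (fun j => b (i, j)) (B i)) ->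
  sum_le B C -> sum_le b C.
Proof.
move=> b0 hB hC s us.
pose s1 := undup [seq ij.1 | ij <- s]; pose s2 := undup [seq ij.2 | ij <- s].
apply: (@le_trans _ _ (\sum_(ij <- [seq (i, j) | i <- s1, j <- s2]) b ij)).
  apply: sum_le_subset => // -[i j] ijs; apply/allpairsP; exists (i, j).
  by rewrite !mem_undup; split=> //; apply/mapP; exists (i, j).
rewrite big_allpairs; apply: le_trans (hC s1 (undup_uniq _)).
by apply: ler_sum => i _; apply: hB; exact: undup_uniq.
Qed.

Lemma sum_le_inj (I J : eqType) (h : I -> J) (b : J -> R) (b' : I -> R) (C : R) :
  injective h -> (forall i, b' i = b (h i)) -> sum_le b C -> sum_le b' C.
Proof.
move=> hi hb bC s us.
have := bC (map h s); rewrite map_inj_uniq// => /(_ us); rewrite big_map.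
by under eq_bigr do rewrite -hb.
Qed.

Lemma sum_leZ (I : eqType) (b : I -> R) c C : 0 <= c -> sum_le b C ->
  sum_le (fun i => c * b i) (c * C).
Proof. by move=> c0 bC s us; rewrite -mulr_sumr ler_wpM2l// bC. Qed.

Lemma sum_le_mono (I : eqType) (b b' : I -> R) C C' :
  (forall i, b i <= b' i) -> C' <= C -> sum_le b' C' -> sum_le b C.
Proof.
by move=> bb CC h s us; apply: le_trans CC; apply: le_trans (h s us); exact: ler_sum.
Qed.

Lemma sum_le_prod (I J : eqType) (b : I -> R) (c : J -> R) B C :
  (forall i, 0 <= b i) -> (forall j, 0 <= c j) ->
  sum_le b B -> sum_le c C -> sum_le (fun ij : I * J => b ij.1 * c ij.2) (B * C).
Proof.
move=> b0 c0 bB cC.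
have C0 : 0 <= C by have := cC [::] erefl; rewrite big_nil.
apply: (@sum_le_dep _ _ _ (fun i => b i * C)).
- by move=> ij; rewrite mulr_ge0.
- by move=> i /=; exact: sum_leZ.
- by move=> s us; rewrite -mulr_suml ler_wpM2r// bB.
Qed.

Lemma sum_le_nat (b : nat -> R) C : (forall n, 0 <= b n) ->
  (forall n, \sum_(0 <= m < n) b m <= C) -> sum_le b C.
Proof.
move=> b0 h s us; apply: le_trans (h (\max_(i <- s) i).+1).
apply: sum_le_subset => // i si; rewrite mem_index_iota leq0n ltnS /=.
exact: leq_bigmax_seq.
Qed.

Lemma sum_le_geometric (q : R) : 0 <= q < 1 -> sum_le (fun n => q ^+ n) (1 - q)^-1.
Proof.
move=> /andP[q0 q1]; apply: sum_le_nat => [n|n]; first exact: exprn_ge0.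
have q1' : 0 < 1 - q by rewrite subr_gt0.
rewrite -[leRHS]mul1r ler_pdivlMr// big_mkord mulrC -opprB mulNr -subrX1 opprB.
by rewrite gerBl exprn_ge0.
Qed.

Lemma sum_le_initial (n : nat) (c : R) : 0 <= c ->
  sum_le (fun k => if (k < n)%N then c else 0) (n%:R * c).
Proof.
move=> c0; apply: sum_le_nat => [k|k]; first by case: ifP.
rewrite -big_mkcond /=.
have -> : \sum_(0 <= i < k | (i < n)%N) c = \sum_(i <- [seq i <- index_iota 0 k | (i < n)%N]) c.
  by rewrite big_filter.
have -> : n%:R * c = \sum_(0 <= i < n) c.
  by rewrite big_const_nat subn0 iter_addr_0 mulr_natl.
apply: sum_le_subset => //; first by rewrite filter_uniq// iota_uniq.
by move=> i; rewrite mem_filter !mem_index_iota => /andP[].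
Qed.

Lemma sum_le_tuple (T : eqType) (b : T -> R) B n : (forall t, 0 <= b t) ->
  sum_le b B -> sum_le (fun t : n.-tuple T => \prod_(x <- t) b x) (B ^+ n).
Proof.
move=> b0 bB; elim: n => [|n IH].
  have uq (t : 0.-tuple T) : t = [tuple] by rewrite tuple0.
  move=> s us; rewrite expr0; case: s us => [|t [|t' s]] /=; first by rewrite big_nil.
    by rewrite big_seq1 (uq t) big_nil.
  by rewrite (uq t) (uq t') mem_head.
apply: (@sum_le_inj _ _ (fun t : n.+1.-tuple T => (thead t, [tuple of behead t]))
  (fun z => b z.1 * \prod_(x <- z.2) b x)).
- move=> t t' [h1 h2]; rewrite (tuple_eta t) (tuple_eta t') h1.
  by apply/val_inj; rewrite /= h2.
- by move=> t; case/tupleP: t => x t; rewrite /= big_cons theadE.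
have p0 (t : n.-tuple T) : 0 <= \prod_(x <- t) b x by apply: prodr_ge0.
by rewrite exprS; exact: (sum_le_prod b0 p0 bB IH).
Qed.

(** The added powers of 1/2, of total at most 2, make every term positive, also at numbers coding no
    index and where [b] vanishes; the terms later occur as denominators. *)
Lemma sum_le_pickle (I : countType) (b : I -> R) B : (forall i, 0 <= b i) ->
  sum_le b B ->
  forall n, \sum_(0 <= m < n) (oapp b 0 (pickle_inv m) + 2^-1 ^+ m) <= B + 2.
Proof.
move=> b0 bB n; rewrite big_split /= lerD//; last first.
  have q1 : 0 <= (2^-1 : R) < 1 by apply/andP; split; lra.
  apply: le_trans (sum_le_geometric q1 (iota_uniq 0 (n - 0))) _.
  by rewrite (_ : 1 - 2^-1 = 2^-1 :> R) ?invrK//; field.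
have -> : \sum_(0 <= i < n) oapp b 0 (pickle_inv i) =
    \sum_(i <- pmap pickle_inv (index_iota 0 n)) b i.
  elim: index_iota => [|m s IH]; first by rewrite !big_nil.
  by rewrite big_cons IH /=; case: pickle_inv => [i|] /=; rewrite ?big_cons ?add0r.
apply: bB; apply: (pmap_uniq (g := pickle)); last exact: iota_uniq.
exact: pickle_invK.
Qed.

End unordered_sums.

(** * Total mass of the weights *)

Section weight_sums.
Variable R : realType.

Lemma dyadic_weight_sum : sum_le (@dyadic_weight R) 16.
Proof.
(* The endpoints become level 0 and the other levels move up by one. *)
pose b (lk : nat * nat) : R := match lk with
  | (0, k) => if (k < 2)%N then 2 else 0
  | (l.+1, k) => if (k < 2 ^ l)%N then 3 / 4 * (3 / 8) ^+ l else 0 end.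
pose h (t : dyadic_index) : nat * nat := match t with
  inl c => (0%N, c : nat) | inr (l, k) => (l.+1, k) end.
have c0 l : 0 <= 3 / 4 * (3 / 8) ^+ l :> R by rewrite mulr_ge0 ?exprn_ge0// divr_ge0.
apply: (@sum_le_inj _ _ _ h b).
- by move=> [[]|[l k]] [[]|[l' k']] //= [] -> // ->.
- by move=> [[]|[l k]].
(* Level 0 contributes 4, and level l+1 contributes 2^l * 3/4 (3/8)^l = (3/4)^(l+1). The common
   majorant 4 (3/4)^l sums to 16. *)
apply: (@sum_le_dep _ _ _ _ (fun l => 4 * (3 / 4) ^+ l)).
- by move=> [[|l] k] /=; case: ifP.
- move=> [|l].
    apply: sum_le_mono (sum_le_initial 2 (c := 2) _) => //.
    by rewrite expr0; lra.
  apply: sum_le_mono (sum_le_initial (2 ^ l) (c0 l)) => //.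
  rewrite natrX mulrCA -exprMn exprS.
  have -> : 2 * (3 / 8) = 3 / 4 :> R by field.
  rewrite mulrA ler_wpM2r ?exprn_ge0 ?divr_ge0//; lra.
apply: sum_le_mono (sum_leZ _ (sum_le_geometric (q := 3 / 4) _)) => //; last first.
  by apply/andP; split; lra.
have -> : 1 - 3 / 4 = 4^-1 :> R by field.
by rewrite invrK; lra.
Qed.

Lemma multi_index_sum (d : nat) :
  sum_le (fun a : multi_index d => (2^-1 : R) ^+ mi_deg a) (2 ^+ d).
Proof.
apply: (@sum_le_inj _ _ _ (fun a : multi_index d => [tuple a i | i < d])
  (fun t : d.-tuple nat => \prod_(n <- t) (2^-1 : R) ^+ n)).
- move=> a a' /(congr1 (fun t => tnth t)) h; apply/ffunP => i.
  by have := congr1 (fun f => f i) h; rewrite !tnth_mktuple.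
- by move=> a; rewrite /= big_map big_enum /= -prodrXr.
have := sum_le_geometric (q := 2^-1 : R).
have -> : (1 - 2^-1)^-1 = 2 :> R by field.
move=> h; apply: sum_le_tuple => [n|]; first by rewrite exprn_ge0.
by apply: h; apply/andP; split; lra.
Qed.

Lemma tensor_weight_sum n : sum_le (fun t : n.-tuple dyadic_index => tensor_weight R t) (16 ^+ n).
Proof. by apply: sum_le_tuple; [exact: dyadic_weight_ge0|exact: dyadic_weight_sum]. Qed.

End weight_sums.

(** * Grid cubes and Lebesgue measure *)

Section boxes.
Variables (R : realType) (r : R).
Hypothesis r_gt0 : 0 < r.

(** Half-open, so that distinct boxes of the grid are disjoint; the pointwise estimates use the
    closed [in_cube]. *)
Definition box n (o : 'I_n -> R) : set (n.-tuple (measurableTypeR R)) :=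
  [set t | forall i, (tnth t i : R) \in `[o i, o i + r[].

Lemma measurable_box n (o : 'I_n -> R) : measurable (box o).
Proof.
have -> : box o = \bigcap_(i in [set: 'I_n]) ((fun t : n.-tuple (measurableTypeR R) => tnth t i) @^-1`
    [set` `[o i, o i + r[]).
  by apply/seteqP; split=> [t h i _|t h i]; [exact: h|exact: (h i I)].
apply: fin_bigcap_measurable => [|i _]; first exact: finite_finset.
rewrite -[X in measurable X]setTI; apply: measurable_tnth => //.
Qed.

Lemma lebesgue_box n (o : 'I_n -> R) : lebesgue_tuple R n (box o) = (r ^+ n)%:E.
Proof.
elim: n o => [|n IH] o /=.
  rewrite /dirac /= indicE mem_set ?expr0//.
  by case.
rewrite /lebesgue_step /pushforward /=.
have -> : (@tuple_cons R n) @^-1` box o = [set` `[o ord0, o ord0 + r[] `*` box (fun i => o (lift ord0 i)).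
  apply/seteqP; split=> [[x t] h|[x t] [/= h1 h2] i].
    split=> [|i] /=; first exact: (h ord0).
    by have := h (lift ord0 i); rewrite tnthS.
  have [j ->|->] := unliftP ord0 i; last exact: h1.
  by rewrite tnthS; exact: h2.
rewrite product_measure1E//; last exact: measurable_box.
have L : lebesgue_measure ([set` `[o ord0, o ord0 + r[] : set R) = r%:E.
  by rewrite lebesgue_measure_itv /= lte_fin ltrDl r_gt0 -EFinB addrAC subrr add0r.
by rewrite exprS EFinM -(IH (fun i => o (lift ord0 i))) -L.
Qed.

(** A lower sum is below the integral: each [m i * r ^+ n] is at most the integral of [h] over its
    box. *)
Lemma sum_inf_le_integral (I : choiceType) n (o : I -> 'I_n -> R)
    (h : n.-tuple (measurableTypeR R) -> R) (m : I -> R) :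
  (forall i j t, box (o i) t -> box (o j) t -> i = j) ->
  (lebesgue_tuple R n).-integrable setT (EFin \o h) ->
  (forall t, 0 <= h t) -> (forall i, 0 <= m i) ->
  (forall i t, box (o i) t -> m i <= h t) ->
  sum_le m (fine (\int[lebesgue_tuple R n]_x (h x)%:E)%E / r ^+ n).
Proof.
move=> disj ih h0 m0 mh s us.
have rn : 0 < r ^+ n by rewrite exprn_gt0.
have /integrableP[mf _] := ih.
rewrite ler_pdivlMr// -lee_fin fineK; last exact: integrable_fin_num.
have mb i : measurable (box (o i)) by exact: measurable_box.
have tr : trivIset [set` s] (fun i => box (o i)).
  by move=> i j _ _ [t [ti tj]]; exact: disj ti tj.
have mU : measurable (\big[setU/set0]_(i <- s) box (o i)) by exact: bigsetU_measurable.
apply: (@le_trans _ _ (\int[lebesgue_tuple R n]_(x in \big[setU/set0]_(i <- s) box (o i)) (h x)%:E)%E); last first.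
  by apply: ge0_subset_integral => // t _; rewrite lee_fin.
rewrite (ge0_integral_bigsetU _ mb us tr) /=; last 2 first.
- exact: measurable_funS mf.
- by move=> t _; rewrite lee_fin.
rewrite mulr_suml -sumEFin; apply: lee_sum => i _.
have -> : (m i * r ^+ n)%:E = (\int[lebesgue_tuple R n]_(x in box (o i)) cst (m i)%:E x)%E.
  rewrite integral_cst// EFinM; congr (_ * _)%E; apply: esym; exact: lebesgue_box.
apply: ge0_le_integral => //.
- by move=> t _; rewrite /= lee_fin.
- exact: measurable_funS mf.
- by move=> t bt; rewrite /= lee_fin; exact: mh.
Qed.

End boxes.

(** * The weight conditions *)

Section bracketed_conditions.
Variables (R : realType) (c : bracket).
Implicit Types (P Q S : {posnum R} -> {posnum R} -> Prop) (lam mu nu : {posnum R}).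

(** Chains of indices are built from [lam] in the Beurling case and from [mu] in the Roumieu case.
    Together with [bracketed_and] this lets estimates be combined without regard to the bracket. *)
Lemma bracketed_comp P Q S : (forall lam nu mu, P lam nu -> Q nu mu -> S lam mu) ->
  bracketed c P -> bracketed c Q -> bracketed c S.
Proof.
case: c => /= PQS hP hQ x.
  by have [y Pxy] := hP x; have [z Qyz] := hQ y; exists z; exact: PQS Pxy Qyz.
by have [y Qyx] := hQ x; have [z Pzy] := hP y; exists z; exact: PQS Pzy Qyx.
Qed.

Definition bracket_monotone P := forall lam lam' mu mu',
  lam%:num <= lam'%:num -> mu'%:num <= mu%:num -> P lam mu -> P lam' mu'.

(** The two conditions return different indices; monotonicity allows both to be replaced by their
    minimum (Beurling) or maximum (Roumieu). *)
Lemma bracketed_and P Q : bracket_monotone P -> bracket_monotone Q ->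
  bracketed c P -> bracketed c Q -> bracketed c (fun lam mu => P lam mu /\ Q lam mu).
Proof.
case: c => /= mP mQ hP hQ x; have [y hy] := hP x; have [z hz] := hQ x.
  exists (Num.min y%:num z%:num)%:pos; split.
    by apply: mP hy => //=; rewrite ge_min lexx.
  by apply: mQ hz => //=; rewrite ge_min lexx orbT.
exists (Num.max y%:num z%:num)%:pos; split.
  by apply: mP hy => //=; rewrite le_max lexx.
by apply: mQ hz => //=; rewrite le_max lexx orbT.
Qed.

End bracketed_conditions.

Section weight_sequences.
Variables (R : realType) (d : nat) (c : bracket) (M : weight_sequence_system R d).
Implicit Types (lam mu nu : {posnum R}) (a : multi_index d).

Definition mi_count (w : seq 'I_d) : multi_index d := \sum_(j <- w) mi_unit j.

Lemma mi_countE w j : mi_count w j = count_mem j w.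
Proof.
rewrite /mi_count; elim: w => [|i w IH]; first by rewrite big_nil ffunE.
by rewrite big_cons ffunE IH /= ffunE (eq_sym j).
Qed.

Lemma count_mi_seq a j : count_mem j (mi_seq a) = a j.
Proof.
rewrite /mi_seq count_flatten -map_comp sumnE big_map big_enum /= (bigD1 j)//=.
rewrite count_nseq /= eqxx mul1n big1 ?addn0// => i ij.
by rewrite count_nseq /= (negPf ij).
Qed.

Lemma perm_mi_seq w a : perm_eq (w ++ mi_seq a) (mi_seq (a + mi_count w)).
Proof.
apply/allP => j _; apply/eqP; rewrite /= count_cat !count_mi_seq ffunE mi_countE.
by rewrite addnC.
Qed.

Lemma mi_deg_unit a j : mi_deg (a + mi_unit j) = (mi_deg a).+1.
Proof.
rewrite /mi_deg; under eq_bigr do rewrite ffunE.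
rewrite big_split /=; under [X in (_ + X)%N]eq_bigr do rewrite ffunE.
by rewrite -addn1; congr (_ + _)%N; rewrite (bigD1 j)//= eqxx big1 ?addn0// => i /negPf ->.
Qed.

(** Room for [n] further derivatives, together with a gain of 2^|a| that pays for the sum over all
    multi-indices. *)
Definition shift_dominated n lam mu := exists2 C : R, 0 < C & forall a w,
  (size w <= n)%N -> 2 ^+ mi_deg a * M mu (a + mi_count w) <= C * M lam a.

Lemma shift_dominated_monotone n : bracket_monotone (shift_dominated n).
Proof.
move=> lam lam' mu mu' ll mm [C C0 h]; exists C => // a w wn.
apply: le_trans (_ : _ <= C * M lam a) _; last by rewrite ler_pM2l// wseq_mono.
by apply: le_trans (h a w wn); rewrite ler_wpM2l ?exprn_ge0// wseq_mono.
Qed.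

Hypothesis hL : cond_L c M.
Hypothesis hM : cond_M2' c M.

Let two0 : 0 < 2 :> R. Proof. by []. Qed.

Let geometric lam mu := exists2 C : R, 0 < C &
  forall a, 2 ^+ mi_deg a * M mu a <= C * M lam a.
Let unit_shift lam mu := exists2 C : R, 0 < C &
  forall a j, 2 ^+ mi_deg a * M mu (a + mi_unit j) <= C * M lam a.

Let Mge0 lam a : 0 <= M lam a. Proof. exact/ltW/wseq_gt0. Qed.

Lemma unit_shift_bracketed : bracketed c unit_shift.
Proof.
(* (M.2)' costs a factor [H ^ |a|] that depends on the index it is applied to, and
   [L] has to absorb it; hence the order of the two steps. *)
case: c hL hM => /= hL' hM'.
  move=> lam; have [nu [C [H [C0 H0 h]]]] := hM' lam.
  have [mu [D D0 h']] := hL' (2 * H) (mulr_gt0 two0 H0) nu.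
  exists mu, (D * C / (2 * H)); first by rewrite divr_gt0 ?mulr_gt0.
  move=> a j; have := h' (a + mi_unit j); rewrite mi_deg_unit exprS => h1.
  have HH : 0 < H ^+ mi_deg a by rewrite exprn_gt0.
  have P : 0 < 2 * H * H ^+ mi_deg a by rewrite !mulr_gt0.
  rewrite -(ler_pM2l P); apply: le_trans (_ : _ <= D * M nu (a + mi_unit j)) _.
    by apply: le_trans h1; rewrite exprMn le_eqVlt; apply/orP; left; apply/eqP; ring.
  apply: le_trans (_ : _ <= D * (C * H ^+ mi_deg a * M lam a)) _.
    by rewrite ler_pM2l.
  rewrite le_eqVlt; apply/orP; left; apply/eqP; field.
  by rewrite gt_eqF.
move=> mu; have [nu [C [H [C0 H0 h]]]] := hM' mu.
have [lam [D D0 h']] := hL' (2 * H) (mulr_gt0 two0 H0) nu.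
exists lam, (C * D); first by rewrite mulr_gt0.
move=> a j; rewrite -mulrA; apply: le_trans (_ : _ <= C * ((2 * H) ^+ mi_deg a * M nu a)) _.
  rewrite exprMn; apply: le_trans (_ : _ <= 2 ^+ mi_deg a * (C * H ^+ mi_deg a * M nu a)) _.
    by rewrite ler_wpM2l ?exprn_ge0.
  by rewrite le_eqVlt; apply/orP; left; apply/eqP; ring.
by rewrite ler_pM2l.
Qed.

Lemma shift_dominated_bracketed n : bracketed c (shift_dominated n).
Proof.
have P1 a : 1 <= 2 ^+ mi_deg a :> R by rewrite exprn_ege1// ler1n.
have geo : bracketed c geometric by exact: hL.
elim: n => [|n IH].
  have mono lam nu mu : geometric lam nu -> geometric nu mu -> shift_dominated 0 lam mu.
    move=> [C C0 h] [D D0 h']; exists (D * C) => [|a [|//] _]; first by rewrite mulr_gt0.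
    rewrite /mi_count big_nil addr0; apply: le_trans (h' a) _; rewrite -mulrA ler_pM2l//.
    by apply: le_trans (h a); rewrite ler_peMl.
  exact: (bracketed_comp mono geo geo).
have mg : bracket_monotone geometric.
  move=> lam lam' mu mu' ll mm [C C0 h]; exists C => // a.
  apply: le_trans (_ : _ <= C * M lam a) _; last by rewrite ler_pM2l// wseq_mono.
  by apply: le_trans (h a); rewrite ler_wpM2l ?exprn_ge0// wseq_mono.
have mu' : bracket_monotone unit_shift.
  move=> lam lam' mu mu' ll mm [C C0 h]; exists C => // a j.
  apply: le_trans (_ : _ <= C * M lam a) _; last by rewrite ler_pM2l// wseq_mono.
  by apply: le_trans (h a j); rewrite ler_wpM2l ?exprn_ge0// wseq_mono.
(* A list of length at most [n.+1] may be empty, which needs [geometric]; otherwise its first letter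
   is removed by [unit_shift]. One index has to serve both. *)
have both := bracketed_and mg mu' geo unit_shift_bracketed.
apply: (fun h => bracketed_comp h both IH) => lam nu mu [[C C0 h] [D D0 h']] [B B0 hB].
exists (B * (C + D)) => [|a w wn]; first by rewrite mulr_gt0// addr_gt0.
case: w wn => [|j w] wn.
  apply: le_trans (hB a [::] _) _ => //; rewrite -mulrA ler_pM2l//.
  apply: le_trans (_ : _ <= C * M lam a) _; last by rewrite ler_wpM2r// lerDl ltW.
  by apply: le_trans (h a); rewrite ler_peMl.
have := hB (a + mi_unit j) w wn; rewrite mi_deg_unit exprS -addrA.
have -> : mi_unit j + mi_count w = mi_count (j :: w) by rewrite /mi_count big_cons.
move=> h1; apply: le_trans (_ : _ <= B * M nu (a + mi_unit j)) _.
  apply: le_trans h1; rewrite -mulrA ler_peMl ?ler1n// mulr_ge0// exprn_ge0//.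
rewrite -mulrA ler_pM2l//; apply: le_trans (_ : _ <= D * M lam a) _.
  by apply: le_trans (h' a j); rewrite ler_peMl.
by rewrite ler_wpM2r// lerDr ltW.
Qed.

End weight_sequences.

(** * Weight functions on the cubes of a grid *)

Section weight_functions.
Variables (R : realType) (d : nat) (c : bracket) (W : weight_function_system R d).
Hypothesis d_gt0 : (0 < d)%N.
Hypothesis hwM : cond_wM c W.
Hypothesis hN : cond_N c W.
Implicit Types (lam mu nu : {posnum R}).

Definition corner (k : d.-tuple int) : 'I_d -> R := fun j => (tnth k j)%:~R / d%:R.
Definition in_grid_cube (k : d.-tuple int) (x : 'rV[R]_d) := in_cube (corner k) d%:R^-1 x.

Let d0 : 0 < d%:R :> R. Proof. by rewrite ltr0n. Qed.
Let r0 : 0 < d%:R^-1 :> R. Proof. by rewrite invr_gt0. Qed.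

Lemma grid_cube_cover (x : 'rV[R]_d) : exists k, in_grid_cube k x.
Proof.
exists [tuple Num.floor (x 0 j * d%:R) | j < d] => j; rewrite /corner tnth_mktuple.
have /andP[h1 h2] := floor_itv (x 0 j * d%:R).
rewrite ler_pdivrMr// h1 /= -[X in _ <= _ + X]mul1r -mulrDl ler_pdivlMr// ltW//.
by rewrite intrD in h2.
Qed.

(** The choice of mesh 1/d: the squared Euclidean distance is at most d * d^-2 <= 1, so that
    [cond_wM] compares any two points of a cube. *)
Lemma grid_cube_close k (x y : 'rV[R]_d) : in_grid_cube k x -> in_grid_cube k y ->
  Num.sqrt (\sum_i (x - y) 0 i ^+ 2) <= 1.
Proof.
move=> cx cy; rewrite -sqrtr1; apply: ler_wsqrtr.
apply: le_trans (_ : _ <= \sum_(i < d) d%:R^-1 ^+ 2) _.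
  apply: ler_sum => i _; rewrite !mxE -real_normK ?num_real//.
  rewrite ler_pXn2r ?nnegrE ?(ltW r0)// ler_norml.
  have := cx i; have := cy i; move: (corner k i) (d%:R^-1) => u v.
  by move=> /andP[? ?] /andP[? ?]; apply/andP; split; lra.
rewrite sumr_const card_ord -[(_ ^+ 2) *+ _]mulr_natl expr2 mulrA mulfV ?gt_eqF// mul1r.
by rewrite invf_le1// ler1n.
Qed.

Lemma grid_box_disjoint k k' t : box d%:R^-1 (corner k) t -> box d%:R^-1 (corner k') t -> k = k'.
Proof.
move=> h h'; apply: eq_from_tnth => i; have := h i; have := h' i.
rewrite !in_itv /= /corner => /andP[a b] /andP[a' b'].
have lt2 (u v : int) (w : R) : u%:~R / d%:R <= w -> w < v%:~R / d%:R + d%:R^-1 -> u <= v.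
  move=> h1 h2; rewrite -ltzD1 -(ltr_int R) intrD.
  have := le_lt_trans h1 h2; rewrite -[X in _ < _ + X]mul1r -mulrDl ltr_pM2r//.
by apply/le_anti; rewrite (lt2 _ _ _ a' b) (lt2 _ _ _ a b').
Qed.

Lemma box_in_cube k t : box d%:R^-1 (corner k) t -> in_grid_cube k (\row_i tnth t i).
Proof.
by move=> h j; have := h j; rewrite in_itv /= mxE => /andP[-> /ltW].
Qed.

(** The number [u k] separates the two weights on the whole cube and normalises the functionals
    attached to it; [v k] is the summable loss. *)
Definition cube_dominated lam mu := exists (u v : d.-tuple int -> R) (B : R),
  [/\ forall k, 0 <= v k, sum_le v B
    & forall k x, in_grid_cube k x -> W lam x <= u k /\ u k <= v k * W mu x].

Lemma cube_dominated_monotone : bracket_monotone cube_dominated.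
Proof.
move=> lam lam' mu mu' ll mm [u [v [B [v0 vB h]]]]; exists u, v, B; split=> // k x kx.
have [h1 h2] := h k x kx; split.
  by apply: le_trans h1; exact: wfun_anti.
by apply: le_trans h2 _; rewrite ler_wpM2l// wfun_anti.
Qed.

Let W_gt0 lam x : 0 < W lam x. Proof. exact: lt_le_trans ltr01 (wfun_ge1 W lam x). Qed.

Definition locally_dominated lam mu := exists2 C : R, 0 < C &
  forall x y : 'rV[R]_d, Num.sqrt (\sum_i y 0 i ^+ 2) <= 1 -> W lam (x + y) <= C * W mu x.

(** For x, y, z in one cube, [cond_wM] takes [W lam x] to [W nu y], the quotient [q y] changes the
    weight to [W nu' y], and [cond_wM] again leads to [W mu z]. Since y is free, [q y] may be
    replaced by its infimum over the cube, and these infima are summable because [q] is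
    integrable. *)
Lemma cube_dominated_bracketed : bracketed c cube_dominated.
Proof.
pose N lam mu := (lebesgue_tuple R d).-integrable setT
    (fun t => let x := \row_i tnth t i in (W lam x / W mu x)%:E).
pose S lam mu := exists nu, locally_dominated lam nu /\ N nu mu.
have hS : bracketed c S.
  by apply: (fun h => bracketed_comp h hwM hN) => lam nu mu h1 h2; exists nu.
apply: (fun h => bracketed_comp h hS hwM) => lam nu' mu [nu [[C C0 h1] hN']] [C' C0' h3].
pose q (x : 'rV[R]_d) := W nu x / W nu' x.
have q0 x : 0 <= q x by rewrite divr_ge0// ltW.
pose m k := inf [set q x | x in in_grid_cube k].
have cc k : in_grid_cube k (\row_j corner k j).
  by move=> j; rewrite mxE lexx lerDl (ltW r0).
have m_lb k : has_inf [set q x | x in in_grid_cube k].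
  by split; [exists (q (\row_j corner k j)), (\row_j corner k j)|exists 0 => _ [x _ <-]].
have m_le k x : in_grid_cube k x -> m k <= q x.
  by move=> kx; apply: ge_inf; [exact: (m_lb k).2|exists x].
have m0 k : 0 <= m k by apply: lb_le_inf; [exact: (m_lb k).1|move=> _ [x _ <-]].
have key k x y z : in_grid_cube k x -> in_grid_cube k y -> in_grid_cube k z ->
    W lam x <= C * C' * q y * W mu z.
  move=> kx ky kz; apply: le_trans (_ : _ <= C * W nu y) _.
    by have := h1 y (x - y) (grid_cube_close kx ky); rewrite subrKC.
  have -> : W nu y = q y * W nu' y by rewrite /q divfK// gt_eqF.
  have -> : C * C' * q y * W mu z = C * (q y * (C' * W mu z)) by ring.
  rewrite ler_pM2l// ler_wpM2l//.
  by have := h3 z (y - z) (grid_cube_close ky kz); rewrite subrKC.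
have key2 k x z : in_grid_cube k x -> in_grid_cube k z -> W lam x <= C * C' * m k * W mu z.
  move=> kx kz; rewrite mulrAC -ler_pdivrMl ?mulr_gt0//.
  apply: lb_le_inf; first exact: (m_lb k).1.
  move=> _ [y ky <-]; rewrite ler_pdivrMl ?mulr_gt0// mulrAC.
  exact: key kx ky kz.
pose u k := sup [set W lam x | x in in_grid_cube k].
have u_ub k : has_sup [set W lam x | x in in_grid_cube k].
  split; first by exists (W lam (\row_j corner k j)), (\row_j corner k j).
  exists (C * C' * m k * W mu (\row_j corner k j)) => _ [x kx <-].
  exact: key2.
pose I := fine (\int[lebesgue_tuple R d]_t (q (\row_i tnth t i))%:E)%E.
exists u, (fun k => C * C' * m k), (C * C' * (I / d%:R^-1 ^+ d)); split.
- by move=> k; rewrite !mulr_ge0// ltW.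
- apply: sum_leZ; first by rewrite mulr_ge0// ltW.
  apply: (sum_inf_le_integral r0 (o := corner) (h := fun t => q (\row_i tnth t i))) => //.
  + exact: grid_box_disjoint.
  + by move=> k t bt; apply: m_le; exact: box_in_cube.
- move=> k x kx; split.
    by apply: ub_le_sup; [exact: (u_ub k).2|exists x].
  apply: ge_sup; first exact: (u_ub k).1.
  by move=> _ [y ky <-]; exact: key2.
Qed.

End weight_functions.

(** * Summable functionals between two steps *)

Section nuclear_steps.
Variables (R : realType) (d : nat) (c : bracket).
Variables (M : weight_sequence_system R d) (W : weight_function_system R d).
Hypothesis d_gt0 : (0 < d)%N.
Local Notation K := R[i].
Local Notation normc := Normc.normc.
Local Notation fn := ('rV[R]_d -> K).
Implicit Types (lam mu : {posnum R}) (phi psi : fn).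

(** Quantitative nuclearity of the inclusion of the step [mu] into the step [lam]. Linearity is
    asked on smooth functions, where the partial derivatives are additive. *)
Definition nuclear_step lam mu := exists (g : nat -> fn -> K) (b : nat -> R) (B : R),
  [/\ forall n, 0 < b n, forall n, \sum_(0 <= m < n) b m <= B,
    forall n a phi psi, smoothC phi -> smoothC psi ->
      g n (a *: phi + psi) = a * g n phi + g n psi,
    forall n phi N, smoothC phi -> (gs_norm M W mu phi <= N%:E)%E ->
      normc (g n phi) <= b n * N
  & forall phi A, smoothC phi -> (forall n, normc (g n phi) <= A) ->
      (gs_norm M W lam phi <= A%:E)%E].

Definition step_index := (multi_index d * (d.-tuple int * d.-tuple dyadic_index))%type.

(** All variables have been frozen, so the result is a constant function and the corner is just a
    convenient point of evaluation. *)
Definition cube_tensor (k : d.-tuple int) (t : d.-tuple dyadic_index) (f : 'rV[R]_d -> R) : R :=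
  tensor_op (corner R k) d%:R^-1 (enum 'I_d) t f (\row_j corner R k j).

Definition step_functional (i : step_index) phi : K :=
  let: (a, (k, t)) := i in
  Complex (cube_tensor k t (partial (mi_seq a) (re phi)))
          (cube_tensor k t (partial (mi_seq a) (im phi))).

Lemma cube_tensorP k t (a : R) f g :
  cube_tensor k t (a *: f + g) = a * cube_tensor k t f + cube_tensor k t g.
Proof. by rewrite /cube_tensor tensor_opP. Qed.

Lemma cube_tensorD k t f g : cube_tensor k t (f + g) = cube_tensor k t f + cube_tensor k t g.
Proof. by rewrite -[f]scale1r cube_tensorP mul1r scale1r. Qed.

Lemma step_functionalP i a phi psi : smoothC phi -> smoothC psi ->
  step_functional i (a *: phi + psi) = a * step_functional i phi + step_functional i psi.
Proof.
case: i => al [k t] [s1 s2] [s3 s4] /=.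
have z1 u := smoothZ u s1; have z2 u := smoothZ u s2.
rewrite reD imD reZ imZ.
rewrite (partialD _ (smoothD (z1 _) (z2 _)) s3) (partialD _ (smoothD (z2 _) (z1 _)) s4).
rewrite (partialD _ (z1 _) (z2 _)) (partialD _ (z2 _) (z1 _)) !(partialZ _ _ s1) !(partialZ _ _ s2).
rewrite !cube_tensorD.
have Z (u : R) f : cube_tensor k t (u *: f) = u * cube_tensor k t f.
  have := cube_tensorP k t u f 0; rewrite addr0 => ->.
  have := cube_tensorP k t 1 0 0; rewrite scale1r addr0 mul1r => /(congr1 (fun x => x - cube_tensor k t 0)).
  by rewrite subrr addrK => <-; rewrite addr0.
rewrite !Z; case: a => u v; apply/eqP; rewrite eq_complex /=.
by apply/andP; split; apply/eqP; ring.
Qed.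

Let d0 : 0 < d%:R :> R. Proof. by rewrite ltr0n. Qed.
Let r0 : 0 < d%:R^-1 :> R. Proof. by rewrite invr_gt0. Qed.
Let r1 : d%:R^-1 <= 1 :> R. Proof. by rewrite invf_le1// ler1n. Qed.

Lemma cube_tensor_lower k f A x : smooth f ->
  (forall t, `|cube_tensor k t f| <= A) -> in_grid_cube k x -> `|f x| <= A.
Proof.
move=> sf h kx.
have ue : uniq (enum 'I_d) by exact: enum_uniq.
apply: (tensor_op_lower r0 (o := corner R k) (x := \row_j corner R k j) ue sf).
  move=> tau st; have st' : size tau == d by rewrite st size_enum_ord.
  exact: (h (Tuple st')).
by move=> i; rewrite mem_enum inE; exact: kx.
Qed.

Lemma cube_tensor_upper k t (w : seq 'I_d) f N : smooth f ->
  (forall w' x, (size w' <= 2 * d)%N -> in_grid_cube k x -> `|partial (w' ++ w) f x| <= N) ->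
  `|cube_tensor k t (partial w f)| <= tensor_weight R t * N.
Proof.
move=> sf h.
have ue : uniq (enum 'I_d) by exact: enum_uniq.
apply: (tensor_op_upper r0 r1 ue _ (smooth_partial w sf)).
- by rewrite size_tuple size_enum_ord.
- by move=> j; rewrite mxE lexx lerDl (ltW r0).
apply: (doubly_bounded_partial sf) => w' hw' y ky; apply: h => //.
by move: hw'; rewrite size_enum_ord.
Qed.

Lemma gs_norm_le_normc mu phi N a x : (gs_norm M W mu phi <= N%:E)%E ->
  normc (mi_partial a phi x) * W mu x <= N * M mu a.
Proof.
move=> h; have := le_trans (gs_norm_ub M W mu phi a x) h.
by rewrite lee_fin ler_pdivrMr// wseq_gt0.
Qed.

Lemma tensor_weight_ge0 (t : seq dyadic_index) : 0 <= tensor_weight R t.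
Proof. by apply: prodr_ge0 => i _; exact: dyadic_weight_ge0. Qed.

Lemma nuclear_stepP lam mu : shift_dominated M (2 * d) lam mu ->
  cube_dominated W lam mu -> nuclear_step lam mu.
Proof.
move=> [C C0 hC] [u [v [B [v0 vB huv]]]].
have W0 l x : 0 < W l x by exact: lt_le_trans ltr01 (wfun_ge1 W l x).
have cc (k : d.-tuple int) : in_grid_cube k (\row_j corner R k j).
  by move=> j; rewrite mxE lexx /= lerDl.
have u0 k : 0 < u k by exact: (lt_le_trans (W0 lam _) (huv k _ (cc k)).1).
(* The normalisation [u / M lam] turns bounds on the functionals into the weighted norm; the 2 pays
   for recombining real and imaginary part. *)
pose w (i : step_index) : R := 2 * u i.2.1 / M lam i.1.
have w0 i : 0 < w i by rewrite divr_gt0 ?mulr_gt0 ?wseq_gt0.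
pose g i phi : K := (w i)%:C%C * step_functional i phi.
(* The 4 is the 2 of [w] times the 2 lost when a modulus is bounded by real plus imaginary part. *)
pose b (i : step_index) : R := 4 * C * (2^-1 ^+ mi_deg i.1 * (v i.2.1 * tensor_weight R i.2.2)).
have t0 t := tensor_weight_ge0 t.
have b0 i : 0 <= b i by rewrite !mulr_ge0 ?exprn_ge0// ltW.
have bB : sum_le b (4 * C * (2 ^+ d * (B * 16 ^+ d))).
  apply: sum_leZ; first by rewrite mulr_ge0// ltW.
  apply: (sum_le_prod (b := fun a => 2^-1 ^+ mi_deg a)
    (c := fun kt : d.-tuple int * d.-tuple dyadic_index => v kt.1 * tensor_weight R kt.2)).
  - by move=> a; rewrite exprn_ge0.
  - by move=> kt; rewrite mulr_ge0.
  - exact: multi_index_sum.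
  - apply: (sum_le_prod (b := v) (c := fun t : d.-tuple dyadic_index => tensor_weight R t)) => //.
    exact: tensor_weight_sum.
have g_le i phi N : smoothC phi -> (gs_norm M W mu phi <= N%:E)%E -> normc (g i phi) <= b i * N.
  case: i => a [k t] sphi hN; have [s1 s2] := sphi.
  have N0 : 0 <= N by rewrite -lee_fin; exact: le_trans (gs_norm_ge0 M W mu phi) hN.
  (* Bound on cube [k] for the derivative of order [a] followed by up to [2 * d] more: [hC] trades
     [M mu] for [M lam a] over 2^|a|, and [huv] bounds 1 / [W mu x] by [v k / u k]. *)
  pose N' := N * (C * (M lam a / 2 ^+ mi_deg a) * v k / u k).
  have der w' x : (size w' <= 2 * d)%N -> in_grid_cube k x ->
      normc (Complex (partial (w' ++ mi_seq a) (re phi) x) (partial (w' ++ mi_seq a) (im phi) x)) <= N'.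
    move=> hw kx; rewrite (partial_perm s1 (perm_mi_seq w' a)) (partial_perm s2 (perm_mi_seq w' a)).
    have := gs_norm_le_normc (a + mi_count w') x hN.
    rewrite -ler_pdivlMr// => /le_trans; apply; rewrite -mulrA /N' ler_wpM2l//.
    rewrite ler_pdivrMr//; have := hC a w' hw; rewrite mulrC -ler_pdivlMr ?exprn_gt0//.
    move=> /le_trans; apply; have [_ h2] := huv k x kx.
    have e0 : 0 <= C * (M lam a / 2 ^+ mi_deg a).
      by rewrite mulr_ge0 ?divr_ge0 ?exprn_ge0// ltW// wseq_gt0.
    have -> : C * (M lam a / 2 ^+ mi_deg a) * v k / u k * W mu x =
        C * (M lam a / 2 ^+ mi_deg a) * (v k * W mu x / u k) by ring.
    rewrite -[C * M lam a / _]mulrA; apply: ler_peMr => //.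
    by rewrite ler_pdivlMr// mul1r.
  rewrite /g Normc.normcM normcR gtr0_norm//.
  have tr : `|cube_tensor k t (partial (mi_seq a) (re phi))| <= tensor_weight R t * N'.
    apply: cube_tensor_upper => // w' x hw kx.
    by apply: le_trans (der w' x hw kx); exact: (Re_normc (Complex _ _)).
  have ti : `|cube_tensor k t (partial (mi_seq a) (im phi))| <= tensor_weight R t * N'.
    apply: cube_tensor_upper => // w' x hw kx.
    by apply: le_trans (der w' x hw kx); exact: (Im_normc (Complex _ _)).
  apply: le_trans (_ : _ <= w (a, (k, t)) * (tensor_weight R t * N' + tensor_weight R t * N')) _.
    by rewrite ler_pM2l//; apply: le_trans (normc_ReIm _) _; exact: lerD.
  rewrite le_eqVlt; apply/orP; left; apply/eqP.
  rewrite /w /b /N' /= exprVn; field.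
  by rewrite !gt_eqF ?exprn_gt0// wseq_gt0.
have g_lower phi A : smoothC phi -> (forall i, normc (g i phi) <= A) ->
    (gs_norm M W lam phi <= A%:E)%E.
  move=> [s1 s2] hA; apply: ub_ereal_sup => _ [[a x] _ <-]; rewrite lee_fin /=.
  have [k kx] := grid_cube_cover d_gt0 x.
  pose A' := A / (2 * u k / M lam a).
  have hg t : normc (step_functional (a, (k, t)) phi) <= A'.
    have := hA (a, (k, t)); rewrite /g Normc.normcM normcR gtr0_norm// mulrC.
    by rewrite -ler_pdivlMr.
  have hr : `|partial (mi_seq a) (re phi) x| <= A'.
    apply: (cube_tensor_lower (smooth_partial _ s1) _ kx) => t.
    by apply: le_trans (hg t); exact: (Re_normc (Complex _ _)).
  have hi : `|partial (mi_seq a) (im phi) x| <= A'.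
    apply: (cube_tensor_lower (smooth_partial _ s2) _ kx) => t.
    by apply: le_trans (hg t); exact: (Im_normc (Complex _ _)).
  have A0 : 0 <= A' by apply: le_trans hr; exact: normr_ge0.
  rewrite ler_pdivrMr ?wseq_gt0//.
  apply: le_trans (_ : _ <= (A' + A') * u k) _.
    rewrite -[X in X * _ <= _]/(normc (mi_partial a phi x)).
    apply: ler_pM; [exact: normc_ge0|exact: ltW| |exact: (huv k x kx).1].
    by apply: le_trans (normc_ReIm _) _; exact: lerD.
  rewrite le_eqVlt; apply/orP; left; apply/eqP; rewrite /A'; field.
  by rewrite !gt_eqF ?wseq_gt0.
(* Numbers that code no index carry the zero functional. *)
exists (fun n phi => oapp (g^~ phi) 0 (pickle_inv n)),
  (fun n => oapp b 0 (pickle_inv n) + 2^-1 ^+ n), (4 * C * (2 ^+ d * (B * 16 ^+ d)) + 2).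
split.
- move=> n; have : 0 <= oapp b 0 (pickle_inv n) by case: pickle_inv => [i|] /=.
  by move=> h; rewrite ltr_wpDl// exprn_gt0.
- exact: sum_le_pickle.
- move=> n a phi psi s1 s2; case: pickle_inv => [i|] /=; last by rewrite mulr0 addr0.
  by rewrite /g step_functionalP// mulrDr mulrCA.
- move=> n phi N s1 hN.
  have N0 : 0 <= N by rewrite -lee_fin; exact: le_trans (gs_norm_ge0 M W mu phi) hN.
  case: pickle_inv => [i|] /=.
    by apply: le_trans (g_le i phi N s1 hN) _; rewrite ler_wpM2r// lerDl exprn_ge0.
  by rewrite -[X in X <= _]/(normc (0 : K)) Normc.normc0 add0r mulr_ge0// exprn_ge0.
- move=> phi A s1 hA; apply: g_lower => // i.
  by have := hA (pickle i); rewrite pickleK_inv.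
Qed.

Lemma nuclear_step_bracketed : cond_L c M -> cond_M2' c M -> cond_wM c W -> cond_N c W ->
  bracketed c nuclear_step.
Proof.
move=> hL hM hwM hN.
have h1 := shift_dominated_bracketed hL hM (2 * d).
have h2 := cube_dominated_bracketed d_gt0 hwM hN.
have := bracketed_and (@shift_dominated_monotone _ _ M (2 * d)) (@cube_dominated_monotone _ _ W) h1 h2.
by case: c => /= h x; have [y [a b]] := h x; exists y; exact: nuclear_stepP.
Qed.

End nuclear_steps.

(** * Assembling countably many nuclear steps *)

Section assembled_steps.
Variables (R : realType) (d : nat).
Variables (M : weight_sequence_system R d) (W : weight_function_system R d).
Local Notation K := R[i].
Local Notation normc := Normc.normc.
Local Notation fn := ('rV[R]_d -> K).
Implicit Types (lam mu : {posnum R}) (phi psi : fn).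

Definition gs_normR lam phi : R := fine (gs_norm M W lam phi).

Lemma gs_normRE lam phi : gs_step M W lam phi -> gs_norm M W lam phi = (gs_normR lam phi)%:E.
Proof. by move=> [_ h]; rewrite /gs_normR fineK// ge0_fin_numE// gs_norm_ge0. Qed.

Lemma gs_normR_ge0 lam phi : 0 <= gs_normR lam phi.
Proof. exact: fine_ge0 (gs_norm_ge0 _ _ _ _). Qed.

Lemma gs_normR_le lam phi A : (gs_norm M W lam phi <= A%:E)%E -> gs_normR lam phi <= A.
Proof.
move=> h; rewrite -lee_fin /gs_normR fineK// ge0_fin_numE ?gs_norm_ge0//.
exact: le_lt_trans h (ltry _).
Qed.

Lemma gs_normR0 lam : gs_normR lam 0 = 0.
Proof. by rewrite /gs_normR gs_norm0. Qed.

Variables (E G : lmodType K) (S : {linear G -> E}) (p : E -> K).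
Variables (comp : nat -> {linear G -> fn}) (lam1 lam2 lam3 : nat -> {posnum R}) (C : nat -> R).
Hypothesis S_surj : forall y, exists x, S x = y.
Hypothesis sp : seminorm p.
Hypothesis step12 : forall N, nuclear_step M W (lam1 N) (lam2 N).
Hypothesis step23 : forall N, nuclear_step M W (lam2 N) (lam3 N).
Hypothesis comp_step : forall N x, gs_step M W (lam3 N) (comp N x).
Hypothesis comp_finite : forall x, exists n, forall N, (n <= N)%N -> comp N x = 0.
Hypothesis C_gt0 : forall N, 0 < C N.
Hypothesis p_le : forall x n, (forall N, (n <= N)%N -> comp N x = 0) ->
  p (S x) <= (\sum_(0 <= N < n) C N * gs_normR (lam1 N) (comp N x))%:C%C.

Let smooth_comp N x : smoothC (comp N x). Proof. by have [] := comp_step N x. Qed.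

Lemma comp_functional_linear (f : fn -> K) N (w : K) :
  (forall a phi psi, smoothC phi -> smoothC psi -> f (a *: phi + psi) = a * f phi + f psi) ->
  linear (fun x => w * f (comp N x) : K^o).
Proof.
move=> hf a x y; rewrite linearP hf// mulrDr /GRing.scale/=.
by rewrite mulrCA.
Qed.

Definition pair_family (T : Type) (z : T) (u : nat -> nat -> T) (k : nat) : T :=
  if pickle_inv k is Some (N, n) then u N n else z.

Lemma pair_family_sum (a : nat -> nat -> R) (B : nat -> R) n :
  (forall N m, 0 <= a N m) -> (forall N k, \sum_(0 <= m < k) a N m <= B N) ->
  (forall N, (n <= N)%N -> B N = 0) ->
  forall k, \sum_(0 <= m < k) pair_family 0 a m <= \sum_(0 <= N < n) B N.
Proof.
move=> a0 aB Bn.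
have B0 N : 0 <= B N by have := aB N 0; rewrite big_geq.
have h : sum_le (fun Nm : nat * nat => a Nm.1 Nm.2) (\sum_(0 <= N < n) B N).
  apply: (@sum_le_dep _ _ _ _ B) => [Nm|N|]; [exact: a0|exact: sum_le_nat (a0 N) (aB N)|].
  apply: sum_le_nat => // k.
  apply: le_trans (_ : _ <= \sum_(0 <= N < maxn n k) B N) _.
    rewrite [leRHS](@big_cat_nat _ _ _ k)//= ?leq_maxr// lerDl.
    by apply: sumr_ge0.
  rewrite (@big_cat_nat _ _ _ n)//= ?leq_maxl// gerDl big_nat big1// => i /andP[ni _].
  by rewrite Bn.
move=> k; have -> : \sum_(0 <= m < k) pair_family 0 a m =
    \sum_(i <- pmap pickle_inv (index_iota 0 k)) a i.1 i.2.
  elim: index_iota => [|m s IH]; first by rewrite !big_nil.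
  rewrite big_cons IH /= /pair_family.
  by case: pickle_inv => [[N i]|] /=; rewrite ?big_cons ?add0r.
apply: h; apply: (pmap_uniq (g := pickle)); last exact: iota_uniq.
exact: pickle_invK.
Qed.

(** The functionals of [step12], weighted over [N], dominate [p]; those of [step23], with larger
    weights [D N], form the square-summable family. The weights may grow arbitrarily, since each [x]
    has finitely many nonzero components. *)
Lemma nuclear_from_steps : exists (q : E -> K) (D : nat -> R),
  [/\ seminorm q, forall y, p y <= q y, forall N, 0 <= D N,
    forall x n, (forall N, (n <= N)%N -> comp N x = 0) ->
      q (S x) <= p (S x) + (\sum_(0 <= N < n) D N * gs_normR (lam3 N) (comp N x))%:C%C
  & forall (X Y : completeNormedModType K) (i : {linear E -> X}) (j : {linear E -> Y}),
      is_completion q i -> is_completion p j ->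
      exists T : {linear X -> Y}, (forall x, T (i x) = j x) /\ nuclear_operator T].
Proof.
have [g /choice [b /choice [B hg]]] := choice step12.
have [e /choice [b' /choice [B' he]]] := choice step23.
have b0 N n : 0 < b N n by have [] := hg N.
have b0' N n : 0 < b' N n by have [] := he N.
have bB N n : \sum_(0 <= m < n) b N m <= B N by have [] := hg N.
have bB' N n : \sum_(0 <= m < n) b' N m <= B' N by have [] := he N.
have B0 N : 0 <= B N by have := bB N 0; rewrite big_geq.
have B0' N : 0 <= B' N by have := bB' N 0; rewrite big_geq.
(* If all weighted functionals are at most [A], the N-th summand of [p_le] is at most A / 2^(N+1),
   so the sum is at most [A]. *)
pose cg N : R := 2 ^+ N.+1 * C N.
have cg0 N : 0 < cg N by rewrite mulr_gt0// exprn_gt0.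
(* Relative to the norm multiplied by [D N], the functionals of component [N] have bounds of total
   at most 2^-N, so that [bb] is summable over all pairs. *)
pose D N : R := cg N * 2 ^+ N * (B N + 1).
have D0 N : 0 < D N by rewrite !mulr_gt0 ?exprn_gt0// ltr_wpDl.
have lin_g N n : linear (fun x => (cg N)%:C%C * g N n (comp N x) : K^o).
  by apply: comp_functional_linear; have [_ _ h _ _] := hg N; exact: h.
have lin_e N n : linear (fun x => (D N)%:C%C * e N n (comp N x) : K^o).
  by apply: comp_functional_linear; have [_ _ h _ _] := he N; exact: h.
pose g1 N n : {linear G -> K^o} := HB.pack (fun x => (cg N)%:C%C * g N n (comp N x) : K^o)
  (GRing.isLinear.Build _ _ _ _ _ (lin_g N n)).
pose e1 N n : {linear G -> K^o} := HB.pack (fun x => (D N)%:C%C * e N n (comp N x) : K^o)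
  (GRing.isLinear.Build _ _ _ _ _ (lin_e N n)).
pose zero : {linear G -> K^o} := \0.
pose gg := pair_family zero g1; pose ee := pair_family zero e1.
have normR (r : R) z : 0 < r -> normc (r%:C%C * z) = r * normc z.
  by move=> r0; rewrite Normc.normcM normcR gtr0_norm.
have e1_le N n x : normc (e1 N n x) <= D N * (b' N n * gs_normR (lam3 N) (comp N x)).
  rewrite normR// ler_pM2l//; have [_ _ _ h _] := he N.
  by apply: h => //; rewrite gs_normRE.
have ee_sum x n k : (forall N, (n <= N)%N -> comp N x = 0) ->
    \sum_(0 <= m < k) normc (ee m x) <=
    \sum_(0 <= N < n) D N * B' N * gs_normR (lam3 N) (comp N x).
  move=> hn; apply: le_trans (pair_family_sum (n := n)
    (a := fun N m => normc (e1 N m x)) (B := fun N => D N * B' N * gs_normR (lam3 N) (comp N x)) _ _ _ k).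
  - rewrite le_eqVlt; apply/orP; left; apply/eqP; apply: eq_bigr => m _.
    rewrite /ee /pair_family; case: pickle_inv => [[N i]|] //=.
    exact: Normc.normc0.
  - by move=> N m; exact: normc_ge0.
  - move=> N l; apply: le_trans (ler_sum _ (fun m _ => e1_le N m x)) _.
    rewrite -mulr_sumr -mulr_suml mulrA ler_wpM2r ?gs_normR_ge0//.
    by rewrite ler_pM2l.
  - by move=> N nN; rewrite hn// gs_normR0 mulr0.
have ee_sq x n k : (forall N, (n <= N)%N -> comp N x = 0) ->
    \sum_(0 <= m < k) normc (ee m x) ^+ 2 <=
    (\sum_(0 <= N < n) D N * B' N * gs_normR (lam3 N) (comp N x)) ^+ 2.
  move=> hn; apply: le_trans (sum_sqr_le _ (fun m => normc_ge0 (ee m x))) _.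
  have s1 := ee_sum x n k hn.
  have s0 : 0 <= \sum_(0 <= m < k) normc (ee m x) by apply: sumr_ge0 => m _; exact: normc_ge0.
  by rewrite ler_pXn2r ?nnegrE// (le_trans s0).
have sq : square_summable ee.
  move=> x; have [n hn] := comp_finite x.
  by exists ((\sum_(0 <= N < n) D N * B' N * gs_normR (lam3 N) (comp N x)) ^+ 2) => k; exact: ee_sq.
have norm2_le N x : D N * gs_normR (lam2 N) (comp N x) <= Bnorm (l2form ee) x.
  rewrite mulrC -ler_pdivlMr//; apply: gs_normR_le.
  have [_ _ _ _ h] := he N; apply: h => // m.
  rewrite ler_pdivlMr// mulrC -normR//.
  by have := term_le_l2norm sq (pickle (N, m)) x; rewrite /ee /pair_family pickleK_inv.
pose bb k := oapp (fun Nn : nat * nat => 2^-1 ^+ Nn.1 * (b Nn.1 Nn.2 / (B Nn.1 + 1))) 0 (pickle_inv k)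
  + 2^-1 ^+ k.
have B1 N : 0 < B N + 1 by rewrite ltr_wpDl.
have b1_ge0 (Nn : nat * nat) : 0 <= 2^-1 ^+ Nn.1 * (b Nn.1 Nn.2 / (B Nn.1 + 1)).
  by rewrite mulr_ge0 ?exprn_ge0// divr_ge0// ltW.
have bb0 k : 0 < bb k.
  by rewrite /bb ltr_wpDl ?exprn_gt0//; case: pickle_inv => [Nn|] /=.
have q1 : 0 <= (2^-1 : R) < 1 by apply/andP; split; lra.
have bb_sum := @sum_le_pickle R _ _ (1 - 2^-1)^-1 b1_ge0 _.
have {}bb_sum : forall k, \sum_(0 <= m < k) bb m <= (1 - 2^-1)^-1 + 2.
  apply: bb_sum; apply: (@sum_le_dep _ _ _ _ (fun N => 2^-1 ^+ N)) => // [N|].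
    apply: sum_le_nat => [n|n]; first exact: (b1_ge0 (N, n)).
    rewrite /= -mulr_sumr -[leRHS]mulr1 ler_wpM2l ?exprn_ge0// -mulr_suml.
    by rewrite ler_pdivrMr// mul1r; apply: le_trans (bB N n) _; rewrite lerDl.
  exact: sum_le_geometric.
have g1_le N n x : normc (g1 N n x) <=
    2^-1 ^+ N * (b N n / (B N + 1)) * (D N * gs_normR (lam2 N) (comp N x)).
  rewrite normR//.
  have h2 : gs_step M W (lam2 N) (comp N x).
    split; first exact: smooth_comp.
    have [_ _ _ h1 h] := he N.
    apply: le_lt_trans (h _ (B' N * gs_normR (lam3 N) (comp N x)) (smooth_comp N x) _) (ltry _) => m.
    apply: le_trans (h1 m _ (gs_normR (lam3 N) (comp N x)) (smooth_comp N x) _) _.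
      by rewrite gs_normRE.
    rewrite ler_wpM2r ?gs_normR_ge0//; apply: le_trans (bB' N m.+1).
    by rewrite big_nat_recr//= lerDr sumr_ge0// => i _; exact: ltW.
  have -> : 2^-1 ^+ N * (b N n / (B N + 1)) * (D N * gs_normR (lam2 N) (comp N x)) =
      cg N * (b N n * gs_normR (lam2 N) (comp N x)).
    by rewrite /D exprVn; field; rewrite gt_eqF//= expf_neq0.
  rewrite ler_pM2l//; have [_ _ _ h _] := hg N.
  by apply: h => //; rewrite gs_normRE.
have gg_le k x : normc (gg k x) <= bb k * Bnorm (l2form ee) x.
  have Q0 := Bnorm_ge0 (l2form ee) x.
  rewrite /gg /bb /pair_family; case: pickle_inv => [[N n]|]; last first.
    by rewrite /= -[X in X <= _]/(normc (0 : K)) Normc.normc0 add0r mulr_ge0// exprn_ge0.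
  apply: le_trans (g1_le N n x) _; rewrite [oapp _ _ _]/=.
  apply: le_trans (_ : _ <= 2^-1 ^+ N * (b N n / (B N + 1)) * Bnorm (l2form ee) x) _.
    by rewrite ler_wpM2l//; exact: (b1_ge0 (N, n)).
  by rewrite ler_wpM2r// lerDl exprn_ge0.
have p_gg x A : 0 <= A -> (forall k, normc (gg k x) <= A) -> p (S x) <= A%:C%C.
  move=> A0 hA; have [n hn] := comp_finite x.
  apply: le_trans (p_le hn) _; rewrite lecR.
  apply: le_trans (_ : _ <= \sum_(0 <= N < n) 2^-1 ^+ N.+1 * A) _.
    apply: ler_sum => N _; rewrite mulrC -ler_pdivlMr//; apply: gs_normR_le.
    have [_ _ _ _ h] := hg N; apply: h => // m.
    have := hA (pickle (N, m)); rewrite /gg /pair_family pickleK_inv normR// mulrC -ler_pdivlMr//.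
    by move=> /le_trans; apply; rewrite /cg exprVn invfM; rewrite le_eqVlt; apply/orP; left; apply/eqP; ring.
  rewrite -mulr_suml ler_piMl//; under eq_bigr do rewrite exprS.
  rewrite -mulr_sumr mulrC ler_pdivrMr// mul1r.
  apply: le_trans (sum_le_geometric q1 (iota_uniq 0 (n - 0))) _.
  by rewrite (_ : 1 - 2^-1 = 2^-1 :> R) ?invrK//; field.
have [q [sq' pq qS nuc]] := nuclear_dominating_seminorm S_surj sq bb0 bb_sum gg_le sp p_gg.
(* [D N * B' N] bounds the l1 norm, hence the l2 norm, of the functionals of component [N] by its
   norm in the step [lam3 N]. *)
exists q, (fun N => D N * B' N); split=> //.
- by move=> N; rewrite mulr_ge0// ltW.
move=> x n hn; apply: le_trans (qS x) _; rewrite lerD2l lecR.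
apply: l2norm_le => // [|k]; last exact: ee_sq.
by apply: sumr_ge0 => N _; rewrite !mulr_ge0 ?gs_normR_ge0// ltW.
Qed.

End assembled_steps.

(** * Continuity and domination by generating seminorms *)

Section seminormed_continuity.
Variables (R : realType) (E : lmodType R[i]) (Gamma : seminorms E).
Local Notation K := R[i].
Local Notation T := (seminormed Gamma).

Lemma seminorm0 (p : E -> K) : seminorm p -> p 0 = 0.
Proof. by move=> [_ _ h]; rewrite -(scale0r 0) h normr0 mul0r. Qed.

Lemma seminorm_Re (p : E -> K) x : seminorm p -> p x = (complex.Re (p x))%:C%C.
Proof. by move=> [h _ _]; exact: ge0_realC. Qed.

Lemma continuous_seminorm_dominated (p : E -> K) :
  seminorm p -> continuous (p : T -> K^o) ->
  exists (s : seq {q | in_seminorms Gamma q}) (C : R), 0 < C /\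
    forall x, p x <= C%:C%C * finite_sum s x.
Proof.
move=> sp cp.
have /cvgrPdist_lt /(_ _ ltr01) := cp (0 : T).
case=> s [e e0 hs].
have eE := ge0_realC (ltW e0); set r := complex.Re e in eE.
have r0 : 0 < r by rewrite -ltcR -eE; exact: e0.
have sf := finite_sum_seminorm s.
exists s, (2 / r); split; first by rewrite divr_gt0.
move=> x; rewrite (seminorm_Re x sp) (seminorm_Re x sf) -rmorphM lecR.
set u := complex.Re (p x); set v := complex.Re (finite_sum s x).
have v0 : 0 <= v by rewrite -lecR -seminorm_Re//; have [h _ _] := sf; exact: h.
apply: (@le_all_eps _ _ _ (2 / r)) => [|t t0]; first by rewrite divr_ge0// ltW.
have vt : 0 < v + t by rewrite ltr_wpDl.
(* Scaling by [w] brings [x] into the ball of radius [r]; the summand [t] keeps the denominator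
   positive when [v] is 0. *)
pose w := r / (2 * (v + t)).
have w0 : 0 < w by rewrite divr_gt0// mulr_gt0.
have normw : `|(w%:C)%C| = (w%:C)%C :> K by rewrite ger0_norm// lecR ltW.
have := hs ((w%:C)%C *: x : E); rewrite /seminormed_ball /= subr0.
have [_ _ hf] := sf; have [_ _ hp] := sp.
rewrite hf hp (seminorm0 sp) sub0r normrN normw (seminorm_Re x sf) (seminorm_Re x sp) -/u -/v.
rewrite eE -!rmorphM ltcR nrmE nrm_normc normcR => h.
have {}h : `|w * u| < 1.
  rewrite -ltcR; apply: h; rewrite /w mulrAC ltr_pdivrMr ?mulr_gt0//.
  by rewrite ltr_pM2l//; lra.
have : w * u < 1 by apply: le_lt_trans h; exact: ler_norm.
rewrite mulrC -ltr_pdivlMr// div1r /w invf_div => h1.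
apply: le_trans (ltW h1) _; rewrite le_eqVlt; apply/orP; left; apply/eqP; ring.
Qed.

Lemma dominated_seminorm_continuous (q : E -> K) s (C : R) :
  seminorm q -> 0 < C -> (forall x, q x <= C%:C%C * finite_sum (s : seq {q | in_seminorms Gamma q}) x) ->
  continuous (q : T -> K^o).
Proof.
move=> sq C0 h x; apply/(@cvgrPdist_lt K (K^o) T (nbhs (x : T))) => e e0.
have CC : 0 < (C%:C)%C :> K by rewrite ltcR.
exists s, (e / (C%:C)%C); first by rewrite divr_gt0.
move=> y; rewrite /seminormed_ball /= ltr_pdivlMr// mulrC => hy.
apply: le_lt_trans hy; apply: le_trans (h _).
have [q0 qD qZ] := sq.
have tri (a b' : E) : q a - q b' <= q (a - b').
  by rewrite lerBlDr; have := qD (a - b') b'; rewrite subrK.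
have sym (a b' : E) : q (a - b') = q (b' - a).
  have -> : a - b' = -1 *: (b' - a) by rewrite scaleN1r opprB.
  by rewrite qZ normrN1 mul1r.
rewrite real_ler_norml ?realB ?ger0_real//; apply/andP; split; last by rewrite sym; exact: tri.
by rewrite lerNl opprB; exact: tri.
Qed.

End seminormed_continuity.

(** * Beurling and Roumieu spaces *)

Section direct_sum_of_steps.
Variables (R : realType) (d : nat).
Variables (M : weight_sequence_system R d) (W : weight_function_system R d).
Variable mu : nat -> {posnum R}.
Local Notation K := R[i].
Local Notation fn := ('rV[R]_d -> K).

Definition finite_steps : {pred nat -> fn} :=
  [pred x | `[< (forall N, gs_step M W (mu N) (x N)) /\
                exists n, forall N, (n <= N)%N -> x N = 0 >]].

Lemma finite_steps_submod_closed : submod_closed finite_steps.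
Proof.
split=> [|a x y].
  rewrite inE; split; last by exists 0%N.
  by move=> N; have [] := gs_step_submod M W (mu N).
rewrite !inE => -[sx [n hn]] [sy [m hm]]; split.
  move=> N; have [_ gD gZ] := gs_step_submod M W (mu N).
  by apply: gD; [apply: gZ; exact: sx|exact: sy].
exists (maxn n m) => N; rewrite geq_max => /andP[nN mN].
by rewrite -[(a *: x + y) N]/(a *: x N + y N) hn// hm// scaler0 addr0.
Qed.

HB.instance Definition _ :=
  GRing.isSubmodClosed.Build _ _ finite_steps finite_steps_submod_closed.

Record step_sum := StepSum { step_val :> nat -> fn; _ : step_val \in finite_steps }.
HB.instance Definition _ := [isSub for step_val].
HB.instance Definition _ := [Choice of step_sum by <:].
HB.instance Definition _ := [SubChoice_isSubLmodule of step_sum by <:].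

Lemma step_sumP (x : step_sum) : (forall N, gs_step M W (mu N) (x N)) /\
  exists n, forall N, (n <= N)%N -> x N = 0.
Proof. by case: x => x /=; rewrite inE. Qed.

Lemma step_val_linear N : linear (fun x : step_sum => x N).
Proof. by []. Qed.

Definition component N : {linear step_sum -> fn} := HB.pack (fun x : step_sum => x N)
  (GRing.isLinear.Build _ _ _ _ _ (step_val_linear N)).

Lemma roumieu_mem lam (phi : fn) : gs_step M W lam phi -> phi \in gs_pred M W Roumieu.
Proof. by move=> h; rewrite inE; exists lam. Qed.

Definition to_roumieu N (x : step_sum) : gs M W Roumieu :=
  Gs (roumieu_mem ((step_sumP x).1 N)).

Lemma to_roumieu_linear N : linear (to_roumieu N).
Proof. by move=> a x y; apply/val_inj. Qed.

Definition component_roumieu N : {linear step_sum -> gs M W Roumieu} :=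
  HB.pack (to_roumieu N) (GRing.isLinear.Build _ _ _ _ _ (to_roumieu_linear N)).

Lemma component_roumieu0 N x : component N x = 0 -> component_roumieu N x = 0.
Proof. by move=> h; apply/val_inj. Qed.

Definition support_bound (x : step_sum) : nat := sval (cid (step_sumP x).2).

Definition total (x : step_sum) : gs M W Roumieu :=
  \sum_(0 <= N < support_bound x) component_roumieu N x.

(** Any bound of the support gives the same sum, so two vectors and their combination can be summed
    over a common range. *)
Lemma totalE x n : (forall N, (n <= N)%N -> component N x = 0) ->
  total x = \sum_(0 <= N < n) component_roumieu N x.
Proof.
have ext m m' : (m <= m')%N -> (forall N, (m <= N)%N -> component N x = 0) ->
    \sum_(0 <= N < m') component_roumieu N x = \sum_(0 <= N < m) component_roumieu N x.
  move=> mm h; rewrite (@big_cat_nat _ _ _ m)//= [X in _ + X]big_nat [X in _ + X]big1 ?addr0//.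
  by move=> N /andP[mN _]; apply: component_roumieu0; exact: h.
have hb : forall N, (support_bound x <= N)%N -> component N x = 0.
  exact: (svalP (cid (step_sumP x).2)).
rewrite /total => h; have [le|lt] := leqP (support_bound x) n; first by rewrite (ext _ _ le hb).
by rewrite (ext _ _ (ltnW lt) h).
Qed.

Lemma total_linear : linear total.
Proof.
move=> a x y; have [n hn] := (step_sumP x).2; have [m hm] := (step_sumP y).2.
have hx N : (maxn n m <= N)%N -> component N x = 0.
  by rewrite geq_max => /andP[nN _]; exact: hn.
have hy N : (maxn n m <= N)%N -> component N y = 0.
  by rewrite geq_max => /andP[_ mN]; exact: hm.
have hxy N : (maxn n m <= N)%N -> component N (a *: x + y) = 0.
  by move=> h; rewrite linearP hx// hy// scaler0 addr0.
rewrite (totalE hx) (totalE hy) (totalE hxy) scaler_sumr -big_split /=.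
by apply: eq_bigr => N _; exact: (linearP (component_roumieu N)).
Qed.

Definition total_map : {linear step_sum -> gs M W Roumieu} :=
  HB.pack total (GRing.isLinear.Build _ _ _ _ _ total_linear).

Lemma single_mem N (phi : fn) : gs_step M W (mu N) phi ->
  (fun m => if m == N then phi else 0) \in finite_steps.
Proof.
move=> h; rewrite inE; split.
  by move=> m; case: eqP => [->//|_]; have [] := gs_step_submod M W (mu m).
by exists N.+1 => m Nm; rewrite gtn_eqF.
Qed.

Definition single N phi (h : gs_step M W (mu N) phi) : step_sum := StepSum (single_mem h).

Lemma total_single N (phi : gs M W Roumieu) (h : gs_step M W (mu N) phi) :
  total (single h) = phi.
Proof.
rewrite (@totalE _ N.+1); last by move=> m Nm; rewrite /= gtn_eqF.
rewrite big_nat_recr//= big_nat big1 ?add0r => [|m /andP[_ mN]].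
  by apply/val_inj; rewrite /= eqxx.
by apply: component_roumieu0; rewrite /= ltn_eqF.
Qed.

End direct_sum_of_steps.

(** * Nuclearity in the Beurling and the Roumieu case *)

Section gelfand_shilov_nuclear.
Variables (R : realType) (d : nat).
Variables (M : weight_sequence_system R d) (W : weight_function_system R d).
Local Notation K := R[i].
Local Notation fn := ('rV[R]_d -> K).
Implicit Types (lam mu : {posnum R}).

Lemma gs_normR_anti lam mu (phi : fn) : lam%:num <= mu%:num -> gs_step M W lam phi ->
  gs_normR M W mu phi <= gs_normR M W lam phi.
Proof.
move=> lm h; apply: gs_normR_le; rewrite -gs_normRE//.
exact: gs_norm_anti.
Qed.

(** Each [b n] is at most [B], so all [g n phi] are bounded by [B] times the [mu] norm, and this
    bounds the [lam] norm. *)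
Lemma nuclear_step_sub lam mu (phi : fn) : nuclear_step M W lam mu ->
  gs_step M W mu phi -> gs_step M W lam phi.
Proof.
move=> [g [b [B [b0 bB _ h1 h2]]]] sphi; have [s _] := sphi; split=> //.
apply: le_lt_trans (h2 _ (B * gs_normR M W mu phi) s _) (ltry _) => n.
apply: le_trans (h1 n _ (gs_normR M W mu phi) s _) _; first by rewrite gs_normRE.
rewrite ler_wpM2r ?gs_normR_ge0//; apply: le_trans (bB n.+1).
by rewrite big_nat_recr//= lerDr sumr_ge0// => i _; exact: ltW.
Qed.

Lemma beurling_step lam (phi : gs M W Beurling) : gs_step M W lam phi.
Proof. by case: phi => phi /=; rewrite inE => /(_ lam I). Qed.

Lemma beurling_finite_sum_le (s : seq {p | in_seminorms (gs_seminorms M W Beurling) p}) :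
  exists lam (C : R), 0 < C /\ forall phi, finite_sum s phi <= (C * gs_normR M W lam phi)%:C%C.
Proof.
elim: s => [|[p /= [mu pE]] s [lam [C [C0 h]]]].
  exists 1%:pos, 1; split=> // phi; rewrite /finite_sum big_nil ler0c mul1r.
  exact: gs_normR_ge0.
exists (Num.min lam%:num mu%:num)%:pos, (1 + C); split; first by rewrite addr_gt0.
move=> phi; rewrite /finite_sum big_cons /= pE mulrDl mul1r rmorphD lerD//.
  by rewrite lecR; apply: gs_normR_anti; [rewrite /= ge_min lexx orbT|exact: beurling_step].
apply: le_trans (h phi) _; rewrite lecR ler_pM2l//.
by apply: gs_normR_anti; [rewrite /= ge_min lexx|exact: beurling_step].
Qed.

Lemma roumieu_finite_sum_le (s : seq {p | in_seminorms (gs_seminorms M W Roumieu) p}) lam :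
  exists2 C : R, 0 < C & forall phi : gs M W Roumieu, gs_step M W lam phi ->
    finite_sum s phi <= (C * gs_normR M W lam phi)%:C%C.
Proof.
elim: s => [|[p /= [sp hp]] s [C C0 h]].
  exists 1 => // phi _; rewrite /finite_sum big_nil ler0c mul1r.
  exact: gs_normR_ge0.
have [D D0 hD] := hp lam.
have DE := ge0_realC (ltW D0).
have DR : 0 < complex.Re D by rewrite -ltcR -DE; exact: D0.
exists (complex.Re D + C) => [|phi sphi]; first by rewrite addr_gt0.
rewrite /finite_sum big_cons /= mulrDl rmorphD lerD//; last exact: h.
by rewrite rmorphM /= -DE; exact: hD.
Qed.

Local Notation EB := (gelfand_shilov M W Beurling).
Local Notation ER := (gelfand_shilov M W Roumieu).

Lemma beurling_nuclear : (forall lam, exists mu, nuclear_step M W lam mu) ->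
  nuclear_space EB.
Proof.
move=> hs p sp cp.
have [s [C0 [C0_gt0 hC]]] := continuous_seminorm_dominated sp cp.
have [lam [C1 [C1_gt0 hC1]]] := beurling_finite_sum_le s.
have [mu h12] := hs lam; have [nu h23] := hs mu.
pose C := C0 * C1.
have C_gt0 : 0 < C by rewrite mulr_gt0.
have p_le (phi : gs M W Beurling) : p phi <= (C * gs_normR M W lam phi)%:C%C.
  apply: le_trans (hC phi) _; rewrite /C -mulrA rmorphM /= ler_pM2l ?ltcR//.
have lin_val : linear (fun phi : gs M W Beurling => (phi : fn)) by [].
pose val1 : {linear gs M W Beurling -> fn} := HB.pack (fun phi : gs M W Beurling => (phi : fn))
  (GRing.isLinear.Build _ _ _ _ _ lin_val).
(* A single step suffices here: the surjection is the identity and the only nonzero component has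
   index 0. *)
pose comp (N : nat) : {linear gs M W Beurling -> fn} := if N is 0 then val1 else \0.
have [q [D [sq pq D0 hq nuc]]] : exists (q : gs M W Beurling -> K) (D : nat -> R),
  [/\ seminorm q, forall phi, p phi <= q phi, forall N, 0 <= D N,
    forall (x : gs M W Beurling) n, (forall N, (n <= N)%N -> comp N x = 0) ->
      q x <= p x + (\sum_(0 <= N < n) D N * gs_normR M W nu (comp N x))%:C%C
  & forall (X Y : completeNormedModType K) (i : {linear gs M W Beurling -> X}) (j : {linear gs M W Beurling -> Y}),
      is_completion q i -> is_completion p j ->
      exists T : {linear X -> Y}, (forall x, T (i x) = j x) /\ nuclear_operator T].
  apply: (nuclear_from_steps (S := idfun) (lam1 := fun=> lam) (lam2 := fun=> mu)
    (lam3 := fun=> nu) (C := fun=> C)) => //.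
  - by move=> y; exists y.
  - move=> [|N] x; first exact: beurling_step.
    by have [] := gs_step_submod M W nu.
  - by move=> x; exists 1%N => -[].
  (* For an empty range the hypothesis makes component 0 vanish, so the norm bounding [p x] is 0. *)
  - move=> x [|n] hx.
      apply: le_trans (p_le x) _; rewrite big_geq// lecR.
      have /= := hx 0%N erefl => ->.
      by rewrite gs_normR0 mulr0.
    apply: le_trans (p_le x) _; rewrite lecR big_nat_recl//= lerDl.
    by apply: sumr_ge0 => N _; rewrite mulr_ge0 ?gs_normR_ge0// ltW.
exists q; split; [exact sq| |exact pq|exact nuc].
pose sn l : {p | in_seminorms (gs_seminorms M W Beurling) p} :=
  exist _ (gs_normC M W l \o (@gs_val _ _ _ _ _)) (ex_intro _ l erefl).
apply: (@dominated_seminorm_continuous _ _ _ q [:: sn lam; sn nu] (C + D 0%N)) => //.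
  by rewrite ltr_wpDr.
move=> x; apply: le_trans (hq x 1%N _) _; first by case.
rewrite big_nat1 /finite_sum !big_cons big_nil addr0 /=.
apply: le_trans (lerD (p_le x) (lexx _)) _.
rewrite -[gs_normC M W lam x]/((gs_normR M W lam x)%:C%C) -[gs_normC M W nu x]/((gs_normR M W nu x)%:C%C).
rewrite -!rmorphD -rmorphM lecR mulrDl !mulrDr -addrA lerD2l.
have := gs_normR_ge0 M W lam x; have := gs_normR_ge0 M W nu x => h1 h2.
have a1 := mulr_ge0 (ltW C_gt0) h1; have a2 := mulr_ge0 (D0 0%N) h2.
by rewrite addrA lerDr addr_ge0.
Qed.

(** The topology is generated by all seminorms bounded on each step, so [q] is continuous as soon as
    it belongs to that family; an estimate on one step at a time is enough. *)
Lemma roumieu_nuclear : (forall mu, exists lam, nuclear_step M W lam mu) ->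
  nuclear_space ER.
Proof.
move=> hs p sp cp.
have [s [C0 [C0_gt0 hC]]] := continuous_seminorm_dominated sp cp.
have [L hL] := choice hs.
(* The steps of index N+1 are cofinal, so countably many exhaust the space. *)
pose mu (N : nat) : {posnum R} := PosNum (ltr0Sn R N).
have /choice[C1 hC1] N : exists C1 : R, 0 < C1 /\ forall phi : gs M W Roumieu,
    gs_step M W (L (L (mu N))) phi ->
    finite_sum s phi <= (C1 * gs_normR M W (L (L (mu N))) phi)%:C%C.
  by have [C1 h1 h2] := roumieu_finite_sum_le s (L (L (mu N))); exists C1.
pose C N := C0 * C1 N.
have C_gt0 N : 0 < C N by rewrite mulr_gt0//; have [] := hC1 N.
have p_le N (phi : gs M W Roumieu) : gs_step M W (L (L (mu N))) phi ->
    p phi <= (C N * gs_normR M W (L (L (mu N))) phi)%:C%C.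
  move=> sphi; apply: le_trans (hC phi) _; rewrite /C -mulrA rmorphM /= ler_pM2l ?ltcR//.
  by have [_] := hC1 N; exact.
have archi lam : exists N, lam%:num <= (mu N)%:num.
  exists (Num.trunc lam%:num); apply: ltW.
  have l0 : 0 <= lam%:num by [].
  by have /andP[_ h] := truncn_itv l0.
have in_step (phi : gs M W Roumieu) : exists N, gs_step M W (mu N) phi.
  case: phi => phi /=; rewrite inE => -[lam _ h].
  by have [N hN] := archi lam; exists N; exact: gs_step_mono hN _ h.
have [q [D [sq pq D0 hq nuc]]] : exists (q : gs M W Roumieu -> K) (D : nat -> R),
  [/\ seminorm q, forall phi, p phi <= q phi, forall N, 0 <= D N,
    forall (x : step_sum M W mu) n, (forall N, (n <= N)%N -> component M W mu N x = 0) ->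
      q (total_map M W mu x) <= p (total_map M W mu x) +
        (\sum_(0 <= N < n) D N * gs_normR M W (mu N) (component M W mu N x))%:C%C
  & forall (X Y : completeNormedModType K) (i : {linear gs M W Roumieu -> X}) (j : {linear gs M W Roumieu -> Y}),
      is_completion q i -> is_completion p j ->
      exists T : {linear X -> Y}, (forall x, T (i x) = j x) /\ nuclear_operator T].
  apply: (nuclear_from_steps (S := total_map M W mu) (lam1 := fun N => L (L (mu N))) (lam2 := fun N => L (mu N)) (C := C)) => //.
  - move=> phi; have [N h] := in_step phi; exists (single h).
    exact: total_single.
  - by move=> N x; exact: (step_sumP x).1.
  - by move=> x; exact: (step_sumP x).2.
  - move=> x n hx; rewrite /= (totalE hx).
    have [_ pD _] := sp.
    elim: (n) => [|m IH]; first by rewrite !big_geq// (seminorm0 sp).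
    rewrite !big_nat_recr//= rmorphD; apply: le_trans (pD _ _) _; rewrite lerD//.
    apply: p_le; apply: nuclear_step_sub (hL _) _; apply: nuclear_step_sub (hL _) _.
    exact: (step_sumP x).1.
exists q; split; [exact sq| |exact pq|exact nuc].
(* An element of the step [lam] is the image of a vector with one component, at an index [N] with
   [lam <= mu N], so only the term [D N] of the bound on [q] remains. *)
have q_in : in_seminorms (gs_seminorms M W Roumieu) q.
  split=> // lam; have [N hN] := archi lam.
  have [C' C'0 hC'] := roumieu_finite_sum_le s lam.
  exists ((C0 * C' + D N)%:C)%C; first by rewrite ltcR ltr_wpDr// mulr_gt0.
  move=> phi sphi; have h := gs_step_mono hN sphi.
  have := hq (single h) N.+1; rewrite /= (total_single h) => /(_ _) /le_trans -> //.
    by move=> m Nm; rewrite gtn_eqF.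
  rewrite big_nat_recr//= big_nat big1 ?add0r => [|m /andP[_ mN]]; last first.
    by rewrite ltn_eqF// gs_normR0 mulr0.
  rewrite eqxx -[gs_normC M W lam phi]/((gs_normR M W lam phi)%:C%C).
  apply: le_trans (lerD (hC phi) (lexx _)) _.
  rewrite -rmorphM mulrDl rmorphD lerD//; last first.
    by rewrite lecR ler_wpM2l//; exact: gs_normR_anti.
  by rewrite -mulrA [leRHS]rmorphM /= ler_pM2l ?ltcR//; exact: hC'.
apply: (@dominated_seminorm_continuous _ _ (gs_seminorms M W Roumieu) q [:: exist _ q q_in] 1) => //.
by move=> x; rewrite /finite_sum big_seq1 mul1r.
Qed.

End gelfand_shilov_nuclear.

Theorem theorem5p1 (R : realType) (d : nat) (d_gt0 : (0 < d)%N) (c : bracket)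
    (M : weight_sequence_system R d) (W : weight_function_system R d) :
  cond_L c M -> cond_M2' c M -> cond_wM c W -> cond_N c W ->
  nuclear_space (gelfand_shilov M W c).
Proof.
move=> hL hM hwM hN; have := nuclear_step_bracketed d_gt0 hL hM hwM hN.
by case: c {hL hM hwM hN}; [exact: beurling_nuclear|exact: roumieu_nuclear].
Qed.
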